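(* Let $\mathcal H=\{h_1,\dots,h_k\}$ be an admissible set, and let $0\le \ell_1,\ell_2\le k$ be integers. If $R\le N^{1/2-\epsilon}$, then \[ \sum_{N<n\le 2N}\Lambda_R(n;\mathcal H,\ell_1)\Lambda_R(n;\mathcal H,\ell_2) =\binom{\ell_1+\ell_2}{\ell_1}\mathfrak S(\mathcal H)\,N\,\frac{(\log R)^{k+\ell_1+\ell_2}}{(k+\ell_1+\ell_2)!}\Big\{1+O\Big(\frac{\beta(\mathcal H)\mathfrak S(\mathcal H)}{\log R}\Big)\Big\}, \] where the implied constant depends at most on $k$.
   Context: $\mathcal H=\{h_1,\dots,h_k\}$ is a set of $k\ge 2$ distinct integers, and $P(n;\mathcal H)=\prod_{h\in\mathcal H}(n+h)$. For squarefree $d$, let $\nu_d=\nu_d(\mathcal H)$ be the number of residue classes $a$ mod $d$ with $P(a;\mathcal H)\equiv 0 \pmod d$. Thus $\nu_p$ is the number of distinct residue classes mod $p$ occupied by $\mathcal H$, and $\nu_d=\prod_{p\mid d}\nu_p$. The set $\mathcal H$ is admissible if $\nu_p<p$ for every prime $p$. Define \[ \mathfrak S(\mathcal H)=\prod_p\Big(1-\frac{\nu_p}{p}\Big)\Big(1-\frac1p\Big)^{-k},\qquad \beta(\mathcal H)=\sum_p\frac{(k-\nu_p)\log p}{p}. \] For squarefree $d$, let $f(d)=d/\nu_d$ and $f_1(d)=\prod_{p\mid d}\frac{p-\nu_p}{\nu_p}$, so that $f_1=f*\mu$ on squarefree integers. For $R>1$ and an integer $0\le\ell\le k$, define \[ \lambda_{d,\ell}=\mu(d)\frac{f(d)}{f_1(d)}\frac{\mathfrak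 S(\mathcal H)}{\ell!}\sum_{\substack{r<R/d\\ (r,d)=1}}\frac{\mu^2(r)}{f_1(r)}\Big(\log\frac{R}{rd}\Big)^{\ell}\quad\text{for } d<R, \] and $\lambda_{d,\ell}=0$ for $d\ge R$. Finally, $\Lambda_R(n;\mathcal H,\ell)=\sum_{d\mid P(n;\mathcal H)}\lambda_{d,\ell}$. Here $N,R\to\infty$. *)

(* Defs.v *)
From HB Require Import structures.
From mathcomp Require Import all_boot all_order all_algebra.
From mathcomp Require Import all_classical all_reals all_analysis.
Set Implicit Arguments. Unset Strict Implicit. Unset Printing Implicit Defensive.
Import Order.TTheory GRing.Theory Num.Theory.
Import numFieldNormedType.Exports.
Local Open Scope ring_scope.

(* Moebius function on positive integers (mu 0 := 0, irrelevant). *)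
Definition mobius (d : nat) : int :=
  if (d == 0)%N then 0
  else if all (fun p => logn p d == 1)%N (primes d) then (-1) ^+ size (primes d)
  else 0.

Definition Ppoly (H : seq int) (n : int) : int := \prod_(h <- H) (n + h).

Definition nu (H : seq int) (d : nat) : nat :=
  count (fun a => (d%:Z %| Ppoly H a%:Z)%Z) (iota 0 d).

Definition admissible (H : seq int) : Prop :=
  forall p : nat, prime p -> (nu H p < p)%N.

Section Defs.
Variable RT : realType.

Definition ff (H : seq int) (d : nat) : RT := d%:R / (nu H d)%:R.

Definition f1 (H : seq int) (d : nat) : RT :=
  \prod_(p <- primes d) ((p%:R - (nu H p)%:R) / (nu H p)%:R).

Definition singser (H : seq int) : RT :=
  limn (fun n : nat => \prod_(p < n | prime p)
     ((1 - (nu H p)%:R / p%:R) * (1 - 1 / p%:R) ^- size H) : RT).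

Definition betaH (H : seq int) : RT :=
  limn (fun n : nat => \sum_(p < n | prime p)
     (((size H)%:R - (nu H p)%:R) * ln p%:R / p%:R) : RT).

Definition lam (H : seq int) (R : RT) (l d : nat) : RT :=
  if d%:R < R then
    (mobius d)%:~R * ff H d / f1 H d * singser H / (l`!)%:R *
    \sum_(r < (Num.truncn R).+1 | (0 < r)%N && (r%:R * d%:R < R) && coprime r d)
       ((mobius r)%:~R ^+ 2 / f1 H r * ln (R / (r%:R * d%:R)) ^+ l)
  else 0.

(* Lambda_R(n; H, l) = sum_{d | P(n;H)} lambda_{d,l}; since lambda_{d,l} = 0
   for d >= R, the sum runs over the positive divisors d <= truncn R. *)
Definition LambdaR (H : seq int) (R : RT) (l : nat) (n : int) : RT :=
  \sum_(d < (Num.truncn R).+1 | (0 < d)%N && (d%:Z %| Ppoly H n)%Z) lam H R l d.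

End Defs.

(* Main.v *)
(** Write [g(r) = mu^2(r) / f_1(r)], [u = log R] and
    [G_l(u) = sum_(r < R) g(r) (log (R/r))^l].  Selberg diagonalisation turns the
    left-hand side into [N S(H)^2 / (l1! l2!) G_(l1+l2)(u)] plus a remainder
    [O(S(H)^2 u^(l1+l2) G_0(u)^4 R^2)], which is negligible because [N >= R^(2 + 4 eps)].

    To evaluate [G_l] uniformly in [H], expand [log r = sum_(p | r) log p] and use
    Mertens' theorem together with [g(p) / (1 + g(p)) = nu_p / p]: this gives
    [|u G_0(u) - (k + 1) G_1(u)| <= B G_0(u)] with [B = O_k(1) + beta(H)], and
    integrating, [|(l+1) u G_l(u) - (k + l + 1) G_(l+1)(u)| <= (l+1) B G_l(u)].
    Since [G_(l+1)' = (l+1) G_l], the quotients [G_l(u) / (u - B)^(k+l)] and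
    [G_l(u) / (u + B)^(k+l)] are monotone in opposite directions for [l >= 1]; hence
    both are compared with [c_l = lim G_l(u) / u^(k+l)], so that
    [c_l (u - B)^(k+l) <= G_l(u) <= c_l (u + B)^(k+l)].

    The limit is found by replacing, one prime at a time, the Euler factor of
    [zeta(1 + s)^k] by that of [g]: each step multiplies the limit by
    [(1 + g(p)) (1 - 1/p)^k], and the steps at large primes change the sums by
    a factor [1 + O(1/p^2)] uniformly in [u].  The result is [1 / (k! S(H))]. *)

Require Import Defs.
From HB Require Import structures.
From mathcomp Require Import all_boot all_order all_algebra.
From mathcomp Require Import all_classical all_reals all_analysis.
From mathcomp Require Import ring lra zify.
Import Order.TTheory GRing.Theory Num.Theory.
Import numFieldNormedType.Exports.
Local Open Scope ring_scope.

(** * Chebyshev and Mertens estimates *)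

(** Uniformity in [H] rests on three facts that depend on [k] only. As [nu_p <= k], the side [s = 1]
    of the logarithmic relation holds with a constant [cA] free of beta, which bounds [G_0(u)] by
    [O_k(u^k)] from a fixed point on. Admissibility gives [S(H) >= cS > 0]. At the prime 2, together
    with [k >= 2], it gives [beta(H) >= ln 2 / 2]. Hence [O_k(1)] is absorbed into [beta(H)], the
    factor [S(H)] in the error costs nothing, and for [u < 2 B] the claimed relative error exceeds a
    constant, so that the growth bound is enough there.

    [G_0] is a step function, so the argument by derivatives can start only at [G_1]; bounds for
    [G_0] are read off from those for [G_1] through the relation.

    The leading constant involves two limits, over the primes and over [u]. They may be exchanged
    because the comparison at large primes is uniform in [u]. This comparison works with
    nondecreasing summatory functions and operators on them in place of Dirichlet series:
    monotonicity is what bounds the effect of the shifts by [ln p]. *)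

Lemma prime_dvd_fact (p n : nat) : prime p -> (p %| n`!)%N = (p <= n)%N.
Proof.
move=> pp; apply/idP/idP => [|le]; last by rewrite dvdn_fact // prime_gt0.
elim: n => [|n IH]; first by rewrite dvdn1 => /eqP e; rewrite e in pp.
rewrite factS Euclid_dvdM // => /orP[/dvdn_leq|/IH/leqW//]; exact.
Qed.

Lemma prod_primes_dvd (a K X : nat) :
  (forall p, (a <= p < K)%N -> prime p -> (p %| X)%N) ->
  (\prod_(a <= p < K | prime p) p %| X)%N.
Proof.
elim: K => [|K IH] dX; first by rewrite big_geq.
have [lt|le] := ltnP K a; first by rewrite big_geq.
rewrite big_mkcond big_nat_recr //= -big_mkcond /=.
have IH' : (\prod_(a <= p < K | prime p) p %| X)%N.
  by apply: IH => p /andP[ap pK]; apply: dX; rewrite ap ltnW.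
case: ifPn => pK; last by rewrite muln1.
rewrite Gauss_dvd ?IH' ?dX ?le ?ltnSn //.
rewrite coprime_sym prime_coprime //; apply/negP; rewrite big_seq_cond.
elim/big_rec : _ => [|i x /andP[]].
  by rewrite dvdn1 => /eqP e; rewrite e in pK.
rewrite mem_index_iota => /andP[i1 i2] pi' IHx; rewrite Euclid_dvdM //.
by case/orP => [|//]; rewrite dvdn_prime2 // => /eqP e; rewrite e ltnn in i2.
Qed.

(** The equal coefficients at [h] and [h.+1] both occur in a row whose sum is [2 * 4 ^ h]. *)
Lemma bin_middle_le (h : nat) : ('C(h.*2.+1, h) <= 4 ^ h)%N.
Proof.
have e : (2 ^ (h.*2.+1) = \sum_(i < h.*2.+2) 'C(h.*2.+1, i))%N.
  rewrite -[2%N]/(1 + 1)%N expnDn; apply: eq_bigr => i _.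
  by rewrite !exp1n !muln1.
have lh : (h < h.*2.+2)%N by rewrite -addnn; lia.
have lh1 : (h.+1 < h.*2.+2)%N by rewrite -addnn; lia.
have ne : Ordinal lh1 != Ordinal lh by rewrite -val_eqE /= neq_ltn ltnSn orbT.
have e4 : (2 ^ (h.*2.+1) = 2 * 4 ^ h)%N by rewrite expnS -mul2n expnM.
move: e; rewrite e4 (bigD1 (Ordinal lh)) //= (bigD1 (Ordinal lh1)) //=.
have -> : 'C(h.*2.+1, h.+1) = 'C(h.*2.+1, h).
  by rewrite -bin_sub ?ltnS -?addnn ?leq_addr //; congr binomial; lia.
lia.
Qed.

(** Induction of Erdos: an even [n > 2] contributes no prime; for [n = 2h+1] the primes from [h+2]
    to [n] all divide the middle binomial coefficient, which costs [4 ^ h], and the others cost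
    [4 ^ h.+1] by induction. *)
Lemma primorial_le (n : nat) : (\prod_(0 <= p < n.+1 | prime p) p <= 4 ^ n)%N.
Proof.
elim/ltn_ind: n => n IH.
have [n2|n2] := leqP n 2.
  by case: n n2 {IH} => [|[|[|]]] // _; rewrite big_mkcond !big_nat_recr //= big_geq.
have [odn|odn] := boolP (odd n); last first.
  case: n IH n2 odn => // n IH n2 odn.
  rewrite big_mkcond big_nat_recr //= -big_mkcond /= ifF ?muln1.
    by apply: leq_trans (IH n _) _ => //; rewrite leq_exp2l.
  by apply/negP => /even_prime[e|]; [lia|rewrite (negPf odn)].
set h := n./2; have hn : n = h.*2.+1 by rewrite -[LHS](odd_double_half n) odn.
have h0 : (0 < h)%N by rewrite hn -addnn in n2; lia.
rewrite (@big_cat_nat _ _ _ h.+2) //=; last by rewrite hn -addnn; lia.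
have -> : (4 ^ n = 4 ^ h.+1 * 4 ^ h)%N by rewrite -expnD hn -addnn; congr expn; lia.
apply: leq_mul; first by apply: IH; rewrite hn -addnn; lia.
apply: leq_trans (bin_middle_le h); apply: dvdn_leq.
  by rewrite bin_gt0 -addnn; lia.
apply: prod_primes_dvd => p; rewrite hn => /andP[hp pn] pp.
have hle : (h <= h.*2.+1)%N by rewrite -addnn; lia.
have := prime_dvd_fact p (h.*2.+1) pp; rewrite -(bin_fact hle) !Euclid_dvdM //.
rewrite !prime_dvd_fact //.
have -> : (p <= h.*2.+1)%N by [].
case: (p %| _)%N => //= ; rewrite -addnn => /idP; rewrite -addnn in pn; lia.
Qed.

Section Mertens.
Variable RT : realType.
Implicit Types (n p : nat).

Lemma ln_nat_ge0 n : 0 <= ln (n%:R : RT).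
Proof.
case: n => [|n]; first by rewrite ln0.
by rewrite ln_ge0 // ler1n.
Qed.

(** The bound [K] is kept free so that the primes of many [n] run over one common range; sums over
    [n] and [p] can then be exchanged. *)
Lemma ln_nat_logn n K : (0 < n)%N -> (forall p, prime p -> (p %| n)%N -> (p < K)%N) ->
  ln (n%:R : RT) = \sum_(p < K | prime p) (logn p n)%:R * ln (p%:R).
Proof.
move=> n0 nK.
rewrite {1}(prod_prime_decomp n0) prime_decompE big_map /=.
have -> : ln ((\prod_(j <- primes n) j ^ logn j n)%N%:R : RT) =
   \sum_(j <- primes n) (logn j n)%:R * ln (j%:R).
  have : all prime (primes n) by apply/allP => p; rewrite mem_primes => /andP[].
  elim: (primes n) => [|q s IH] /=; first by rewrite !big_nil ln1.
  case/andP => pq ps; have q0 : 0 < ((q ^ logn q n)%N%:R : RT).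
    by rewrite ltr0n expn_gt0 prime_gt0.
  have r0 : 0 < ((\prod_(j <- s) j ^ logn j n)%N%:R : RT).
    rewrite ltr0n big_seq_cond; apply: prodn_cond_gt0 => i /andP[/(allP ps)/prime_gt0 i0 _].
    by rewrite expn_gt0 i0.
  rewrite !big_cons natrM lnM ?posrE // IH //.
  by rewrite natrX lnXn ?ltr0n ?prime_gt0 // mulr_natl.
rewrite -(big_mkord prime (fun p => (logn p n)%:R * ln (p%:R : RT))).
rewrite [RHS](bigID (fun p => p \in primes n)) /= [X in _ + X]big1 ?addr0; last first.
  move=> i /andP[pi']; rewrite mem_primes pi' n0 /= => nd.
  by rewrite -[logn i n]/((logn i n)%N) lognE pi' n0 (negPf nd) mul0r.
rewrite -[RHS]big_filter; apply: perm_big.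
apply: uniq_perm; rewrite ?primes_uniq ?filter_uniq ?iota_uniq // => p.
rewrite mem_filter mem_index_iota mem_primes /= n0 /=.
case: (boolP (prime p)) => //= pp; case: (boolP (p %| n)%N) => //= pd.
by rewrite nK.
Qed.

Lemma ln_fact_le n : ln ((n`!)%:R : RT) <= n%:R * ln n%:R.
Proof.
elim: n => [|n IH]; first by rewrite mul0r ln1.
rewrite factS natrM lnM ?posrE ?ltr0n ?fact_gt0 //.
have -> : (n.+1%:R : RT) * ln n.+1%:R = ln n.+1%:R + n%:R * ln n.+1%:R.
  by rewrite -{1}natr1 mulrDl mul1r addrC.
rewrite lerD2l (le_trans IH) // ler_wpM2l //.
case: (n) => [|m]; first by rewrite ln0 // ln1.
by rewrite ler_ln ?posrE ?ltr0n // ler_nat.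
Qed.

Lemma ln_fact_ge n : n%:R * ln n%:R - n%:R <= ln ((n`!)%:R : RT).
Proof.
elim: n => [|n IH]; first by rewrite !mul0r subrr ln1.
rewrite factS natrM lnM ?posrE ?ltr0n ?fact_gt0 //.
case: n IH => [|n] IH; first by rewrite fact0 !ln1; lra.
have : ln (n.+2%:R : RT) - ln n.+1%:R <= n.+1%:R^-1.
  rewrite -ln_div ?posrE ?ltr0n //.
  have -> : n.+2%:R / n.+1%:R = 1 + n.+1%:R^-1 :> RT.
    by rewrite -[n.+2]addn1 natrD mulrDl divff ?pnatr_eq0 // mul1r.
  by apply: le_ln1Dx; rewrite (lt_trans (ltrN10 _)) // invr_gt0 ltr0n.
move=> /(ler_wpM2l (ler0n RT n.+1)); rewrite divff ?pnatr_eq0 // => hh.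
have -> : (n.+2%:R : RT) * ln n.+2%:R = ln n.+2%:R + n.+1%:R * ln n.+2%:R.
  by rewrite -{1}natr1 mulrDl mul1r addrC.
have -> : n.+2%:R = n.+1%:R + 1 :> RT by rewrite natr1.
rewrite natr1; lra.
Qed.

Lemma theta_le n : \sum_(p < n.+1 | prime p) ln (p%:R : RT) <= n%:R * ln 4.
Proof.
rewrite mulr_natl -lnXn // -natrX.
rewrite -(big_mkord prime (fun p => ln (p%:R : RT))).
have -> : \sum_(0 <= p < n.+1 | prime p) ln (p%:R : RT) =
   ln ((\prod_(0 <= p < n.+1 | prime p) p)%N%:R).
  suff [] : 0 < ((\prod_(0 <= p < n.+1 | prime p) p)%N%:R : RT) /\
     \sum_(0 <= p < n.+1 | prime p) ln (p%:R : RT) =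
   ln ((\prod_(0 <= p < n.+1 | prime p) p)%N%:R) by [].
  elim/big_rec2: _ => [|p y x pp [y0 ->]]; first by rewrite ln1.
  have p0 : 0 < p%:R :> RT by rewrite ltr0n prime_gt0.
  by rewrite natrM mulr_gt0 // lnM.
rewrite ler_ln ?posrE ?ltr0n ?expn_gt0 //; last first.
  by apply: prodn_cond_gt0 => p /prime_gt0.
by rewrite ler_nat primorial_le.
Qed.

Lemma ln_fact_primes n :
  ln ((n`!)%:R : RT) = \sum_(p < n.+1 | prime p) (logn p n`!)%:R * ln (p%:R).
Proof. by apply: ln_nat_logn; [exact: fact_gt0|move=> p pp; rewrite prime_dvd_fact]. Qed.

(** Legendre's formula, of which the first term is enough; the upper bound that follows sums the
    whole geometric series. *)
Lemma logn_fact_ge n p : prime p -> n%:R / p%:R - 1 <= (logn p n`!)%:R :> RT.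
Proof.
move=> pp; have p0 : 0 < p%:R :> RT by rewrite ltr0n prime_gt0.
have : (n %/ p <= logn p n`!)%N.
  rewrite logn_fact //; case: n => [|n]; first by rewrite div0n.
  by rewrite big_nat_recl // expn1 leq_addr.
rewrite -(ler_nat RT); apply: le_trans.
rewrite lerBlDr ler_pdivrMr // natr1 -natrM ler_nat.
rewrite {1}(divn_eq n p); have := ltn_pmod n (prime_gt0 pp); lia.
Qed.

Lemma logn_fact_le n p : prime p -> (logn p n`!)%:R <= n%:R / (p%:R - 1) :> RT.
Proof.
move=> pp; have p1 : 1 < p%:R :> RT by rewrite ltr1n prime_gt1.
have p0 : 0 < p%:R :> RT by rewrite (lt_trans _ p1).
rewrite logn_fact // natr_sum.
have gs m : \sum_(1 <= i < m.+1) (p%:R : RT) ^- i = (1 - p%:R ^- m) / (p%:R - 1).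
  elim: m => [|m IH]; first by rewrite big_geq // expr0 invr1 subrr mul0r.
  rewrite big_nat_recr //= IH exprS.
  have pm : p%:R ^+ m != 0 :> RT by rewrite expf_neq0 // gt_eqF.
  by field; rewrite pm !gt_eqF // subr_gt0.
apply: (@le_trans _ _ (\sum_(1 <= i < n.+1) n%:R * p%:R ^- i)).
  apply: ler_sum => i _; rewrite ler_pdivlMr ?exprn_gt0 // -natrX -natrM ler_nat.
  exact: leq_trunc_div.
rewrite -mulr_sumr gs ler_wpM2l // ler_pdivrMr ?subr_gt0 // mulVf ?gt_eqF ?subr_gt0 //.
Qed.

Lemma sum_ln_sq_le M : \sum_(n < M | (1 < n)%N) ln (n%:R : RT) / (n%:R * (n%:R - 1)) <= 2.
Proof.
(* The subtracted term imitates the tail integral [(ln x + 1) / x] of [ln x / x^2]. The 2 in place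
   of 1 pays for discretisation and makes the case [m = 0] an equality. *)
suff H m : \sum_(n < m.+2 | (1 < n)%N) ln (n%:R : RT) / (n%:R * (n%:R - 1)) <=
     2 - (ln (m.+1%:R) + 2) / m.+1%:R.
  have [M2|M2] := leqP M 1.
    by rewrite big_pred0 // => i; apply/negP => i1; have := ltn_ord i; lia.
  rewrite -(ltn_predK M2) -(@ltn_predK 0 M.-1); last by lia.
  by apply: le_trans (H _) _; rewrite gerBl divr_ge0 // addr_ge0 // ln_nat_ge0.
elim: m => [|m IH].
  by rewrite big_mkcond !big_ord_recl big_ord0 /= ln1; lra.
rewrite big_mkcond big_ord_recr /= -big_mkcond /=.
apply: le_trans (lerD IH (lexx _)) _.
have -> : m.+2%:R - 1 = m.+1%:R :> RT by rewrite -natr1 addrK.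
have m0 : 0 < m.+1%:R :> RT by rewrite ltr0n.
have h : ln (m.+2%:R : RT) - ln m.+1%:R <= m.+1%:R^-1.
  rewrite -ln_div ?posrE ?ltr0n //.
  have -> : m.+2%:R / m.+1%:R = 1 + m.+1%:R^-1 :> RT.
    by rewrite -[m.+2]addn1 natrD mulrDl divff ?pnatr_eq0 // mul1r.
  by apply: le_ln1Dx; rewrite (lt_trans (ltrN10 _)) // invr_gt0 ltr0n.
rewrite -[m.+2%:R]natr1 in h *.
set x : RT := m.+1%:R in h m0 *.
have x1 : 1 <= x by rewrite /x ler1n.
set a := ln (x + 1) in h *; set b := ln x in h *.
have h2 : (a - b) * (x + 1) <= 2.
  apply: (@le_trans _ _ (x^-1 * (x + 1))); first by rewrite ler_wpM2r //; lra.
  have xV : x^-1 <= 1 by rewrite invf_le1.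
  by rewrite mulrDr mulVf ?gt_eqF // mulr1 lerD2l.
rewrite -subr_ge0.
have -> : 2 - (a + 2) / (x + 1) - (2 - (b + 2) / x + a / ((x + 1) * x)) =
   (2 - (a - b) * (x + 1)) / ((x + 1) * x).
  by field; rewrite !gt_eqF //; lra.
by rewrite divr_ge0 ?mulr_ge0 //; lra.
Qed.

(** [ln n!] is evaluated by Legendre's formula and by Stirling's bounds. The difference is at most
    [theta(n) / n <= ln 4] on one side and at least [-1 - 2] on the other; 4 covers both. *)
Lemma mertens_nat n : (0 < n)%N ->
  `|\sum_(p < n.+1 | prime p) ln (p%:R : RT) / p%:R - ln n%:R| <= 4.
Proof.
move=> n0; have n0' : 0 < n%:R :> RT by rewrite ltr0n.
set S := \sum_(p < _ | _) _.
have up : n%:R * S - \sum_(p < n.+1 | prime p) ln (p%:R : RT) <= n%:R * ln n%:R.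
  apply: le_trans (ln_fact_le n); rewrite ln_fact_primes mulr_sumr -sumrB.
  apply: ler_sum => p pp.
  apply: (@le_trans _ _ ((n%:R / p%:R - 1) * ln p%:R)).
    by rewrite le_eqVlt; apply/orP; left; apply/eqP; ring.
  by rewrite ler_wpM2r ?ln_nat_ge0 // logn_fact_ge.
have lo : n%:R * ln n%:R - n%:R <= n%:R * S + n%:R * 2.
  apply: le_trans (ln_fact_ge n) _; rewrite ln_fact_primes.
  apply: (@le_trans _ _ (n%:R * S + n%:R *
      \sum_(p < n.+1 | (1 < p)%N) ln (p%:R : RT) / (p%:R * (p%:R - 1)))); last first.
    by rewrite lerD2l ler_wpM2l // sum_ln_sq_le.
  apply: (@le_trans _ _ (n%:R * S + n%:R *
      \sum_(p < n.+1 | prime p) ln (p%:R : RT) / (p%:R * (p%:R - 1)))); last first.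
    rewrite lerD2l ler_wpM2l // big_mkcond [leRHS]big_mkcond /=.
    apply: ler_sum => p _; case: ifP => [/prime_gt1->//|_]; case: ifP => // p1.
    by rewrite divr_ge0 ?ln_nat_ge0 // mulr_ge0 // subr_ge0 ler1n ltnW.
  rewrite !mulr_sumr -big_split /=; apply: ler_sum => p pp.
  have p1 : 1 < p%:R :> RT by rewrite ltr1n prime_gt1.
  apply: le_trans (ler_wpM2r (ln_nat_ge0 p) (logn_fact_le n p pp)) _.
  rewrite le_eqVlt; apply/orP; left; apply/eqP; field.
  by rewrite !gt_eqF //; lra.
have ln4 : ln (4 : RT) <= 4 by exact/ltW/ln_sublinear.
have th : \sum_(p < n.+1 | prime p) ln (p%:R : RT) <= n%:R * 4.
  by apply: le_trans (theta_le n) _; rewrite ler_wpM2l.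
have e1 : n%:R * (S - ln n%:R) <= n%:R * 4 by lra.
have e2 : n%:R * (- 4) <= n%:R * (S - ln n%:R) by lra.
by rewrite ler_norml; rewrite !ler_pM2l // in e1 e2; rewrite e1 e2.
Qed.

End Mertens.

Lemma sum_ord_bound (V : nmodType) (P : pred nat) (F : nat -> V) (m n : nat) :
  (forall i, P i -> (i < m)%N) -> (forall i, P i -> (i < n)%N) ->
  \sum_(i < m | P i) F i = \sum_(i < n | P i) F i.
Proof.
wlog le : m n / (m <= n)%N => [H|] Pm Pn.
  by have [/H|/ltnW/H] := leqP m n => h; [exact: h|apply/esym/h].
rewrite (big_ord_widen_cond _ P F le); apply: eq_bigl => i.
by case: (boolP (P i)) => //= /Pm ->.
Qed.

Lemma sum_multiples (V : nmodType) (d M : nat) (Q : pred nat) (F : nat -> V) :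
  (0 < d)%N -> (forall n, Q n -> (n < M)%N) ->
  \sum_(n < M | (d %| n)%N && Q n) F n = \sum_(m < M | Q (d * m)%N) F (d * m)%N.
Proof.
move=> d0 QM; case: M QM => [|M] QM; first by rewrite !big_ord0.
rewrite (reindex_onto (fun m : 'I_M.+1 => inord (d * m) : 'I_M.+1)
   (fun n : 'I_M.+1 => inord (n %/ d))) /=; last first.
  move=> n /andP[dn Qn]; apply: val_inj => /=.
  have lt : (n %/ d < M.+1)%N by apply: leq_ltn_trans (ltn_ord n); exact: leq_div.
  by rewrite !inordK // mulnC divnK.
have E (m : 'I_M.+1) : (d %| @inord M (d * m))%N && Q (@inord M (d * m)) &&
   (inord (@inord M (d * m) %/ d) == m) = Q (d * m)%N.
  have [lt|ge] := ltnP (d * m)%N M.+1.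
    rewrite inordK // dvdn_mulr //= mulKn //.
    by rewrite (_ : inord m == m) ?andbT //; apply/eqP/val_inj; rewrite /= inordK.
  (* When [d * m] is out of range, [inord] returns the default 0, and the round trip would force
     [m = 0], contradicting the overflow. *)
  have -> : Q (d * m)%N = false by apply/negP => /QM; lia.
  have e0 : (@inord M (d * m) : nat) = 0%N.
    by rewrite /inord /insubd insubF //=; apply/negP; lia.
  rewrite e0 div0n; apply/negP => /andP[_ /eqP/(congr1 val)/=].
  by rewrite inordK // => e; rewrite -e muln0 in ge.
by apply: eq_big => m; [exact: E|rewrite E => /QM lt; rewrite inordK].
Qed.

Lemma mertens (RT : realType) (v : RT) (M : nat) : 0 < v -> expR v <= M%:R ->
  `|\sum_(p < M | prime p && (ln (p%:R : RT) < v)) ln (p%:R : RT) / p%:R - v| <= 5.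
Proof.
move=> v0 vM; have ev : 1 < expR v by rewrite expR_gt1.
(* [n] is the largest integer strictly below [expR v], to match the strict [ln p < v]; it is the
   truncation minus one when [expR v] is an integer. Replacing [ln n] by [v] costs at most 1, whence
   [5 = 4 + 1]. *)
have [n [n0 n1 n2]] : exists n : nat, [/\ (0 < n)%N, n%:R < expR v & expR v <= n.+1%:R].
  have /andP[t1 t2] := truncn_itv (expR_ge0 v); set t := Num.truncn _ in t1 t2.
  move: t1; rewrite le_eqVlt => /orP[/eqP e|lt].
    exists t.-1; have t2' : (1 < t)%N by rewrite -(ltr_nat RT) e.
    rewrite (ltn_predK t2') e lexx; split=> //; first by lia.
    by rewrite -e ltr_nat; lia.
  exists t; split=> //; last exact: ltW.
  by have : 1 < t.+1%:R :> RT by [exact: lt_trans t2]; rewrite ltr1n.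
have n0' : 0 < n%:R :> RT by rewrite ltr0n.
have -> : \sum_(p < M | prime p && (ln (p%:R : RT) < v)) ln (p%:R : RT) / p%:R =
   \sum_(p < n.+1 | prime p) ln (p%:R : RT) / p%:R.
  have Pn i : prime i && (ln (i%:R : RT) < v) -> (i < n.+1)%N.
    case/andP=> pi'; rewrite -ltr_expR lnK ?posrE ?ltr0n ?prime_gt0 // => lt.
    by rewrite -(ltr_nat RT); exact: lt_le_trans n2.
  rewrite (sum_ord_bound _ (fun p => prime p && (ln (p%:R : RT) < v))
      (fun p => ln (p%:R : RT) / p%:R) _ n.+1) //.
    apply: eq_bigl => i; case: (boolP (prime i)) => //= pi'.
    rewrite -ltr_expR lnK ?posrE ?ltr0n ?prime_gt0 //; apply: le_lt_trans n1.
    by rewrite ler_nat -ltnS.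
  move=> i /Pn lt; rewrite -(ltr_nat RT); apply: lt_le_trans vM.
  by apply: le_lt_trans n1; rewrite ler_nat.
have := mertens_nat RT n n0; set S := \sum_(p < _ | _) _.
have l1 : ln (n%:R : RT) <= v by rewrite -ler_expR lnK ?posrE // ltW.
have l2 : v <= ln (n%:R : RT) + 1.
  have : v <= ln (n.+1%:R : RT) by rewrite -ler_expR lnK ?posrE ?ltr0n.
  move/le_trans; apply; rewrite -lerBlDl -ln_div ?posrE ?ltr0n //.
  have -> : n.+1%:R / n%:R = 1 + n%:R^-1 :> RT.
    by rewrite -natr1 mulrDl divff ?gt_eqF // mul1r.
  apply: (@le_trans _ _ n%:R^-1); last by rewrite invf_le1 // ler1n.
  by apply: le_ln1Dx; rewrite (lt_trans (ltrN10 _)) // invr_gt0.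
by rewrite !ler_norml => /andP[a b]; apply/andP; split; lra.
Qed.

(** * Logarithmic sums of squarefree multiplicative functions *)

Section SquarefreeMultiplicative.
Variable RT : realType.
Implicit Types (a : nat -> RT) (u v : RT) (P Q : pred nat) (l n m p : nat).

(** Nonnegative multiplicative functions supported on squarefree numbers, given by their behaviour
    when one prime is added. Taking [m = 0] gives [a 0 = 0]. *)
Definition sqmult a :=
  [/\ a 1%N = 1, forall n, 0 <= a n &
      forall p m, prime p -> a (p * m)%N = if (p %| m)%N then 0 else a p * a m].

(** The range serves only to make the sum finite. The guard [0 < n] is needed since [ln 0 = 0] would
    let the index 0 in. *)
Definition logsum a P l u : RT :=
  \sum_(n < (Num.truncn (expR u)).+1 | [&& (0 < n)%N, ln (n%:R : RT) < u & P n])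
     a n * (u - ln n%:R) ^+ l.

Lemma lt_of_ln n u M : (0 < n)%N -> ln (n%:R : RT) < u -> expR u <= M%:R -> (n < M)%N.
Proof.
move=> n0; rewrite -ltr_expR lnK ?posrE ?ltr0n // => nu uM.
by rewrite -(ltr_nat RT); exact: lt_le_trans uM.
Qed.

Lemma logsumE a P l u M : expR u <= M%:R -> logsum a P l u =
  \sum_(n < M | [&& (0 < n)%N, ln (n%:R : RT) < u & P n]) a n * (u - ln n%:R) ^+ l.
Proof.
move=> uM; rewrite /logsum.
apply: (sum_ord_bound _ (fun n => [&& (0 < n)%N, ln (n%:R : RT) < u & P n])
   (fun n => a n * (u - ln n%:R) ^+ l)) => i /and3P[i0 iu _].
  by apply: (lt_of_ln _ _ _ i0 iu); exact/ltW/truncnS_gt.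
exact: (lt_of_ln _ _ _ i0 iu).
Qed.

Lemma logsum_le0 a P l u : u <= 0 -> logsum a P l u = 0.
Proof.
move=> u0; rewrite /logsum big_pred0 // => n; apply/negP => /and3P[_ nu _].
by have := ln_nat_ge0 RT n; rewrite leNgt (lt_le_trans nu u0).
Qed.

Lemma ln_natM m n : (0 < m)%N -> (0 < n)%N ->
  ln ((m * n)%N%:R : RT) = ln m%:R + ln n%:R.
Proof. by move=> m0 n0; rewrite natrM lnM ?posrE ?ltr0n. Qed.

Section Fixed.
Variable a : nat -> RT.
Hypothesis sq : sqmult a.

Lemma sqmult_ge0 n : 0 <= a n. Proof. by case: sq => _ ->. Qed.

Lemma sqmult0 : a 0%N = 0.
Proof. by case: sq => _ _ /(_ 2%N 0%N isT). Qed.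

Lemma logsum_ge0 P l u : 0 <= logsum a P l u.
Proof.
apply: sumr_ge0 => n /and3P[_ nu _]; rewrite mulr_ge0 ?sqmult_ge0 //.
by rewrite exprn_ge0 // subr_ge0 ltW.
Qed.

Lemma le_logsum P Q l u v : u <= v -> (forall n, P n -> Q n) ->
  logsum a P l u <= logsum a Q l v.
Proof.
move=> uv PQ; set M := (Num.truncn (expR v)).+1.
have vM : expR v <= M%:R by exact/ltW/truncnS_gt.
have uM : expR u <= M%:R by apply: le_trans vM; rewrite ler_expR.
rewrite !(logsumE _ _ _ _ M) // [leLHS]big_mkcond [leRHS]big_mkcond /=.
apply: ler_sum => n _; case: ifPn => [/and3P[n0 nu Pn]|_].
  rewrite n0 (lt_le_trans nu uv) (PQ _ Pn) /= ler_wpM2l ?sqmult_ge0 //.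
  by rewrite lerXn2r ?nnegrE ?subr_ge0 ?lerD2r // ltW // (lt_le_trans nu).
case: ifPn => // /and3P[_ nv _].
by rewrite mulr_ge0 ?sqmult_ge0 // exprn_ge0 // subr_ge0 ltW.
Qed.

(** Substitute [n = p * m]: the [m] divisible by [p] drop out because [a] vanishes off squarefree
    numbers. *)
Lemma logsum_mult P p l u M : prime p -> expR u <= M%:R ->
  (forall m, ~~ (p %| m)%N -> P (p * m)%N = P m) ->
  \sum_(n < M | (p %| n)%N && [&& (0 < n)%N, ln (n%:R : RT) < u & P n])
     a n * (u - ln n%:R) ^+ l =
  a p * logsum a (fun m => P m && ~~ (p %| m)%N) l (u - ln p%:R).
Proof.
move=> pp uM PP; have p0 := prime_gt0 pp.
pose Q n := [&& (0 < n)%N, ln (n%:R : RT) < u & P n].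
rewrite (sum_multiples _ p M Q (fun n => a n * (u - ln n%:R) ^+ l)) //; last first.
  by move=> n /and3P[n0 nu _]; exact: (lt_of_ln _ _ _ n0 nu).
have uM' : expR (u - ln p%:R) <= M%:R.
  by apply: le_trans uM; rewrite ler_expR gerBl ln_nat_ge0.
rewrite (logsumE _ _ _ _ M) // mulr_sumr big_mkcond [RHS]big_mkcond /=.
apply: eq_bigr => m _; rewrite /Q muln_gt0 p0 /=.
case: (posnP m) => [->|m0] //=.
rewrite ln_natM // ltrBrDl.
case: sq => _ _ ->//; have [pm|pm] := boolP (p %| m)%N.
  by rewrite andbF mul0r; case: ifP => //; rewrite andbF.
by rewrite PP // andbT; case: ifP => // _; rewrite mulrA opprD addrA.
Qed.

Lemma logsum_split P p l u : prime p ->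
  (forall m, ~~ (p %| m)%N -> P (p * m)%N = P m) ->
  logsum a P l u = logsum a (fun m => P m && ~~ (p %| m)%N) l u +
    a p * logsum a (fun m => P m && ~~ (p %| m)%N) l (u - ln p%:R).
Proof.
move=> pp PP; set M := (Num.truncn (expR u)).+1.
have uM : expR u <= M%:R by exact/ltW/truncnS_gt.
rewrite -(logsum_mult P p l u M) // !(logsumE _ _ _ _ M) //.
rewrite (bigID (fun n : 'I_M => (p %| n)%N)) /= addrC; congr (_ + _).
  by apply: eq_bigl => n; rewrite -!andbA.
by apply: eq_bigl => n; rewrite andbC.
Qed.

Lemma sqmult_logn n p : a n != 0 -> prime p -> logn p n = (p %| n)%N.
Proof.
move=> an pp; have n0 : (0 < n)%N by case: n an => //; rewrite sqmult0 eqxx.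
rewrite lognE pp n0 /=; case: ifP => // /dvdnP[m e].
case: sq => _ _ /(_ p m pp); rewrite mulnC -e; case: ifP => pm.
  by move=> e0; rewrite e0 eqxx in an.
by rewrite e mulnK ?prime_gt0 // lognE pm !andbF.
Qed.

Lemma sum_ln_sqmult u M : expR u <= M%:R ->
  u * logsum a predT 0 u - logsum a predT 1 u =
  \sum_(p < M | prime p) ln p%:R *
     (a p * logsum a (fun m => ~~ (p %| m)%N) 0 (u - ln p%:R)).
Proof.
move=> uM; rewrite !(logsumE _ _ _ _ M) // mulr_sumr -sumrB.
transitivity (\sum_(n < M | [&& (0 < n)%N, ln (n%:R : RT) < u & predT n])
   \sum_(p < M | prime p) (if (p %| n)%N then a n * ln p%:R else 0)).
  apply: eq_bigr => n /and3P[n0 nu _]; rewrite expr0 expr1 mulr1 mulrBr.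
  rewrite [u * _]mulrC opprB addrC subrK.
  have [an|an] := eqVneq (a n) 0.
    by rewrite an mul0r big1 // => p _; case: ifP => // _; rewrite mul0r.
  rewrite (@ln_nat_logn _ n M) //; last first.
    by move=> p pp /dvdn_leq -/(_ n0) le; apply: leq_ltn_trans le _.
  rewrite mulr_sumr; apply: eq_bigr => p pp.
  by rewrite (sqmult_logn n p) //; case: ifP => _; rewrite ?mul1r // mul0r mulr0.
rewrite exchange_big /=; apply: eq_bigr => p pp.
rewrite -big_mkcondr /= -mulr_suml mulrC; congr (_ * _).
have := logsum_mult predT p 0 u M pp uM (fun _ _ => erefl).
rewrite /= => <-; rewrite [RHS]big_mkcond [LHS]big_mkcond /=; apply: eq_bigr => n _.
by rewrite andbC; case: ifP => // _; rewrite mulr1.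
Qed.

Lemma gerBl_ln u n : u - ln n%:R <= u.
Proof. by rewrite gerBl ln_nat_ge0. Qed.

(** The left side [u G_0 - G_1] equals the sum of [a n * ln n]. Expanding [ln n] over primes gives
    sums over integers prime to [p]; these are traded for full sums, after which the inner sum over
    primes is the Mertens-type sum of the hypothesis, taken at [v = u - ln m]. *)
Lemma log_relation (k A B E u : RT) M : 0 < u -> expR u <= M%:R ->
  (forall v, 0 < v -> v <= u ->
    k * v - B <= \sum_(p < M | prime p && (ln (p%:R : RT) < v))
        a p / (1 + a p) * ln p%:R <= k * v + A) ->
  \sum_(p < M | prime p) a p * (a p / (1 + a p)) * ln p%:R <= E ->
  k * logsum a predT 1 u - B * logsum a predT 0 u <=
  u * logsum a predT 0 u - logsum a predT 1 u <=
  k * logsum a predT 1 u + (A + E) * logsum a predT 0 u.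
Proof.
move=> u0 uM HV HE.
have a1 p : 0 < 1 + a p by rewrite ltr_pwDl // sqmult_ge0.
pose w p := a p / (1 + a p).
have w0 p : 0 <= w p by rewrite divr_ge0 ?sqmult_ge0 // ltW.
pose G v := logsum a predT 0 v.
pose Gp p v := logsum a (fun m => ~~ (p %| m)%N) 0 v.
(* From [G v = Gp p v + a p * Gp p (v - ln p)]. The first term on the right has the full sum; the
   second carries [a p * w p], whose sum against [ln p] is bounded by [E]. *)
have key p v : prime p -> a p * Gp p v = w p * G v + a p * w p * (Gp p v - Gp p (v - ln p%:R)).
  move=> pp; rewrite /G (logsum_split predT p 0 v pp) //=.
  rewrite -/(Gp p v) -/(Gp p (v - ln p%:R)) /w.
  by field; rewrite gt_eqF.
rewrite (sum_ln_sqmult u M) //.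
have -> : \sum_(p < M | prime p) ln p%:R *
     (a p * logsum a (fun m => ~~ (p %| m)%N) 0 (u - ln p%:R)) =
   \sum_(p < M | prime p) w p * ln p%:R * G (u - ln p%:R) +
   \sum_(p < M | prime p) a p * w p * ln p%:R *
      (Gp p (u - ln p%:R) - Gp p (u - ln p%:R - ln p%:R)).
  rewrite -big_split /=; apply: eq_bigr => p pp.
  by rewrite -/(Gp p (u - ln p%:R)) key //; ring.
have -> : \sum_(p < M | prime p) w p * ln p%:R * G (u - ln p%:R) =
   \sum_(m < M | [&& (0 < m)%N, ln (m%:R : RT) < u & predT m]) a m *
     \sum_(p < M | prime p && (ln (p%:R : RT) < u - ln m%:R)) w p * ln p%:R.
  under [RHS]eq_bigr do rewrite mulr_sumr.
  rewrite (exchange_big_dep (fun p : 'I_M => prime p)) /=; last by move=> ? ? _ /andP[].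
  apply: eq_bigr => p pp; rewrite /G (logsumE _ _ _ _ M); last first.
    by apply: le_trans uM; rewrite ler_expR gerBl ln_nat_ge0.
  rewrite mulr_sumr; apply: eq_big => m.
    rewrite pp /= andbT andbT; case: (0 < m)%N => //=.
    rewrite ltrBrDl ltrBrDr; apply/idP/andP => [h|[]//]; split=> //.
    by apply: le_lt_trans h; rewrite lerDr ln_nat_ge0.
  by rewrite expr0 mulr1 mulrC.
set X := \sum_(m < M | _) _; set Y := \sum_(p < M | prime p) _.
have G0 v : 0 <= G v by exact: logsum_ge0.
(* [Gp] is nondecreasing, so the correction is nonnegative and [E] enters the upper bound only. *)
have Y0 : 0 <= Y.
  apply: sumr_ge0 => p _; rewrite mulr_ge0 //.
    exact: mulr_ge0 (mulr_ge0 (sqmult_ge0 _) (w0 _)) (ln_nat_ge0 _ _).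
  by rewrite subr_ge0 le_logsum // gerBl ln_nat_ge0.
have Y1 : Y <= E * G u.
  apply: (@le_trans _ _ (\sum_(p < M | prime p) a p * w p * ln p%:R * G u)); last first.
    by rewrite -mulr_suml ler_wpM2r.
  apply: ler_sum => p pp; rewrite ler_wpM2l //.
    exact: mulr_ge0 (mulr_ge0 (sqmult_ge0 _) (w0 _)) (ln_nat_ge0 _ _).
  rewrite lerBlDr (@le_trans _ _ (G u)) //; last by rewrite lerDl logsum_ge0.
  by rewrite le_logsum // gerBl ln_nat_ge0.
have G1E c : k * logsum a predT 1 u + c * logsum a predT 0 u =
  \sum_(m < M | [&& (0 < m)%N, ln (m%:R : RT) < u & predT m]) a m *
    (k * (u - ln m%:R) + c).
  rewrite !(logsumE _ _ _ _ M) // !mulr_sumr -big_split /=.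
  by apply: eq_bigr => m _; rewrite expr0 expr1; ring.
rewrite -mulNr; apply/andP; split.
  rewrite G1E.
  apply: (@le_trans _ _ X); last by rewrite lerDl.
  apply: ler_sum => m /and3P[m0 mu _]; rewrite ler_wpM2l ?sqmult_ge0 //.
  have um : 0 < u - ln m%:R by rewrite subr_gt0.
  by have /andP[] := HV _ um (gerBl_ln _ _).
rewrite [X in _ <= _ + X]mulrDl addrA lerD // G1E.
apply: ler_sum => m /and3P[m0 mu _]; rewrite ler_wpM2l ?sqmult_ge0 //.
have um : 0 < u - ln m%:R by rewrite subr_gt0.
by have /andP[] := HV _ um (gerBl_ln _ _).
Qed.

End Fixed.
End SquarefreeMultiplicative.

(** * Truncated powers *)

Section TruncatedPowers.
Variable RT : realType.
Implicit Types (f df : RT -> RT) (s : seq RT) (x y u v : RT) (l n M : nat).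

(** The functions treated below fail to be differentiable at the points [ln n]. The interval is cut
    at each exceptional point [s] and continuity glues the pieces. *)
Lemma le_derive_finite f df s x y : x <= y ->
  (forall t, x <= t <= y -> {for t, continuous f}) ->
  (forall t, x < t < y -> t \notin s -> is_derive t 1 f (df t)) ->
  (forall t, x < t < y -> t \notin s -> 0 <= df t) ->
  f x <= f y.
Proof.
elim: s x y => [|z s IH] x y xy cf Df df0.
  apply: (@ger0_derive1_le_cc _ f x y).
  - by move=> t; rewrite in_itv /= => /Df h; have [] := h isT.
  - move=> t; rewrite in_itv /= => ht; rewrite derive1E.
    by have := Df t ht isT => hd; rewrite derive_val df0.
  - by apply: continuous_in_subspaceT => t; rewrite inE /= in_itv /= => /cf.
  - by rewrite in_itv /= lexx.
  - by rewrite in_itv /= lexx xy.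
  - exact: xy.
have [/andP[xz zy]|nz] := boolP (x < z < y).
  apply: (@le_trans _ _ (f z)).
    apply: IH; first exact: ltW.
    - by move=> t /andP[a b]; apply: cf; rewrite a (le_trans b) // ltW.
    - move=> t /andP[a b] ts; apply: Df; first by rewrite a (lt_trans b).
      by rewrite inE negb_or ts andbT lt_eqF.
    - move=> t /andP[a b] ts; apply: df0; first by rewrite a (lt_trans b).
      by rewrite inE negb_or ts andbT lt_eqF.
  apply: IH; first exact: ltW.
  - by move=> t /andP[a b]; apply: cf; rewrite b (le_trans _ a) // ltW.
  - move=> t /andP[a b] ts; apply: Df; first by rewrite b (lt_trans _ a).
    by rewrite inE negb_or ts andbT gt_eqF.
  - move=> t /andP[a b] ts; apply: df0; first by rewrite b (lt_trans _ a).
    by rewrite inE negb_or ts andbT gt_eqF.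
apply: IH => // t ht ts; [apply: Df|apply: df0] => //; rewrite inE negb_or ts andbT;
  by apply/eqP => e; rewrite -e ht in nz.
Qed.

(** The value at [x = 0] is 0 even for [l = 0], in agreement with the strict inequality [ln n < u]
    in [logsum]. *)
Definition tpow l x : RT := if 0 < x then x ^+ l else 0.

Lemma tpow_continuous l : continuous (tpow l.+1).
Proof.
have -> : tpow l.+1 = (fun x => (Num.max 0 x) ^+ l.+1).
  apply/funext => x; rewrite /tpow; case: ltP => // _.
  by rewrite expr0n.
move=> x; apply: (@continuous_comp _ _ _ (fun x => Num.max 0 x) (fun x => x ^+ l.+1)).
  by apply: continuous_max; [exact: cst_continuous|exact: cvg_id].
exact: exprn_continuous.
Qed.

Lemma is_derive_tpow l x : x != 0 -> is_derive x 1 (tpow l.+1) (l.+1%:R * tpow l x).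
Proof.
rewrite neq_lt => /orP[x0|x0].
  have -> : l.+1%:R * tpow l x = 0 by rewrite /tpow ltNge ltW //= mulr0.
  apply: (@near_eq_is_derive RT RT RT (cst 0) (tpow l.+1) x 1 0).
  near=> t; rewrite /tpow ltNge ltW //=.
  by near: t; exact: lt_nbhsl.
have -> : l.+1%:R * tpow l x = (l.+1%:R * x ^+ l) *: 1 by rewrite /tpow x0 /GRing.scale /= mulr1.
apply: (@near_eq_is_derive RT RT RT (id ^+ l.+1 : RT -> RT) (tpow l.+1) x 1).
  near=> t; have t0 : 0 < t by near: t; exact: lt_nbhsr.
  by rewrite /tpow t0 exprfctE.
Unshelve. all: by end_near. Qed.

Variable c : nat -> RT.
(** The number of terms does not move with [u], unlike in [logsum], so this can be differentiated
    term by term off the finite set of [ln n]. *)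
Definition tpsum M l u := \sum_(n < M) c n * tpow l (u - ln n%:R).

Lemma is_derive_tpsum M l u : u \notin [seq ln (n%:R : RT) | n <- iota 0 M] ->
  is_derive u 1 (tpsum M l.+1) (l.+1%:R * tpsum M l u).
Proof.
move=> us.
have -> : tpsum M l.+1 = \sum_(n < M) (fun u => c n * tpow l.+1 (u - ln n%:R)).
  by apply/funext => t; rewrite fct_sumE.
rewrite mulr_sumr; apply: is_derive_sum => n.
have un : u - ln n%:R != 0.
  rewrite subr_eq0; apply: contraNneq us => ->.
  by apply: map_f; rewrite mem_iota /=.
have h := is_derive_tpow l _ un.
have h2 : is_derive u (1 : RT) (fun t : RT => t - ln n%:R) 1.
  by have := @is_derive_shift RT u 1 (- ln n%:R).
have h3 := @is_derive1_comp RT (tpow l.+1) (fun t => t - ln n%:R) u _ _ h h2.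
have h4 := @is_deriveZ _ _ _ _ (c n) _ _ _ h3.
rewrite mulr1 /GRing.scale /= in h4.
by have -> : l.+1%:R * (c n * tpow l (u - ln n%:R)) = c n * (l.+1%:R * tpow l (u - ln n%:R))
  by ring.
Qed.

Lemma tpsum_continuous M l : continuous (tpsum M l.+1).
Proof.
elim: M => [|M IH] u.
  have -> : tpsum 0 l.+1 = cst 0 by apply/funext => t; rewrite /tpsum big_ord0.
  exact: cst_continuous.
have -> : tpsum M.+1 l.+1 = (fun u => tpsum M l.+1 u + c M * tpow l.+1 (u - ln M%:R)).
  by apply/funext => t; rewrite /tpsum big_ord_recr.
apply: continuousD; first exact: IH.
apply: continuousM; first exact: cst_continuous.
apply: (@continuous_comp _ _ _ (fun u => u - ln M%:R) (tpow l.+1)); last exact: tpow_continuous.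
by apply: continuousB; [exact: cvg_id|exact: cst_continuous].
Qed.

Variables (M k : nat) (s B U : RT).

(** The cutoff [U] is present because a sum of [M] terms agrees with the full [logsum] only while
    [expR u <= M]. *)
Definition tprel l := forall u, 0 < u <= U ->
  0 <= l.+1%:R * (B - s * u) * tpsum M l u + s * (k + l.+1)%:R * tpsum M l.+1 u.

Hypothesis c0 : c 0%N = 0.

Lemma tpsum_at0 l : tpsum M l 0 = 0.
Proof.
rewrite /tpsum big1 // => -[[|n] nM] _ /=; first by rewrite c0 mul0r.
by rewrite /tpow ifF ?mulr0 // sub0r oppr_gt0 ltNge ln_nat_ge0.
Qed.

(* The expression in [tprel l.+1] vanishes at [0] and its derivative is [l.+2] times the one
   in [tprel l]. *)
Lemma tprel_lift l : tprel l -> tprel l.+1.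
Proof.
move=> H u /andP[u0 uU].
pose F (t : RT) := l.+2%:R * (B - s * t) * tpsum M l.+1 t + s * (k + l.+2)%:R * tpsum M l.+2 t.
pose dF (t : RT) := l.+2%:R * (l.+1%:R * (B - s * t) * tpsum M l t +
    s * (k + l.+1)%:R * tpsum M l.+1 t).
suff : F 0 <= F u.
  by apply: le_trans; rewrite /F !tpsum_at0 !mulr0 addr0.
apply: (@le_derive_finite F dF [seq ln (n%:R : RT) | n <- iota 0 M]) => //.
- exact: ltW.
- move=> t _; apply: continuousD; apply: continuousM; last exact: tpsum_continuous.
  + apply: continuousM; first exact: cst_continuous.
    apply: continuousB; first exact: cst_continuous.
    by apply: continuousM; [exact: cst_continuous|exact: cvg_id].
  + exact: tpsum_continuous.
  + exact: cst_continuous.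
- move=> t _ ts.
  have h1 := is_derive_tpsum M l t ts; have h2 := is_derive_tpsum M l.+1 t ts.
  have q : is_derive t (1 : RT) (fun t : RT => l.+2%:R * (B - s * t)) (l.+2%:R * - s).
    have -> : (fun t : RT => l.+2%:R * (B - s * t)) = (l.+2%:R \*: (cst B - (s \*: id))).
      by apply/funext.
    by apply: is_derive_eq; rewrite /GRing.scale /= mulr1 sub0r.
  have := is_deriveD (is_deriveM q h1) (is_deriveZ (s * (k + l.+2)%:R) h2).
  rewrite /GRing.scale /= => h; apply: (is_derive_eq h).
  rewrite /dF /= addnS -[(k + l.+1).+1%:R]natr1; ring.
- by move=> t /andP[t0 tu] _; rewrite mulr_ge0 // H // t0 (le_trans (ltW tu)).
Qed.

(** Since [s ^+ 2 = 1], one has [B - s t = - s (t - s B)], so the derivative of the quotient is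
    exactly the expression of [tprel] divided by a positive power of [t - s B]. *)
Lemma tprel_mono l x y : s ^+ 2 = 1 -> tprel l -> 0 < x -> x <= y -> y <= U ->
  0 < x - s * B -> 
  - s * (tpsum M l.+1 x / (x - s * B) ^+ (k + l.+1)) <=
  - s * (tpsum M l.+1 y / (y - s * B) ^+ (k + l.+1)).
Proof.
move=> s2 H x0 xy yU xB.
pose F (t : RT) := - s * (tpsum M l.+1 t * ((t - s * B) ^+ (k + l.+1))^-1).
pose dF (t : RT) := (l.+1%:R * (B - s * t) * tpsum M l t +
    s * (k + l.+1)%:R * tpsum M l.+1 t) * (t - s * B) ^- (k + l.+1).+1.
have tB t : x <= t -> 0 < t - s * B.
  by move=> xt; apply: lt_le_trans xB _; rewrite lerD2r.
apply: (@le_derive_finite F dF [seq ln (n%:R : RT) | n <- iota 0 M]) => //.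
- move=> t /andP[xt _]; apply: continuousM; first exact: cst_continuous.
  apply: continuousM; first exact: tpsum_continuous.
  apply: continuousV; first by rewrite expf_neq0 // gt_eqF // tB.
  apply: (@continuous_comp _ _ _ (fun u => u - s * B) (fun x => x ^+ (k + l.+1)));
    last exact: exprn_continuous.
  by apply: continuousB; [exact: cvg_id|exact: cst_continuous].
- move=> t /andP[/ltW xt _] ts.
  have h1 := is_derive_tpsum M l t ts.
  have h2 : is_derive t (1 : RT) (fun t : RT => t - s * B) 1.
    by have := @is_derive_shift RT t 1 (- (s * B)).
  have h3 := is_deriveX (k + l.+1) h2.
  have ne : t - s * B != 0 by rewrite gt_eqF // tB.
  have ne3 : ((fun t : RT => t - s * B) ^+ (k + l.+1)) t != 0.
    by rewrite exprfctE expf_neq0.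
  have h4 := is_deriveV ne3 h3.
  have := is_deriveZ (- s) (is_deriveM h1 h4).
  rewrite !exprfctE /GRing.scale /= => h; apply: (is_derive_eq h).
  rewrite /dF; rewrite addnS /= exprS [(_ ^+ (_).+2)]exprSr exprS.
  set X := t - s * B in ne *.
  have -> : B - s * t = - s * X by rewrite /X -[in LHS](mul1r B) -s2; ring.
  set Z := X ^+ (k + l); have Z0 : Z != 0 by rewrite expf_neq0.
  by field; rewrite ne Z0.
- move=> t /andP[xt ty] _; rewrite mulr_ge0 //.
    by rewrite H // (lt_trans x0 xt) (le_trans (ltW ty)).
  by rewrite invr_ge0 exprn_ge0 // ltW // tB // ltW.
Qed.
End TruncatedPowers.

(** * Monotone quotients and their limits at infinity *)

Section LogarithmicAverages.
Local Open Scope classical_set_scope.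
Variables (RT : realType) (a : nat -> RT) (k : nat).
Hypothesis sq : sqmult RT a.
Implicit Types (u x y : RT) (l n M : nat) (s B c : RT).
Local Notation mm l u := (logsum RT a predT l u).

Lemma logsum_tpsum l u M : expR u <= M%:R -> mm l u = tpsum RT a M l u.
Proof.
move=> uM; rewrite (logsumE _ _ _ _ _ M) // big_mkcond /=; apply: eq_bigr => -[[|n] nM] _ /=.
  by rewrite (sqmult0 _ _ sq) mul0r.
by rewrite andbT /tpow subr_gt0; case: ifP => // _; rewrite mulr0.
Qed.

(* [s = 1] and [s = -1] are the two sides of [|u G_0(u) - (k + 1) G_1(u)| <= B G_0(u)]. *)
Definition logsum_relation s B := forall u, 0 < u ->
  0 <= (B - s * u) * mm 0 u + s * k.+1%:R * mm 1 u.

Lemma logsum_relationP s B l u : logsum_relation s B -> 0 < u ->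
  0 <= l.+1%:R * (B - s * u) * mm l u + s * (k + l.+1)%:R * mm l.+1 u.
Proof.
move=> H u0; set M := (Num.truncn (expR u)).+1.
have uM : expR u <= M%:R by exact/ltW/truncnS_gt.
suff : tprel RT a M k s B u l by move=> /(_ u); rewrite u0 lexx !(logsum_tpsum _ _ M) //; apply.
elim: l => [|l IH]; last exact: tprel_lift (sqmult0 _ _ sq) _ IH.
move=> v /andP[v0 vu].
have vM : expR v <= M%:R by apply: le_trans uM; rewrite ler_expR.
by rewrite -!(logsum_tpsum _ _ M) // mul1r addn1 H.
Qed.

Lemma logsum_mono s B l x y : s ^+ 2 = 1 -> logsum_relation s B -> 0 < x -> x <= y ->
  0 < x - s * B ->
  - s * (mm l.+1 x / (x - s * B) ^+ (k + l.+1)) <=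
  - s * (mm l.+1 y / (y - s * B) ^+ (k + l.+1)).
Proof.
move=> s2 H x0 xy xB; set M := (Num.truncn (expR y)).+1.
have yM : expR y <= M%:R by exact/ltW/truncnS_gt.
have le v : v <= y -> expR v <= M%:R by move=> vy; apply: le_trans yM; rewrite ler_expR.
rewrite !(logsum_tpsum _ _ M) ?le //.
apply: (tprel_mono _ _ _ _ _ _ y) => // v /andP[v0 vy].
by rewrite -!(logsum_tpsum _ _ M) ?le // logsum_relationP.
Qed.

(** The nonincreasing quotient is compared with its value at [A + 1], where the denominator is 1;
    the relation then passes from [G_1] to [G_0]. Only the side [s = 1] is used, and later this side
    comes with an [A] independent of [H]. *)
Lemma logsum_growth A u : 0 <= A -> logsum_relation 1 A -> A + 1 <= u ->
  mm 0 u <= k.+1%:R * mm 1 (A + 1) * u ^+ k.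
Proof.
move=> A0 H Au.
have Ap : 0 < A + 1 by rewrite ltr_wpDl.
have uA : 0 < u - A by rewrite subr_gt0 (lt_le_trans _ Au) // ltrDl.
have u0 : 0 < u by exact: lt_le_trans Au.
have e : A + 1 - 1 * A = 1 by rewrite mul1r addrC addKr.
have := @logsum_mono 1 A 0 (A + 1) u (expr1n _ _) H Ap Au.
rewrite e ltr01 => /(_ isT); rewrite expr1n divr1 mul1r addn1 !mulN1r lerN2.
rewrite ler_pdivrMr ?exprn_gt0 // => h.
have := H u u0; rewrite !mul1r -subr_ge0 => r.
have r' : (u - A) * mm 0 u <= k.+1%:R * mm 1 u by lra.
have h' : (u - A) * mm 0 u <= (u - A) * (k.+1%:R * mm 1 (A + 1) * (u - A) ^+ k).
  apply: le_trans r' _; apply: le_trans (ler_wpM2l (ler0n _ _) h) _.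
  by rewrite exprS le_eqVlt; apply/orP; left; apply/eqP; ring.
rewrite ler_pM2l // in h'; apply: le_trans h' _.
rewrite ler_wpM2l ?mulr_ge0 ?(logsum_ge0 _ _ sq) //.
by rewrite lerXn2r ?nnegrE ?(ltW uA) ?(ltW u0) // gerBl.
Qed.

Section Limit.
Variables (B c : RT).
Hypothesis B0 : 0 <= B.
Hypothesis relU : logsum_relation 1 B.
Hypothesis relL : logsum_relation (-1) B.
Hypothesis limc : mm 0 u / u ^+ k @[u --> +oo] --> c.

Lemma cvg_inv_pinfty : (x^-1 : RT) @[x --> +oo] --> (0 : RT).
Proof.
apply/gtr0_cvgV0; last exact: cvg_id.
by exists 0; split => // x.
Qed.

Lemma near_pinfty_gt y : \forall x \near +oo, y < (x : RT).
Proof. by exists y; split=> //; exact: num_real. Qed.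

(** Value of the beta integral [l * int_0^u c t^k (u - t)^(l-1) dt] divided by [u^(k+l)], which is
    what [G_l] becomes when [G_0(t)] is replaced by [c t^k]. *)
Definition mconst l : RT := c * (k`! * l`!)%:R / ((k + l)`!)%:R.

Lemma mconstS l : mconst l.+1 * (k + l.+1)%:R = mconst l * l.+1%:R.
Proof.
rewrite /mconst addnS !factS !natrM.
have h1 : (k + l)`!%:R != 0 :> RT by rewrite pnatr_eq0 -lt0n fact_gt0.
have h2 : (k + l).+1%:R != 0 :> RT by rewrite pnatr_eq0.
move: h1 h2; move: (k + l)`!%:R (k + l).+1%:R => x y h1 h2.
by field; rewrite h1 h2.
Qed.

(** The two relations squeeze [G_(l+1) / (u G_l)] to [(l+1) / (k+l+1)] with relative error
    [B / u]. *)
Lemma logsum_cvg l : mm l u / u ^+ (k + l) @[u --> +oo] --> mconst l.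
Proof.
elim: l => [|l IH].
  rewrite addn0; have -> : mconst 0 = c.
    rewrite /mconst addn0 fact0 muln1 mulfK // pnatr_eq0 -lt0n fact_gt0 //.
  exact: limc.
have kl : 0 < (k + l.+1)%:R :> RT by rewrite ltr0n addnS.
pose g s u := (l.+1%:R / (k + l.+1)%:R) * (1 + s * (B * u^-1)) * (mm l u / u ^+ (k + l)).
have gc s : g s u @[u --> +oo] --> mconst l.+1.
  have -> : mconst l.+1 = (l.+1%:R / (k + l.+1)%:R) * (1 + s * (B * 0)) * mconst l.
    have := mconstS l; move/(canRL (mulfK _)) => ->; last by rewrite gt_eqF.
    by ring.
  apply: cvgM => //; apply: cvgM; first exact: cvg_cst.
  apply: cvgD; first exact: cvg_cst.
  apply: cvgM; first exact: cvg_cst.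
  by apply: cvgM; [exact: cvg_cst|exact: cvg_inv_pinfty].
apply: squeeze_cvgr (gc (-1)) (gc 1).
near=> u.
have u0 : 0 < u by near: u; exact: near_pinfty_gt.
have un : 0 < u ^+ (k + l) by rewrite exprn_gt0.
have h1 := logsum_relationP 1 B l u relU u0.
have h2 := logsum_relationP (-1) B l u relL u0.
rewrite /g addnS exprS -addnS; set X := mm l u in h1 h2 *; set Y := mm l.+1 u in h1 h2 *.
set Z := u ^+ (k + l) in un *.
have E s : l.+1%:R / (k + l.+1)%:R * (1 + s * (B / u)) * (X / Z) =
   (l.+1%:R * (u + s * B) * X / (k + l.+1)%:R) / (u * Z).
  by field; rewrite !gt_eqF.
have uZ : 0 < u * Z by rewrite mulr_gt0.
rewrite !E; apply/andP; split; rewrite ler_pM2r ?invr_gt0 //.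
  by rewrite ler_pdivrMr //; lra.
by rewrite ler_pdivlMr //; lra.
Unshelve. all: by end_near. Qed.

(** Each monotone quotient at [u] is compared with the same quotient at [y], and [y] tends to
    infinity. Replacing [y - B] or [y + B] by [y] in the denominator goes in the favourable
    direction on both sides. *)
Lemma logsumS_bounds l u : B < u ->
  mconst l.+1 * (u - B) ^+ (k + l.+1) <= mm l.+1 u <= mconst l.+1 * (u + B) ^+ (k + l.+1).
Proof.
move=> Bu; have u0 : 0 < u by exact: le_lt_trans Bu.
have uB : 0 < u - B by rewrite subr_gt0.
have uB' : 0 < u + B by rewrite ltr_pwDl.
have m0 y : 0 <= mm l.+1 y by exact: logsum_ge0.
apply/andP; split.
  rewrite -ler_pdivlMr ?exprn_gt0 //.
  apply: (cvgr_to_le (logsum_cvg l.+1)); near=> y.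
  have uy : u <= y by apply: ltW; near: y; exact: near_pinfty_gt.
  have y0 : 0 < y by exact: lt_le_trans uy.
  have := logsum_mono 1 B l u y (expr1n _ _) relU u0 uy.
  rewrite mul1r => /(_ uB); rewrite !mulN1r lerN2; apply: le_trans.
  rewrite ler_wpM2l // lef_pV2 ?posrE ?exprn_gt0 ?subr_gt0 //; last exact: lt_le_trans uy.
  by rewrite lerXn2r ?nnegrE ?subr_ge0 ?(ltW y0) ?gerBl // (le_trans (ltW Bu)).
have s2 : (-1) ^+ 2 = 1 :> RT by rewrite sqrrN expr1n.
rewrite -ler_pdivrMr ?exprn_gt0 //.
apply: (cvgr_to_ge (logsum_cvg l.+1)); near=> y.
have uy : u <= y by apply: ltW; near: y; exact: near_pinfty_gt.
have y0 : 0 < y by exact: lt_le_trans uy.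
have := logsum_mono (-1) B l u y s2 relL u0 uy.
rewrite mulN1r !opprK => /(_ uB'); rewrite !mul1r => /le_trans; apply.
rewrite ler_wpM2l // lef_pV2 ?posrE ?exprn_gt0 //; last by rewrite ltr_pwDl.
by rewrite lerXn2r ?nnegrE ?(ltW y0) ?addr_ge0 ?(ltW y0) // lerDl.
Unshelve. all: by end_near. Qed.

(** Derived from level [l.+1] through the relation, so that [l = 0] is covered; the price is one
    factor [u + B] or [u - B] in the denominator. *)
Lemma logsum_bounds l u : B < u ->
  mconst l * (u - B) ^+ (k + l.+1) / (u + B) <= mm l u <=
  mconst l * (u + B) ^+ (k + l.+1) / (u - B).
Proof.
move=> Bu; have u0 : 0 < u by exact: le_lt_trans Bu.
have uB : 0 < u - B by rewrite subr_gt0.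
have uB' : 0 < u + B by rewrite ltr_pwDl.
have /andP[b1 b2] := logsumS_bounds l u Bu.
have h1 := logsum_relationP 1 B l u relU u0.
have h2 := logsum_relationP (-1) B l u relL u0.
have kl : 0 < (k + l.+1)%:R :> RT by rewrite ltr0n addnS.
have l0 : 0 < l.+1%:R :> RT by rewrite ltr0n.
have e := mconstS l.
set X := mm l u in h1 h2 *; set Y := mm l.+1 u in h1 h2 b1 b2 *.
set U1 := (u - B) ^+ _ in b1 *; set U2 := (u + B) ^+ _ in b2 *.
have {}b1 := ler_wpM2r (ltW kl) b1; have {}b2 := ler_wpM2r (ltW kl) b2.
apply/andP; split.
  rewrite ler_pdivrMr // -(ler_pM2r l0).
  apply: (@le_trans _ _ (Y * (k + l.+1)%:R)); last by lra.
  by apply: le_trans b1; rewrite mulrAC [leRHS]mulrAC -e.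
rewrite ler_pdivlMr // -(ler_pM2r l0).
apply: (@le_trans _ _ (Y * (k + l.+1)%:R)); first by lra.
by apply: le_trans b2 _; rewrite mulrAC [leRHS]mulrAC -e.
Qed.

End Limit.
End LogarithmicAverages.

Lemma pow_quot_bound (RT : realType) (n : nat) : exists2 K : RT, 0 < K &
  forall t : RT, 0 <= t <= 2^-1 ->
   1 - K * t <= (1 - t) ^+ n / (1 + t) /\ (1 + t) ^+ n / (1 - t) <= 1 + K * t.
Proof.
have [K1 K10 hK] : exists2 K : RT, 0 < K & forall t : RT, 0 <= t <= 2^-1 ->
    1 - K * t <= (1 - t) ^+ n /\ (1 + t) ^+ n <= 1 + K * t.
  elim: n => [|n [K K0 IH]].
    by exists 1 => // t /andP[t0 _]; rewrite !expr0 mul1r; split; lra.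
  exists (K + K + 1); first by lra.
  move=> t /andP[t0 t1]; have [|h1 h2] := IH t; first by rewrite t0.
  rewrite !exprS; split.
    have : 0 <= (1 - t) * ((1 - t) ^+ n - (1 - K * t)) by rewrite mulr_ge0 //; lra.
    have : 0 <= K * t * t by rewrite !mulr_ge0 // ltW.
    have : 0 <= K * t by rewrite mulr_ge0 // ltW.
    nra.
  have : 0 <= (1 + t) * ((1 + K * t) - (1 + t) ^+ n) by rewrite mulr_ge0 //; lra.
  have : 0 <= K * t by rewrite mulr_ge0 // ltW.
  nra.
exists (2 * K1 + 2); first by lra.
move=> t /andP[t0 t1]; have [|h1 h2] := hK t; first by rewrite t0.
have Kt : 0 <= K1 * t by rewrite mulr_ge0 // ltW.
have Ktt : 0 <= K1 * t * t by rewrite mulr_ge0.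
split.
  rewrite ler_pdivlMr; last by lra.
  apply: le_trans h1; nra.
rewrite ler_pdivrMr; last by lra.
apply: le_trans h2 _; nra.
Qed.

(** * The leading constant *)

Section Operators.
Variable RT : realType.
Implicit Types (F X Y : RT -> RT) (u v d : RT) (s : seq nat) (n p M z : nat).

(** Common shape of the functions of [u] that sum nonnegative coefficients over [ln n < u]; every
    operator below preserves it. *)
Definition summatory F := (forall u, u <= 0 -> F u = 0) /\ {homo F : u v / u <= v}.

Lemma summatory_ge0 F u : summatory F -> 0 <= F u.
Proof.
case=> F0 Fm; have [/F0->//|u0] := leP u 0.
by rewrite -(F0 0 (lexx _)); apply/Fm/ltW.
Qed.

Definition rough s n := all (fun p => ~~ (p %| n)%N) s.

(** In terms of Dirichlet series: multiplication by [zeta(1 + X)] deprived of its Euler factors at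
    the primes of [s]. *)
Definition roughavg s F u : RT :=
  \sum_(n < (Num.truncn (expR u)).+1 | [&& (0 < n)%N, ln (n%:R : RT) < u & rough s n])
    F (u - ln n%:R) / n%:R.

Lemma roughavgE s F u M : expR u <= M%:R -> roughavg s F u =
  \sum_(n < M | [&& (0 < n)%N, ln (n%:R : RT) < u & rough s n]) F (u - ln n%:R) / n%:R.
Proof.
move=> uM; rewrite /roughavg.
apply: (sum_ord_bound _ (fun n => [&& (0 < n)%N, ln (n%:R : RT) < u & rough s n])
   (fun n => F (u - ln n%:R) / n%:R)) => i /and3P[i0 iu _].
  by apply: (lt_of_ln _ _ _ _ i0 iu); exact/ltW/truncnS_gt.
exact: (lt_of_ln _ _ _ _ i0 iu).
Qed.

Lemma roughavg_summatoryE s F u M : summatory F -> expR u <= M%:R -> roughavg s F u =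
  \sum_(n < M | (0 < n)%N && rough s n) F (u - ln n%:R) / n%:R.
Proof.
move=> [F0 _] uM; rewrite (roughavgE _ _ _ M) // big_mkcond [RHS]big_mkcond /=.
apply: eq_bigr => n _; case: (0 < n)%N => //=; case: ltP => //= un.
by case: ifP => // _; rewrite F0 ?mul0r // subr_le0.
Qed.

Lemma summatory_roughavg s F : summatory F -> summatory (roughavg s F).
Proof.
move=> SF; split=> [u u0|u v uv].
  rewrite /roughavg big_pred0 // => n; apply/negP => /and3P[_ nu _].
  by have := ln_nat_ge0 RT n; rewrite leNgt (lt_le_trans nu u0).
set M := (Num.truncn (expR v)).+1.
have vM : expR v <= M%:R by exact/ltW/truncnS_gt.
have uM : expR u <= M%:R by apply: le_trans vM; rewrite ler_expR.
rewrite !(roughavg_summatoryE _ _ _ M) //; apply: ler_sum => n _.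
by rewrite ler_wpM2r ?invr_ge0 //; case: SF => _; apply; rewrite lerD2r.
Qed.

(** In terms of Dirichlet series: multiplication by the Euler factor [1 + g p^(-X)]. *)
Definition addprime (g : RT) p F u := F u + g * F (u - ln p%:R).

Lemma summatory_addprime g p F : 0 <= g -> summatory F -> summatory (addprime g p F).
Proof.
move=> g0 [F0 Fm]; split=> [u u0|u v uv].
  by rewrite /addprime !F0 ?mulr0 ?addr0 // subr_le0 (le_trans u0) // ln_nat_ge0.
by rewrite /addprime lerD ?Fm // ler_wpM2l // Fm // lerD2r.
Qed.

(** Linearity and commutation with translations, recorded only through their one use: an identity
    that exchanges the Euler factor at [p] survives the operator. *)
Definition translinear (T : (RT -> RT) -> RT -> RT) :=
  (forall F, summatory F -> summatory (T F)) /\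
  (forall X Y q p, summatory X -> summatory Y ->
     (forall u, X u = Y u + q * X (u - ln p%:R)) ->
     forall u, T X u = T Y u + q * T X (u - ln p%:R)).

Lemma translinear_roughavg s : translinear (roughavg s).
Proof.
split=> [|X Y q p SX SY XY u]; first exact: summatory_roughavg.
set M := (Num.truncn (expR u)).+1.
have uM : expR u <= M%:R by exact/ltW/truncnS_gt.
have uM' : expR (u - ln p%:R) <= M%:R.
  by apply: le_trans uM; rewrite ler_expR gerBl ln_nat_ge0.
rewrite !(roughavg_summatoryE _ _ _ M) // mulr_sumr -big_split /=.
apply: eq_bigr => n _; rewrite [X _]XY [u - ln p%:R - _]addrAC; ring.
Qed.

Lemma translinear_addprime g r : 0 <= g -> translinear (addprime g r).
Proof.
move=> g0; split=> [F|X Y q p SX SY XY u]; first exact: summatory_addprime.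
rewrite /addprime [X u]XY [X (u - ln r%:R)]XY [u - ln p%:R - _]addrAC; ring.
Qed.

Lemma translinear_comp T1 T2 : translinear T1 -> translinear T2 ->
  translinear (fun F => T1 (T2 F)).
Proof.
move=> [S1 L1] [S2 L2]; split=> [F SF|X Y q p SX SY XY u]; first exact/S1/S2.
by apply: L1; [exact: S2|exact: S2|move=> v; exact: L2].
Qed.

Lemma translinear_iter m T : translinear T -> translinear (iter m T).
Proof.
by move=> LT; elim: m => [|m IH]; [split|exact: (translinear_comp T (iter m T))].
Qed.

Definition unitstep u : RT := if 0 < u then 1 else 0.

Lemma summatory_unitstep : summatory unitstep.
Proof.
split=> [u u0|u v uv]; first by rewrite /unitstep ltNge u0.
rewrite /unitstep; case: ifP => u0; last by case: ifP.
by rewrite (lt_le_trans u0 uv).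
Qed.

(** An index prime to [s] is either also prime to [p], or [p * m] with [m] prime to [s] and possibly
    divisible by [p]. Hence the same operator reappears on the right, shifted: the Euler factor
    [(1 - p^(-1-X))^(-1)] written without division. *)
Lemma roughavg_cons s p F : prime p -> p \notin s -> all prime s ->
  forall u, roughavg s F u = roughavg (p :: s) F u + p%:R^-1 * roughavg s F (u - ln p%:R).
Proof.
move=> pp ps prs u; have p0 := prime_gt0 pp.
set M := (Num.truncn (expR u)).+1.
have uM : expR u <= M%:R by exact/ltW/truncnS_gt.
have uM' : expR (u - ln p%:R) <= M%:R.
  by apply: le_trans uM; rewrite ler_expR gerBl ln_nat_ge0.
rewrite !(roughavgE _ _ _ M) // (bigID (fun n : 'I_M => (p %| n)%N)) /= addrC.
congr (_ + _).
  by apply: eq_bigl => n; rewrite -!andbA; congr (_ && (_ && _)); rewrite andbC.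
pose Q n := [&& (0 < n)%N, ln (n%:R : RT) < u & rough s n].
under eq_bigl do rewrite andbC.
rewrite (sum_multiples _ p M Q (fun n => F (u - ln n%:R) / n%:R)) //; last first.
  by move=> n /and3P[n0 nu _]; exact: (lt_of_ln _ _ _ _ n0 nu).
rewrite mulr_sumr big_mkcond [RHS]big_mkcond /=; apply: eq_bigr => m _.
rewrite /Q muln_gt0 p0 /=; case: (posnP m) => [->//|m0] /=.
rewrite ln_natM // ltrBrDl.
have -> : rough s (p * m) = rough s m.
  apply: eq_in_all => q qs; have pq := allP prs q qs.
  rewrite Euclid_dvdM // dvdn_prime2 //.
  by case: eqP qs ps => // -> ->.
case: ifP => // _; rewrite opprD addrA natrM invfM; ring.
Qed.

End Operators.

(** * Inserting the same Euler factor [k] times *)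

Section Chain.
Variable RT : realType.
Variables (F : nat -> RT -> RT) (k : nat) (q d : RT).
Hypothesis SF : forall i, (i <= k)%N -> summatory RT (F i).
Hypothesis q0 : 0 < q.
Hypothesis q1 : q <= 2^-1.
Hypothesis d0 : 0 <= d.
Hypothesis FS : forall i, (i < k)%N -> forall u, F i.+1 u = F i u + q * F i.+1 (u - d).
Implicit Types (u : RT) (i : nat).

Let Fge0 i u : (i <= k)%N -> 0 <= F i u.
Proof. by move=> ik; exact/summatory_ge0/SF. Qed.

Let Fshift i u : (i <= k)%N -> F i (u - d) <= F i u.
Proof. by move=> ik; have [_] := SF i ik; apply; rewrite gerBl. Qed.

(** Formally [F i] is [F 0] under the [i]-th power of a geometric series in [q] times the shift; the
    terms of order 0 and 1 are kept. *)
Lemma chain_ge i u : (i <= k)%N -> F 0%N u + i%:R * q * F 0%N (u - d) <= F i u.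
Proof.
elim: i u => [|i IH] u ik; first by rewrite !mul0r addr0.
have F0i v : F 0%N v <= F i.+1 v.
  have h := IH v (ltnW ik); rewrite FS //.
  have t2 := mulr_ge0 (ltW q0) (Fge0 i.+1 (v - d) ik).
  have t1 := mulr_ge0 (mulr_ge0 (ler0n RT i) (ltW q0)) (Fge0 0%N (v - d) (leq0n _)).
  by lra.
have h := IH u (ltnW ik); rewrite FS // -natr1.
have := ler_wpM2l (ltW q0) (F0i (u - d)); lra.
Qed.

(** By monotonicity [F i.+1 (u - 2d) <= F i.+1 (u - d)], so the recursion taken at [u - d] bounds
    [F i.+1 (u - d)] by [F i (u - d) / (1 - q)], without summing a series. *)
Lemma chain_step_le i u : (i < k)%N -> F i.+1 u <= F i u + q / (1 - q) * F i (u - d).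
Proof.
move=> ik; have q2 : 0 < 1 - q by have := q1; lra.
have h : (1 - q) * F i.+1 (u - d) <= F i (u - d).
  have := FS i ik (u - d); have := ler_wpM2l (ltW q0) (Fshift i.+1 (u - d) ik); lra.
rewrite FS // lerD2l -mulrA ler_wpM2l ?(ltW q0) // mulrC ler_pdivlMr // mulrC //.
Qed.

Lemma chain_le i u : (i <= k)%N ->
  F i u <= F 0%N u + ((1 + q / (1 - q)) ^+ i - 1) * F 0%N (u - d).
Proof.
have a0 : 0 <= q / (1 - q) by rewrite divr_ge0 ?(ltW q0) //; have := q1; lra.
set al := q / (1 - q) in a0 *.
elim: i u => [|i IH] u ik; first by rewrite expr0 subrr mul0r addr0.
apply: le_trans (chain_step_le i u ik) _; rewrite -/al.
have h1 := IH u (ltnW ik); have h2 := ler_wpM2l a0 (IH (u - d) (ltnW ik)).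
have b1 : 0 <= (1 + al) ^+ i - 1 by rewrite subr_ge0 exprn_ege1 // lerDl.
have h3 := ler_wpM2l (mulr_ge0 a0 b1) (Fshift 0%N (u - d) (leq0n _)).
rewrite exprS; set b := (1 + al) ^+ i in h1 h2 h3 b1 *.
set f0 := F 0%N u in h1 *; set f1 := F 0%N (u - d) in h1 h2 h3 *.
set f2 := F 0%N _ in h2 h3.
have -> : f0 + ((1 + al) * b - 1) * f1 = (f0 + (b - 1) * f1) + al * (f1 + (b - 1) * f1) by ring.
apply: lerD => //; apply: le_trans h2 _.
by rewrite !mulrDr lerD2l !mulrA.
Qed.

End Chain.

Lemma sum_ord_gt0 (V : nmodType) (G : nat -> V) (M : nat) :
  \sum_(n < M | (0 < n)%N) G n = \sum_(1 <= n < M) G n.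
Proof.
elim: M => [|[|M] IH]; first by rewrite big_ord0 big_geq.
  by rewrite big_mkcond big_ord_recl big_ord0 big_geq //= addr0.
by rewrite big_mkcond big_ord_recr /= -big_mkcond /= IH [RHS]big_nat_recr.
Qed.

Section Asymptotics.
Local Open Scope classical_set_scope.
Variable RT : realType.
Implicit Types (F : RT -> RT) (u : RT) (k i : nat).

Lemma cvg_pow_pinfty (d : RT) k : (1 - d * u^-1) ^+ k @[u --> +oo] --> (1 : RT).
Proof.
have e : (1 : RT) = (1 - d * 0) ^+ k by rewrite mulr0 subr0 expr1n.
rewrite [X in _ --> X]e.
apply: (@cvg_comp _ _ _ (fun u => 1 - d * u^-1) (fun u => u ^+ k) _ (nbhs (1 - d * 0))); last exact: exprn_continuous.
apply: cvgB; first exact: cvg_cst.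
by apply: cvgM; [exact: cvg_cst|exact: cvg_inv_pinfty].
Qed.

Lemma cvg_shift_pinfty F k (c d : RT) : F u / u ^+ k @[u --> +oo] --> c ->
  F (u - d) / u ^+ k @[u --> +oo] --> c.
Proof.
move=> Fc.
have sh : (u - d : RT) @[u --> +oo] --> +oo.
  apply/cvgryPge => A; near=> u; rewrite lerBrDr; apply/ltW.
  by near: u; exact: near_pinfty_gt.
have h1 : F (u - d) / (u - d) ^+ k @[u --> +oo] --> c.
  exact: (@cvg_comp _ _ _ (fun u => u - d) (fun u => F u / u ^+ k) _ _ _ sh Fc).
have h2 := cvg_pow_pinfty d k.
rewrite -[c]mulr1; apply: cvg_trans (cvgM h1 h2); apply: near_eq_cvg; near=> u.
have u0 : 0 < u by near: u; exact: near_pinfty_gt.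
have ud : 0 < u - d by rewrite subr_gt0; near: u; exact: near_pinfty_gt.
rewrite /=; have -> : 1 - d / u = (u - d) / u by field; rewrite gt_eqF.
rewrite exprMn exprVn mulrA divfK // expf_neq0 // gt_eqF //.
Unshelve. all: by end_near. Qed.

(** Read downwards, the recursion is exact: [F i] is [F i.+1] minus [q] times its shift. A shift
    does not change the limit, so each step multiplies it by [1 - q]. *)
Lemma cvg_chain (F : nat -> RT -> RT) k m (q d c : RT) :
  (forall i, (i < m)%N -> forall u, F i.+1 u = F i u + q * F i.+1 (u - d)) ->
  F m u / u ^+ k @[u --> +oo] --> c ->
  F 0%N u / u ^+ k @[u --> +oo] --> c * (1 - q) ^+ m.
Proof.
elim: m c => [|m IH] c FS Fc; first by rewrite expr0 mulr1.
rewrite exprS mulrA; apply: IH => [i im u|]; first by apply: FS; rewrite ltnS ltnW.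
have -> : (fun u => F m u / u ^+ k) =
   (fun u => F m.+1 u / u ^+ k - q * (F m.+1 (u - d) / u ^+ k)).
  by apply/funext => u; rewrite [F m.+1 u]FS //; ring.
rewrite mulrBr mulr1 [c * q]mulrC; apply: cvgB => //.
apply: cvgM; first exact: cvg_cst.
exact: cvg_shift_pinfty.
Qed.

Lemma pow_diff_le i (x y : RT) : 0 <= y -> y <= x ->
  i.+1%:R * y ^+ i * (x - y) <= x ^+ i.+1 - y ^+ i.+1 <= i.+1%:R * x ^+ i * (x - y).
Proof.
move=> y0 yx; have x0 := le_trans y0 yx.
elim: i => [|i /andP[IH1 IH2]]; first by rewrite !expr0 !expr1 !mul1r lexx.
have e : x ^+ i.+2 - y ^+ i.+2 = x * (x ^+ i.+1 - y ^+ i.+1) + y ^+ i.+1 * (x - y).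
  by rewrite !exprS; ring.
have e' : x ^+ i.+2 - y ^+ i.+2 = y * (x ^+ i.+1 - y ^+ i.+1) + x ^+ i.+1 * (x - y).
  by rewrite !exprS; ring.
have xy : 0 <= x - y by rewrite subr_ge0.
have ei z : i.+2%:R * z ^+ i.+1 * (x - y) =
    z * (i.+1%:R * z ^+ i * (x - y)) + z ^+ i.+1 * (x - y).
  by rewrite -[i.+2%:R]natr1 exprS; ring.
have h2 : y ^+ i.+1 * (x - y) <= x ^+ i.+1 * (x - y).
  by rewrite ler_wpM2r // lerXn2r ?nnegrE.
apply/andP; split; rewrite ei.
  by rewrite e' lerD // ler_wpM2l.
by rewrite e lerD // ler_wpM2l.
Qed.

(** Telescoping with [1 / n >= ln (n+1) - ln n]; truncating [P] at 0 makes the last term vanish. *)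
Lemma roughavg_nil_ge F i : (forall u, 0 < u -> u ^+ i / i`!%:R <= F u) ->
  forall u, 0 < u -> u ^+ i.+1 / i.+1`!%:R <= roughavg RT [::] F u.
Proof.
move=> Fi u u0; set M := (Num.truncn (expR u)).+1.
have uM : expR u <= M%:R by exact/ltW/truncnS_gt.
have M1 : (1 <= M)%N by [].
pose P (n : nat) : RT := Num.max 0 (u - ln n%:R).
have P0 n : 0 <= P n by rewrite le_max lexx.
have fS : i.+1`!%:R = i.+1%:R * i`!%:R :> RT by rewrite factS natrM.
have f0 : 0 < i`!%:R :> RT by rewrite ltr0n fact_gt0.
have PM : P M = 0.
  apply/max_idPl; rewrite subr_le0 -ler_expR lnK ?posrE ?ltr0n //.
have P1 : P 1%N = u by rewrite /P ln1 subr0; apply/max_idPr/ltW.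
have step n : (0 < n)%N -> P n ^+ i.+1 - P n.+1 ^+ i.+1 <=
    if ln (n%:R : RT) < u then i.+1`!%:R * (F (u - ln n%:R) / n%:R) else 0.
  move=> n0; have n0' : 0 < n%:R :> RT by rewrite ltr0n.
  have lnn : ln (n%:R : RT) <= ln n.+1%:R by rewrite ler_ln ?posrE ?ltr0n // ler_nat.
  have PP : P n.+1 <= P n by rewrite /P le_max2 // lerD2l lerN2.
  case: ltP => [nu|un]; last first.
    have -> : P n = 0 by apply/max_idPl; rewrite subr_le0.
    by rewrite expr0n /= sub0r oppr_le0 exprn_ge0.
  have Pn : P n = u - ln n%:R by apply/max_idPr; rewrite subr_ge0 ltW.
  have /andP[_ h] := pow_diff_le i (P n) (P n.+1) (P0 _) PP; apply: le_trans h _.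
  have d : P n - P n.+1 <= n%:R^-1.
    apply: (@le_trans _ _ (ln n.+1%:R - ln n%:R)).
      by rewrite Pn lerBlDr -lerBlDl (_ : _ - _ = u - ln n.+1%:R) ?le_max ?lexx ?orbT //; ring.
    rewrite -ln_div ?posrE ?ltr0n //.
    have -> : n.+1%:R / n%:R = 1 + n%:R^-1 :> RT.
      by rewrite -natr1 mulrDl divff ?gt_eqF // mul1r.
    by apply: le_ln1Dx; rewrite (lt_trans (ltrN10 _)) // invr_gt0.
  have Fn : P n ^+ i <= i`!%:R * F (P n).
    by rewrite mulrC -ler_pdivrMr // Fi // Pn subr_gt0.
  rewrite -Pn fS -!mulrA ler_wpM2l // mulrA; apply: ler_pM => //.
    by rewrite exprn_ge0.
  by rewrite subr_ge0.
rewrite (roughavgE _ _ _ _ M) // ler_pdivrMr ?ltr0n ?fact_gt0 //.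
have tel : \sum_(1 <= n < M) (P n ^+ i.+1 - P n.+1 ^+ i.+1) = u ^+ i.+1.
  rewrite (telescope_sumr_eq (fun n => - P n ^+ i.+1)) => [||n _] //; last by rewrite opprK addrC.
  by rewrite PM P1 expr0n /= oppr0 add0r opprK.
rewrite -tel mulrC mulr_sumr (eq_bigl (fun n : 'I_M => (0 < n)%N && (ln (n%:R : RT) < u))); last first.
  by move=> n; rewrite andbT.
rewrite big_mkcondr /= (sum_ord_gt0 _ (fun n => if ln (n%:R : RT) < u then
   i.+1`!%:R * (F (u - ln n%:R) / n%:R) else 0)) big_seq [leRHS]big_seq; apply: ler_sum => n.
by rewrite mem_index_iota => /andP[n0 _]; exact: step.
Qed.

(** Telescoping with [1 / (n+1) <= ln (n+1) - ln n], which leaves the term [n = 1] aside. *)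
Lemma roughavg_nil_le F i : (forall u, 0 < u -> F u <= (u + i%:R) ^+ i / i`!%:R) ->
  forall u, 0 < u -> roughavg RT [::] F u <= (u + i.+1%:R) ^+ i.+1 / i.+1`!%:R.
Proof.
move=> Fi u u0; set M := (Num.truncn (expR u)).+1.
have uM : expR u <= M%:R by exact/ltW/truncnS_gt.
have M1 : (1 < M)%N by rewrite -(ltr_nat RT); apply: lt_le_trans uM; rewrite expR_gt1.
pose Q (n : nat) : RT := Num.max 0 (u - ln n%:R) + i%:R.
have Q0 n : 0 <= Q n by rewrite addr_ge0 // le_max lexx.
have fS : i.+1`!%:R = i.+1%:R * i`!%:R :> RT by rewrite factS natrM.
have f0 : 0 < i`!%:R :> RT by rewrite ltr0n fact_gt0.
have Q1 : Q 1%N = u + i%:R by rewrite /Q ln1 subr0; congr (_ + _); apply/max_idPr/ltW.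
have step n : (0 < n)%N ->
    (if ln (n.+1%:R : RT) < u then i.+1`!%:R * (F (u - ln n.+1%:R) / n.+1%:R) else 0)
    <= Q n ^+ i.+1 - Q n.+1 ^+ i.+1.
  move=> n0; have n0' : 0 < n%:R :> RT by rewrite ltr0n.
  have lnn : ln (n%:R : RT) <= ln n.+1%:R by rewrite ler_ln ?posrE ?ltr0n // ler_nat.
  have QQ : Q n.+1 <= Q n.
    rewrite lerD2r; case: (leP 0 (u - ln n.+1%:R)) => h; last by rewrite le_max lexx.
    by rewrite le_max lerD2l lerN2 lnn orbT.
  case: ltP => [nu|un]; last by rewrite subr_ge0 lerXn2r ?nnegrE.
  have Qn1 : Q n.+1 = u - ln n.+1%:R + i%:R.
    by congr (_ + _); apply/max_idPr; rewrite subr_ge0 ltW.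
  have /andP[h _] := pow_diff_le i (Q n) (Q n.+1) (Q0 _) QQ; apply: le_trans _ h.
  have d : n.+1%:R^-1 <= Q n - Q n.+1.
    apply: (@le_trans _ _ (ln n.+1%:R - ln n%:R)); last first.
      rewrite Qn1 /Q.
      have : u - ln n%:R <= Num.max 0 (u - ln n%:R) by rewrite le_max lexx orbT.
      by move: (Num.max _ _) => z; lra.
    rewrite -opprB -ln_div ?posrE ?ltr0n //.
    have -> : n%:R / n.+1%:R = 1 + - n.+1%:R^-1 :> RT.
      by rewrite -[X in X / _](addrK 1) natr1 mulrBl divff ?pnatr_eq0 // mul1r.
    by rewrite lerNr; apply: le_ln1Dx; rewrite ltrN2 invf_lt1 ?ltr0n // ltr1n.
  have Fn : i`!%:R * F (u - ln n.+1%:R) <= Q n.+1 ^+ i.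
    by rewrite mulrC -ler_pdivlMr // Qn1 Fi // subr_gt0.
  rewrite fS -!mulrA ler_wpM2l // mulrA.
  apply: (@le_trans _ _ (Q n.+1 ^+ i * n.+1%:R^-1)); first by rewrite ler_wpM2r.
  by rewrite ler_wpM2l // exprn_ge0.
rewrite (roughavgE _ _ _ _ M) // ler_pdivlMr ?ltr0n ?fact_gt0 //.
rewrite mulrC mulr_sumr (eq_bigl (fun n : 'I_M => (0 < n)%N && (ln (n%:R : RT) < u))); last first.
  by move=> n; rewrite andbT.
rewrite big_mkcondr /= (sum_ord_gt0 _ (fun n => if ln (n%:R : RT) < u then
   i.+1`!%:R * (F (u - ln n%:R) / n%:R) else 0)) big_ltn // ln1 u0 subr0 divr1.
rewrite big_add1 /=.
have tel : \sum_(1 <= n < M.-1) (Q n ^+ i.+1 - Q n.+1 ^+ i.+1) = Q 1%N ^+ i.+1 - Q M.-1 ^+ i.+1.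
  rewrite (telescope_sumr_eq (fun n => - Q n ^+ i.+1)) => [||n _]; rewrite ?opprK.
  - by rewrite addrC.
  - by rewrite -ltnS (ltn_predK M1).
  - by rewrite addrC.
apply: (@le_trans _ _ (i.+1`!%:R * F u + (Q 1%N ^+ i.+1 - Q M.-1 ^+ i.+1))).
  rewrite lerD2l -tel big_seq [leRHS]big_seq; apply: ler_sum => n.
  by rewrite mem_index_iota => /andP[n0 _]; exact: step.
(* The extra 1 in the base absorbs the term [n = 1]: [(Q 1 + 1)^(i+1) - (Q 1)^(i+1)] is at least
   [(i+1) (Q 1)^i]. *)
have -> : u + i.+1%:R = Q 1%N + 1 by rewrite Q1 -addrA natr1.
have q1 : Q 1%N <= Q 1%N + 1 by rewrite lerDl.
have /andP[h _] := pow_diff_le i (Q 1%N + 1) (Q 1%N) (Q0 _) q1.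
have Fu : i.+1`!%:R * F u <= i.+1%:R * Q 1%N ^+ i.
  by rewrite fS -mulrA ler_wpM2l // mulrC -ler_pdivlMr // Q1 Fi.
have : 0 <= Q M.-1 ^+ i.+1 by rewrite exprn_ge0.
have e : i.+1%:R * Q 1%N ^+ i * (Q 1%N + 1 - Q 1%N) = i.+1%:R * Q 1%N ^+ i by ring.
rewrite e in h; lra.
Qed.

Lemma iter_roughavg_nil k u : 0 < u ->
  u ^+ k / k`!%:R <= iter k (roughavg RT [::]) (unitstep RT) u <= (u + k%:R) ^+ k / k`!%:R.
Proof.
elim: k u => [|k IH] u u0; first by rewrite /= /unitstep u0 !expr0 fact0 divr1 lexx.
by rewrite iterS roughavg_nil_ge ?roughavg_nil_le // => v v0; have /andP[] := IH v v0.
Qed.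

Lemma cvg_iter_roughavg_nil k :
  iter k (roughavg RT [::]) (unitstep RT) u / u ^+ k @[u --> +oo] --> (k`!%:R^-1 : RT).
Proof.
have f0 : 0 < k`!%:R :> RT by rewrite ltr0n fact_gt0.
apply: (@squeeze_cvgr _ _ _ _ (fun=> k`!%:R^-1) (fun u => (1 + k%:R * u^-1) ^+ k / k`!%:R)).
- near=> u; have u0 : 0 < u by near: u; exact: near_pinfty_gt.
  have uk : 0 < u ^+ k by rewrite exprn_gt0.
  have /andP[h1 h2] := iter_roughavg_nil k u u0.
  rewrite ler_pdivlMr // ler_pdivrMr // mulrC h1 /=; apply: le_trans h2 _.
  rewrite mulrAC -exprMn mulrDl mul1r divfK ?gt_eqF //.
- exact: cvg_cst.
- rewrite -[X in _ --> X]mul1r; apply: cvgM; last exact: cvg_cst.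
  have := cvg_pow_pinfty (- k%:R) k.
  by under eq_fun do rewrite mulNr opprK.
Unshelve. all: by end_near. Qed.

End Asymptotics.

(** Recursive so that passing from [z] to [z.+1] conses at most one prime, which is the induction
    step on hybrids. *)
Fixpoint primes_upto (z : nat) : seq nat :=
  if z is z'.+1 then if prime z then z :: primes_upto z' else primes_upto z' else [::].

Lemma mem_primes_upto (z p : nat) : (p \in primes_upto z) = prime p && (p <= z)%N.
Proof.
elim: z => [|z IH]; first by rewrite in_nil leqn0 andbC; case: eqP => // ->.
rewrite /=; case: ifPn => pz; rewrite ?inE IH [(p <= z.+1)%N]leq_eqVlt ltnS.
  by case: eqP => [->|_] //=; rewrite pz.
by case: eqP => [->|_] //=; rewrite (negPf pz).
Qed.

Lemma all_prime_primes_upto z : all prime (primes_upto z).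
Proof. by apply/allP => p; rewrite mem_primes_upto => /andP[]. Qed.

Lemma pow1D_le2 (RT : realType) (k : nat) (al : RT) : 0 <= al <= 1 ->
  (1 + al) ^+ k <= 1 + k%:R * al + 4 ^+ k * al ^+ 2.
Proof.
case/andP=> a0 a1; elim: k => [|k IH].
  by rewrite !expr0 mul0r addr0 mul1r lerDl sqr_ge0.
rewrite exprS -natr1 exprS; apply: le_trans (ler_wpM2l _ IH) _; first by lra.
have k4 : k%:R <= 4 ^+ k :> RT.
  by rewrite -natrX ler_nat ltnW // ltn_expl.
have f0 : 0 <= 4 ^+ k :> RT by rewrite exprn_ge0.
set f := 4 ^+ k in k4 f0 *; set x := k%:R in k4 *.
have x0 : 0 <= x by rewrite /x.
have A2 : 0 <= al ^+ 2 by exact: sqr_ge0.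
have h1 : al ^+ 2 * x <= al ^+ 2 * f by rewrite ler_wpM2l.
have h2 : al ^+ 2 * f * al <= al ^+ 2 * f * 1 by rewrite ler_wpM2l // mulr_ge0.
have h3 : 0 <= al ^+ 2 * f by rewrite mulr_ge0.
rewrite -subr_ge0.
have -> : 1 + (x + 1) * al + 4 * f * al ^+ 2 - (1 + al) * (1 + x * al + f * al ^+ 2) =
  al ^+ 2 * f * 3 - al ^+ 2 * x - al ^+ 2 * f * al by ring.
lra.
Qed.

Section Constant.
Local Open Scope classical_set_scope.
Variables (RT : realType) (a : nat -> RT) (k : nat).
Hypothesis sq : sqmult RT a.
Implicit Types (F X Y : RT -> RT) (u v : RT) (s : seq nat) (n p z P i : nat).

Definition addprimes s X := foldr (fun p F => addprime RT (a p) p F) X s.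

Lemma translinear_addprimes s : translinear RT (addprimes s).
Proof.
elim: s => [|p s IH]; first by split.
apply: (translinear_comp _ (addprime RT (a p) p) (addprimes s)) => //.
by apply: translinear_addprime; exact: sqmult_ge0.
Qed.

Lemma eq_addprimes s X Y u : (forall v, v <= u -> X v = Y v) ->
  addprimes s X u = addprimes s Y u.
Proof.
elim: s u => [|p s IH] u XY /=; first exact: XY.
rewrite /addprime (IH u) // (IH (u - ln p%:R)) // => v vu; apply: XY.
by apply: le_trans vu _; rewrite gerBl ln_nat_ge0.
Qed.

(* The Dirichlet series of [hybrid s] has the Euler factor [1 + a p X] at the primes
   of [s] and that of [zeta ^ k] at all other primes. *)
Definition hybrid s := addprimes s (iter k (roughavg RT s) (unitstep RT)).

(** Interpolates between [hybrid s], at [i = k], and [hybrid (p :: s)] without its factor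
    [1 + a p X], at [i = 0]: the zeta factor at [p] is present [i] times. It is a chain in the sense
    of the section [Chain]. *)
Let Fi p s i := addprimes s (iter (k - i) (roughavg RT (p :: s))
   (iter i (roughavg RT s) (unitstep RT))).

Let summatory_Fi p s i : summatory RT (Fi p s i).
Proof.
apply: (translinear_addprimes s).1.
apply: (translinear_iter _ _ _ (translinear_roughavg _ _)).1.
apply: (translinear_iter _ _ _ (translinear_roughavg _ _)).1.
exact: summatory_unitstep.
Qed.

Let Fi_step p s : prime p -> p \notin s -> all prime s -> forall i, (i < k)%N ->
  forall u, Fi p s i.+1 u = Fi p s i u + p%:R^-1 * Fi p s i.+1 (u - ln p%:R).
Proof.
move=> pp ps prs i ik u; rewrite {2}/Fi -(subnSK ik) iterSr.
set Z := iter i _ _.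
have SZ : summatory RT Z.
  apply: (translinear_iter _ _ _ (translinear_roughavg _ _)).1.
  exact: summatory_unitstep.
have T := translinear_comp _ _ _ (translinear_addprimes s)
   (translinear_iter _ (k - i.+1) _ (translinear_roughavg RT (p :: s))).
apply: T.2; [exact: summatory_roughavg|exact: summatory_roughavg|].
exact: roughavg_cons.
Qed.

Let hybrid_cons p s : hybrid (p :: s) = addprime RT (a p) p (Fi p s 0).
Proof. by rewrite /hybrid /Fi subn0. Qed.

Let hybrid_Fk p s : hybrid s = Fi p s k.
Proof. by rewrite /hybrid /Fi subnn. Qed.

Lemma cvg_hybrid_cons p s (c : RT) : prime p -> p \notin s -> all prime s ->
  hybrid s u / u ^+ k @[u --> +oo] --> c ->
  hybrid (p :: s) u / u ^+ k @[u --> +oo] --> c * ((1 + a p) * (1 - p%:R^-1) ^+ k).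
Proof.
move=> pp ps prs; rewrite (hybrid_Fk p s) => hc.
have h0 := cvg_chain RT (Fi p s) k k p%:R^-1 (ln p%:R) c (Fi_step p s pp ps prs) hc.
have h1 := cvg_shift_pinfty RT _ k _ (ln p%:R) h0.
rewrite hybrid_cons.
have -> : (fun u => addprime RT (a p) p (Fi p s 0) u / u ^+ k) =
  (fun u => Fi p s 0 u / u ^+ k + a p * (Fi p s 0 (u - ln p%:R) / u ^+ k)).
  by apply/funext => u; rewrite /addprime; ring.
have -> : c * ((1 + a p) * (1 - p%:R^-1) ^+ k) =
  c * (1 - p%:R^-1) ^+ k + a p * (c * (1 - p%:R^-1) ^+ k) by ring.
by apply: cvgD => //; apply: cvgM => //; exact: cvg_cst.
Qed.

Lemma cvg_hybrid_upto z : hybrid (primes_upto z) u / u ^+ k @[u --> +oo] -->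
  k`!%:R^-1 * \prod_(p < z.+1 | prime p) ((1 + a p) * (1 - p%:R^-1) ^+ k).
Proof.
elim: z => [|z IH].
  rewrite big_mkcond big_ord_recl big_ord0 /= !mulr1.
  exact: cvg_iter_roughavg_nil.
rewrite big_mkcond big_ord_recr /= -big_mkcond /=.
case: ifPn => pz; last by rewrite mulr1.
have zs : z.+1 \notin primes_upto z by rewrite mem_primes_upto ltnn andbF.
rewrite (mulrA k`!%:R^-1).
exact: (cvg_hybrid_cons z.+1 (primes_upto z) _ pz zs (all_prime_primes_upto z) IH).
Qed.

(** The term [4 k^2] covers the gap between [k / (p - k)] and [k / p], and [2 * 4^k] the
    second-order part of [(1 + 1 / (p - 1))^k], both measured against [1 / (p (p - 1))]. *)
Definition cdev : RT := 4 * k%:R ^+ 2 + 2 * 4 ^+ k.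

Lemma cdev_ge0 : 0 <= cdev.
Proof. by rewrite addr_ge0 // mulr_ge0 // ?sqr_ge0 // exprn_ge0. Qed.

(** Both hybrids have the form [f0 + c f1] with [f1] the shift of [f0]: for one [c = k / (p - k)],
    for the other [c] lies between [k / p] and [(1 + 1 / (p - 1))^k - 1]. These agree up to
    [O(1 / p^2)], and [f1] is bounded by either hybrid. *)
Lemma hybrid_compare p s u : prime p -> p \notin s -> all prime s -> (2 * k < p)%N ->
  a p = k%:R / (p%:R - k%:R) ->
  hybrid (p :: s) u <= (1 + cdev / (p%:R * (p%:R - 1))) * hybrid s u /\
  hybrid s u <= (1 + cdev / (p%:R * (p%:R - 1))) * hybrid (p :: s) u.
Proof.
move=> pp ps prs kp ap.
have p2 : 2 <= p%:R :> RT by rewrite ler_nat prime_gt1.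
have p0 : 0 < p%:R :> RT by lra.
have pk : 2 * k%:R < p%:R :> RT by rewrite -natrM ltr_nat.
have k0 : 0 <= k%:R :> RT by [].
have q0 : 0 < (p%:R^-1 : RT) by rewrite invr_gt0.
have q1 : (p%:R^-1 : RT) <= 2^-1 by rewrite lef_pV2 ?posrE.
have SF i : (i <= k)%N -> summatory RT (Fi p s i) by move=> _; exact: summatory_Fi.
have ge := chain_ge RT (Fi p s) k p%:R^-1 (ln p%:R) SF q0 (Fi_step p s pp ps prs) k u (leqnn k).
have le := chain_le RT (Fi p s) k p%:R^-1 (ln p%:R) SF q0 q1 (ln_nat_ge0 RT p) (Fi_step p s pp ps prs) k u (leqnn k).
rewrite hybrid_cons (hybrid_Fk p s) /addprime ap.
have f1_ge0 : 0 <= Fi p s 0 (u - ln p%:R) by exact/summatory_ge0/summatory_Fi.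
have f10 : Fi p s 0 (u - ln p%:R) <= Fi p s 0 u.
  by have [_] := summatory_Fi p s 0; apply; rewrite gerBl ln_nat_ge0.
have alE : p%:R^-1 / (1 - p%:R^-1) = (p%:R - 1)^-1 :> RT.
  by field; rewrite !gt_eqF //; lra.
rewrite alE in le.
move: ge le f1_ge0 f10; move: (Fi p s k u) (Fi p s 0 u) (Fi p s 0 (u - ln p%:R)).
move=> fk f0 f1 ge le f1_ge0 f10.
move: p0 p2 pk q0 q1 alE ge le; move: (p%:R : RT) => x x0 x2 xk _ _ _ ge le.
have x1 : 0 < x * (x - 1) by rewrite mulr_gt0 //; lra.
have xk0 : 0 < x - k%:R by lra.
set dl := cdev / (x * (x - 1)).
have dl0 : 0 <= dl by rewrite divr_ge0 ?cdev_ge0 ?(ltW x1).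
have g0 : 0 <= k%:R / (x - k%:R) by rewrite divr_ge0 // ltW.
have n1 : k%:R / (x - k%:R) <= k%:R * x^-1 + dl.
  have -> : k%:R / (x - k%:R) = k%:R * x^-1 + k%:R ^+ 2 / (x * (x - k%:R)).
    by field; rewrite !gt_eqF.
  rewrite lerD2l ler_pdivrMr ?mulr_gt0 // /dl mulrAC ler_pdivlMr // /cdev.
  have kk : 0 <= k%:R ^+ 2 :> RT by exact: sqr_ge0.
  have f4 : 0 <= 4 ^+ k :> RT by rewrite exprn_ge0.
  have xx : 0 <= x * (x - k%:R) by rewrite mulr_ge0 ?(ltW x0) ?(ltW xk0).
  have h : x * (x - 1) <= 4 * (x * (x - k%:R)).
    have : 0 <= x * (x - 2 * k%:R) by rewrite mulr_ge0; lra.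
    by nra.
  have := ler_wpM2l kk h; have := mulr_ge0 f4 xx; nra.
have n2 : (1 + (x - 1)^-1) ^+ k - 1 <= k%:R / (x - k%:R) + dl.
  have al01 : 0 <= (x - 1)^-1 <= 1.
    by apply/andP; split; [rewrite invr_ge0|rewrite invf_le1]; lra.
  have := pow1D_le2 RT k (x - 1)^-1 al01.
  have b1 : k%:R * (x - 1)^-1 <= k%:R / (x - k%:R).
    case: (posnP k) => [->|kpos]; first by rewrite !mul0r.
    rewrite ler_wpM2l // lef_pV2 ?posrE //; last by lra.
    by rewrite lerD2l lerN2 ler1n.
  have b2 : 4 ^+ k * (x - 1)^-1 ^+ 2 <= dl.
    rewrite /dl exprVn ler_pdivlMr // mulrAC ler_pdivrMr; last by rewrite exprn_gt0 //; lra.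
    rewrite /cdev.
    have kk : 0 <= k%:R ^+ 2 * (x - 1) ^+ 2 :> RT by rewrite mulr_ge0 // sqr_ge0.
    have f4 : 0 <= 4 ^+ k :> RT by rewrite exprn_ge0.
    have h : x * (x - 1) <= 2 * (x - 1) ^+ 2 by rewrite expr2; nra.
    have := ler_wpM2l f4 h; nra.
  lra.
split.
  have h : k%:R / (x - k%:R) * f1 <= (k%:R * x^-1 + dl) * f1 by rewrite ler_wpM2r.
  have h0 : 0 <= k%:R * x^-1 * f1 by rewrite !mulr_ge0 // invr_ge0 ltW.
  have h2 : dl * f1 <= dl * fk by rewrite ler_wpM2l //; lra.
  lra.
have h : ((1 + (x - 1)^-1) ^+ k - 1) * f1 <= (k%:R / (x - k%:R) + dl) * f1 by rewrite ler_wpM2r.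
have h2 : dl * f1 <= dl * (f0 + k%:R / (x - k%:R) * f1).
  rewrite ler_wpM2l //; have := mulr_ge0 g0 f1_ge0; lra.
lra.
Qed.

Section Tail.
Variable P : nat.
Hypothesis P0 : (0 < P)%N.
Hypothesis kP : (2 * k <= P)%N.
Hypothesis aP : forall p, prime p -> (P < p)%N -> a p = k%:R / (p%:R - k%:R).

(** The factors [1 + cdev / (p (p - 1))] are at most exponentials whose exponents telescope when
    taken over all integers, since [1 / (z (z+1)) = 1 / z - 1 / (z+1)]. The bound is the same for
    every [u]. *)
Lemma hybrid_tail z u : (P <= z)%N ->
  hybrid (primes_upto z) u <= expR (cdev * (P%:R^-1 - z%:R^-1)) * hybrid (primes_upto P) u /\
  hybrid (primes_upto P) u <= expR (cdev * (P%:R^-1 - z%:R^-1)) * hybrid (primes_upto z) u.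
Proof.
elim: z => [|z IH] Pz; first by exfalso; have := P0; lia.
move: Pz; rewrite leq_eqVlt => /orP[/eqP <-|]; first by rewrite subrr mulr0 expR0 !mul1r.
rewrite ltnS => Pz; have [h1 h2] := IH Pz.
have H0 s : 0 <= hybrid s u.
  apply: summatory_ge0; apply: (translinear_addprimes s).1.
  apply: (translinear_iter _ _ _ (translinear_roughavg _ _)).1.
  exact: summatory_unitstep.
have z0 : 0 < z%:R :> RT by rewrite ltr0n (leq_trans P0).
have z1 : 0 < z.+1%:R :> RT by rewrite ltr0n.
set e1 := expR (cdev * (P%:R^-1 - z%:R^-1)) in h1 h2.
set e2 := expR _.
have E : e2 = e1 * expR (cdev / (z.+1%:R * (z.+1%:R - 1))).
  rewrite -expRD; congr expR; rewrite -natr1 addrK.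
  have P0' : 0 < P%:R :> RT by rewrite ltr0n P0.
  have z1' : z%:R + 1 != 0 :> RT by rewrite natr1 gt_eqF.
  by field; rewrite z1' !gt_eqF.
have e0 : 0 <= e1 by rewrite expR_ge0.
have d1 : 1 + cdev / (z.+1%:R * (z.+1%:R - 1)) <= expR (cdev / (z.+1%:R * (z.+1%:R - 1))).
  exact: expR_ge1Dx.
have d0 : 0 <= cdev / (z.+1%:R * (z.+1%:R - 1)).
  by rewrite divr_ge0 ?cdev_ge0 // mulr_ge0 // -natr1 addrK ltW.
have d2 : 1 <= expR (cdev / (z.+1%:R * (z.+1%:R - 1))) by apply: le_trans d1; rewrite lerDl.
rewrite E /=; case: ifPn => pz; last first.
  split; [apply: le_trans h1 _|apply: le_trans h2 _]; rewrite ler_wpM2r // ler_peMr //.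
have [||||g1 g2] := hybrid_compare z.+1 (primes_upto z) u pz.
- by rewrite mem_primes_upto ltnn andbF.
- exact: all_prime_primes_upto.
- by rewrite ltnS (leq_trans kP).
- by apply: aP => //; rewrite ltnS.
split.
  apply: le_trans g1 _; rewrite mulrAC mulrC.
  by apply: ler_pM => //; rewrite (le_trans ler01) // lerDl.
apply: le_trans h2 _; rewrite -mulrA ler_wpM2l //; apply: le_trans g2 _.
by rewrite ler_wpM2r.
Qed.
End Tail.

Lemma addprimes_unitstep s u : uniq s -> all prime s ->
  addprimes s (unitstep RT) u = logsum RT a (fun n => all (mem s) (primes n)) 0 u.
Proof.
elim: s u => [|p s IH] u /=.
  move=> _ _; rewrite /unitstep; case: ltP => u0; last by rewrite logsum_le0.
  set M := (Num.truncn (expR u)).+1.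
  have M1 : (1 < M)%N.
    by rewrite -(ltr_nat RT); apply: lt_trans (truncnS_gt _); rewrite expR_gt1.
  rewrite /logsum (bigD1 (Ordinal M1)) /= ?ln1 ?u0 //.
  rewrite expr0 mulr1 big1 => [|n /andP[/and3P[n0 nu Pn] n1]].
    by case: sq => ->; rewrite addr0.
  have n2 : (1 < n)%N.
    by rewrite ltn_neqAle n0 andbT eq_sym; apply: contraNneq n1 => e; apply/eqP/val_inj.
  by move: (allP Pn (pdiv n)); rewrite mem_primes pdiv_prime // n0 pdiv_dvd => /(_ isT).
case/andP=> ps us /andP[pp prs].
rewrite /addprime !IH // (logsum_split _ _ sq (fun n => all (mem (p :: s)) (primes n)) p 0 u) //.
  have E v : logsum RT a (fun m => all (mem (p :: s)) (primes m) && ~~ (p %| m)%N) 0 v =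
     logsum RT a (fun n => all (mem s) (primes n)) 0 v.
    apply: eq_bigl => n; case: (posnP n) => // n0 /=; congr (_ && _).
    apply/andP/allP => [[/allP h pn] q qn|h].
      have := h q qn; rewrite !inE => /orP[/eqP e|//].
      by move: qn; rewrite mem_primes e (negPf pn) !andbF.
    split; first by apply/allP => q /h; rewrite !inE => ->; rewrite orbT.
    apply/negP => pn; have := h p; rewrite mem_primes pp n0 pn => /(_ isT).
    by rewrite inE (negPf ps).
  by rewrite !E.
move=> m pm; have m0 : (0 < m)%N by case: m pm => //; rewrite dvdn0.
have E q : (q \in primes (p * m)) = (q == p) || (q \in primes m).
  rewrite !mem_primes muln_gt0 (prime_gt0 pp) m0 /=.
  case: (boolP (prime q)) => [pq|npq] /=; last by rewrite orbF; case: eqP npq => // ->; rewrite pp.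
  by rewrite Euclid_dvdM // dvdn_prime2.
apply/allP/allP => h q; first by move=> qm; apply: h; rewrite E qm orbT.
by rewrite E => /orP[/eqP ->|/h//]; exact: mem_head.
Qed.

Lemma uniq_primes_upto z : uniq (primes_upto z).
Proof.
elim: z => //= z IH; case: ifP => // _ /=.
by rewrite IH mem_primes_upto ltnn andbF.
Qed.

(** No [n > 1] below [expR u] is free of primes up to [z], so in this range each remaining zeta
    operator acts as the identity. *)
Lemma hybrid_logsum z u : expR u <= z.+1%:R ->
  hybrid (primes_upto z) u = logsum RT a predT 0 u.
Proof.
move=> uz; rewrite /hybrid (@eq_addprimes _ _ (unitstep RT)) => [|v vu].
  rewrite addprimes_unitstep ?uniq_primes_upto ?all_prime_primes_upto //.
  rewrite !(logsumE _ _ _ _ _ z.+1) //; apply: eq_bigl => n.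
  case: (0 < n)%N / posnP => // n0 /=; congr (_ && _); apply/allP => q /=.
  rewrite mem_primes mem_primes_upto => /and3P[-> _ /dvdn_leq -/(_ n0) qn] /=.
  by rewrite (leq_trans qn) // -ltnS.
have vz : expR v <= z.+1%:R by apply: le_trans uz; rewrite ler_expR.
have H F w : w <= v -> summatory RT F -> roughavg RT (primes_upto z) F w = F w.
  move=> wv SF; have [w0|w0] := leP w 0.
    by rewrite (SF.1 w w0) (summatory_roughavg _ _ _ SF).1.
  have wz : expR w <= z.+1%:R by apply: le_trans vz; rewrite ler_expR.
  have z1 : (1 < z.+1)%N.
    by rewrite -(ltr_nat RT); apply: lt_le_trans wz; rewrite expR_gt1.
  rewrite (roughavgE _ _ _ _ z.+1) // (bigD1 (Ordinal z1)) /=; last first.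
    rewrite ln1 w0 /=; apply/allP => q; rewrite mem_primes_upto => /andP[/prime_gt1 q1 _].
    by rewrite dvdn1 neq_ltn q1 orbT.
  rewrite ln1 subr0 divr1 big1 ?addr0 // => n /andP[/and3P[n0 nw rn] n1].
  have n2 : (1 < n)%N.
    by rewrite ltn_neqAle n0 andbT eq_sym; apply: contraNneq n1 => e; apply/eqP/val_inj.
  move: (allP rn (pdiv n)); rewrite mem_primes_upto pdiv_prime // pdiv_dvd /=.
  by rewrite (leq_trans (pdiv_leq n0)) -1?ltnS // => /(_ isT).
have SI m : summatory RT (iter m (roughavg RT (primes_upto z)) (unitstep RT)).
  apply: (translinear_iter _ _ _ (translinear_roughavg _ _)).1.
  exact: summatory_unitstep.
suff : forall m, iter m (roughavg RT (primes_upto z)) (unitstep RT) v = unitstep RT v by [].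
by elim=> //= m IH; rewrite H // IH.
Qed.

(** First [P] is fixed so that [expR (cdev / P)] is close to 1, then [u] grows with the prime set at
    [P] fixed; the passage from [P] to all primes costs only that factor. *)
Lemma cvg_logsum (L : RT) (P1 : nat) :
  (forall p, prime p -> (P1 < p)%N -> a p = k%:R / (p%:R - k%:R)) ->
  (fun z => \prod_(p < z | prime p) ((1 + a p) * (1 - p%:R^-1) ^+ k)) @ \oo --> L ->
  logsum RT a predT 0 u / u ^+ k @[u --> +oo] --> L / k`!%:R.
Proof.
move=> aP1 cL; rewrite mulrC; set c := k`!%:R^-1 * L.
pose cz z := k`!%:R^-1 * \prod_(p < z.+1 | prime p) ((1 + a p) * (1 - p%:R^-1) ^+ k).
have ccz : cz z @[z --> \oo] --> c.
  apply: cvgM; first exact: cvg_cst.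
  have := cL; rewrite -(cvg_shiftn 1).
  by under eq_fun do rewrite addn1.
have ex (t : RT) : expR (t * (cdev * z.+1%:R^-1)) @[z --> \oo] --> (1 : RT).
  have e1 : (1 : RT) = expR (t * (cdev * 0)) by rewrite !mulr0 expR0.
  rewrite [X in _ --> X]e1.
  apply: continuous_cvg; first exact: continuous_expR.
  apply: cvgM; first exact: cvg_cst.
  apply: cvgM; first exact: cvg_cst.
  exact: cvg_harmonic.
have exS (t : RT) : expR (t * (cdev * z%:R^-1)) @[z --> \oo] --> (1 : RT).
  rewrite -(cvg_shiftn 1); have := ex t.
  by under eq_fun do rewrite -addn1.
have up : expR (1 * (cdev * z%:R^-1)) * cz z @[z --> \oo] --> c.
  by rewrite -[c]mul1r; exact: cvgM.
have lo : expR ((-1) * (cdev * z%:R^-1)) * cz z @[z --> \oo] --> c.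
  by rewrite -[c]mul1r; exact: cvgM.
apply/cvgrPdist_le => e e0.
have c1 : c < c + e by rewrite ltrDl.
have c2 : c - e < c by rewrite gtrBl.
have hz : \forall z \near \oo, [/\ expR (1 * (cdev * z%:R^-1)) * cz z < c + e,
    c - e < expR ((-1) * (cdev * z%:R^-1)) * cz z & (P1 + 2 * k + 1 <= z)%N].
  near=> z; split; near: z; [exact: (cvgr_lt _ up)|exact: (cvgr_gt _ lo)|exact: nbhs_infty_ge].
have [P [h1 h2 PP]] : exists P, [/\ expR (1 * (cdev * P%:R^-1)) * cz P < c + e,
    c - e < expR ((-1) * (cdev * P%:R^-1)) * cz P & (P1 + 2 * k + 1 <= P)%N].
  by have [N _ H] := hz; exists N; apply: H => /=.
have P0 : (0 < P)%N by apply: leq_trans PP; rewrite addn1.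
have kP : (2 * k <= P)%N by apply: leq_trans PP; lia.
have aP p : prime p -> (P < p)%N -> a p = k%:R / (p%:R - k%:R).
  by move=> pp Pp; apply: aP1 => //; apply: leq_ltn_trans Pp; apply: leq_trans PP; lia.
set A := expR (1 * (cdev * P%:R^-1)) in h1.
set A' := expR ((-1) * (cdev * P%:R^-1)) in h2.
have AA : A' * A = 1 by rewrite /A /A' -expRD mulN1r mul1r addNr expR0.
have A0 : 0 < A by exact: expR_gt0.
have A'0 : 0 < A' by exact: expR_gt0.
pose h u := hybrid (primes_upto P) u / u ^+ k.
have hc : h u @[u --> +oo] --> cz P by exact: cvg_hybrid_upto.
have hU : A * h u @[u --> +oo] --> A * cz P by apply: cvgM => //; exact: cvg_cst.
have hL : A' * h u @[u --> +oo] --> A' * cz P by apply: cvgM => //; exact: cvg_cst.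
near=> u.
have u0 : 0 < u by near: u; exact: near_pinfty_gt.
have uk : 0 < u ^+ k by rewrite exprn_gt0.
have u1 : A * h u < c + e by near: u; exact: (cvgr_lt _ hU).
have u2 : c - e < A' * h u by near: u; exact: (cvgr_gt _ hL).
(* [z] depends on [u]; this is harmless since the tail bound does not deteriorate with [z]. *)
pose z := maxn P (Num.truncn (expR u)).+1.
have Pz : (P <= z)%N by rewrite leq_maxl.
have uz : expR u <= z.+1%:R.
  apply: le_trans (ltW (truncnS_gt _)) _; rewrite ler_nat.
  by rewrite (leq_trans (leq_maxr P _)) // leqnSn.
have [t1 t2] := hybrid_tail P P0 kP aP z u Pz.
rewrite (hybrid_logsum z u uz) in t1 t2; set G := logsum _ _ _ _ _ in t1 t2 *.
have H0 : 0 <= hybrid (primes_upto P) u.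
  apply: summatory_ge0; apply: (translinear_addprimes _).1.
  apply: (translinear_iter _ _ _ (translinear_roughavg _ _)).1.
  exact: summatory_unitstep.
have G0 : 0 <= G by exact: logsum_ge0.
have eA : expR (cdev * (P%:R^-1 - z%:R^-1)) <= A.
  by rewrite /A mul1r ler_expR ler_wpM2l ?cdev_ge0 // gerBl invr_ge0.
have s1 : G <= A * hybrid (primes_upto P) u by apply: le_trans t1 _; rewrite ler_wpM2r.
have s2 : hybrid (primes_upto P) u <= A * G by apply: le_trans t2 _; rewrite ler_wpM2r.
have s2' : A' * hybrid (primes_upto P) u <= G.
  by rewrite -[G]mul1r -AA -mulrA ler_wpM2l // ltW.
have b1 : G / u ^+ k <= A * h u by rewrite /h mulrA ler_wpM2r // invr_ge0 ltW.
have b2 : A' * h u <= G / u ^+ k by rewrite /h mulrA ler_wpM2r // invr_ge0 ltW.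
by rewrite ler_norml; apply/andP; split; lra.
Unshelve. all: by end_near. Qed.
End Constant.

(** * Residue counts and the singular series *)

Lemma perm_primes_primeM (p m : nat) : prime p -> (0 < m)%N -> ~~ (p %| m)%N ->
  perm_eq (primes (p * m)) (p :: primes m).
Proof.
move=> pp m0 pm; apply: uniq_perm; rewrite ?primes_uniq //=.
  by rewrite primes_uniq mem_primes (negPf pm) !andbF.
move=> q; rewrite inE !mem_primes muln_gt0 (prime_gt0 pp) m0 /=.
case: (boolP (prime q)) => [pq|npq] /=; last by rewrite orbF; case: eqP npq => // ->; rewrite pp.
by rewrite Euclid_dvdM // dvdn_prime2.
Qed.

Lemma mobius1 : mobius 1 = 1. Proof. by []. Qed.

Lemma mobius_primeM (p m : nat) : prime p ->
  mobius (p * m) = if (p %| m)%N then 0 else - mobius m.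
Proof.
move=> pp; have p0 := prime_gt0 pp.
case: (posnP m) => [->|m0]; first by rewrite muln0 dvdn0.
rewrite /mobius muln_eq0 !eqn0Ngt p0 m0 /=; case: (boolP (p %| m)%N) => pm.
  rewrite ifF //; apply/negP => /allP /(_ p).
  rewrite mem_primes pp muln_gt0 p0 m0 dvdn_mulr // => /(_ isT).
  by rewrite lognM // logn_prime // eqxx lognE pp m0 pm.
have pe := perm_primes_primeM p m pp m0 pm.
rewrite (perm_size pe) (perm_all _ pe) /=.
rewrite lognM // logn_prime // eqxx lognE (negPf pm) !andbF /=.
have -> : all (fun q => logn q (p * m) == 1%N) (primes m) =
   all (fun q => logn q m == 1%N) (primes m).
  apply: eq_in_all => q; rewrite mem_primes => /and3P[pq _ qm].
  rewrite lognM // logn_prime // (_ : q == p = false) //.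
  by apply/eqP => e; rewrite -e qm in pm.
by case: ifP => _; rewrite ?oppr0 // exprS mulN1r.
Qed.

(** Induction over squarefree numbers, splitting off the least prime factor. *)
Lemma mobius_neq0_ind (P : nat -> Prop) : P 1%N ->
  (forall p m, prime p -> (0 < m)%N -> ~~ (p %| m)%N -> mobius m != 0 -> P m -> P (p * m)%N) ->
  forall n, mobius n != 0 -> P n.
Proof.
move=> P1 PS; elim/ltn_ind => n IH sn.
case: n IH sn => [|[|n]] IH sn //.
have pp : prime (pdiv n.+2) by rewrite pdiv_prime.
set p := pdiv n.+2 in pp; have pd : (p %| n.+2)%N by exact: pdiv_dvd.
have e : n.+2 = (p * (n.+2 %/ p))%N by rewrite mulnC divnK.
have m0 : (0 < n.+2 %/ p)%N by rewrite divn_gt0 ?prime_gt0 // dvdn_leq.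
move: sn; rewrite e mobius_primeM //; case: ifPn => // pm; rewrite oppr_eq0 => sm.
apply: PS => //; apply: IH => //; rewrite ltn_Pdiv // prime_gt1 //.
Qed.

Lemma mobius_mul (d e : nat) : mobius (d * e) = if coprime d e then mobius d * mobius e else 0.
Proof.
elim/ltn_ind: d e => d IH e; case: d IH => [|[|d]] IH.
- by rewrite mul0n /mobius /= mul0r; case: ifP.
- by rewrite mul1n coprime1n mobius1 mul1r.
have pp : prime (pdiv d.+2) by rewrite pdiv_prime.
set p := pdiv d.+2 in pp; have pd : (p %| d.+2)%N by exact: pdiv_dvd.
have ed : d.+2 = (p * (d.+2 %/ p))%N by rewrite mulnC divnK.
have lt : (d.+2 %/ p < d.+2)%N by rewrite ltn_Pdiv // prime_gt1.
have := IH _ lt e; move: (d.+2 %/ p)%N ed => m -> {IH lt pd} IH.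
rewrite -mulnA (mobius_primeM p (m * e)) // (mobius_primeM p m) // Euclid_dvdM // IH coprimeMl (@prime_coprime p e) //.
case: (p %| m)%N; case: (p %| e)%N; case: (coprime m e) => //=; rewrite ?mul0r ?oppr0 ?mulNr //.
Qed.

Section Nu.
Variable H : seq int.
Implicit Types (n d p m : nat) (x y : int).

Lemma Ppoly_mod d x y : (d%:Z %| x - y)%Z ->
  (d%:Z %| Ppoly H x)%Z = (d%:Z %| Ppoly H y)%Z.
Proof.
move=> dxy; suff h : (d%:Z %| Ppoly H x - Ppoly H y)%Z.
  by rewrite -[Ppoly H x](subrK (Ppoly H y)); exact: rpredDl.
rewrite /Ppoly; elim: H => [|h s IH]; first by rewrite !big_nil subrr dvdz0.
rewrite !big_cons; set A := \prod_(j <- s) _ in IH *; set B := \prod_(j <- s) _ in IH *.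
have -> : (x + h) * A - (y + h) * B = (x + h) * (A - B) + (x - y) * B by ring.
by apply: rpredD; [exact: dvdz_mull|exact: dvdz_mulr].
Qed.

Lemma nuE d : nu H d = (\sum_(a < d) (d%:Z %| Ppoly H a%:Z)%Z)%N.
Proof.
rewrite /nu -sum1_count big_mkcond /=.
rewrite -(big_mkord predT (fun a => (d%:Z %| Ppoly H a%:Z)%Z : nat)) /index_iota subn0.
by apply: eq_bigr => i _; case: (_ %| _)%Z.
Qed.

Lemma dvdz_natmod d n : (d%:Z %| Ppoly H n%:Z)%Z = (d%:Z %| Ppoly H (n %% d)%N%:Z)%Z.
Proof.
apply: Ppoly_mod; rewrite {1}(divn_eq n d) PoszD addrK PoszM.
by rewrite dvdz_mull.
Qed.

(** Chinese remainders: [a] modulo [m * n] corresponds to its pair of residues, and divisibility of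
    the polynomial depends on residues only. *)
Lemma nu_mul m n : (0 < m)%N -> (0 < n)%N -> coprime m n ->
  nu H (m * n) = (nu H m * nu H n)%N.
Proof.
move=> m0 n0 cmn; rewrite !nuE.
have mn0 : (0 < m * n)%N by rewrite muln_gt0 m0.
pose f (a : 'I_(m * n)) : 'I_m * 'I_n :=
  (Ordinal (ltn_pmod a m0), Ordinal (ltn_pmod a n0)).
have fi : injective f.
  move=> a b [e1 e2]; apply: val_inj; apply/eqP.
  have : (a == b %[mod m * n])%N by rewrite chinese_remainder // e1 e2 !eqxx.
  by rewrite !modn_small.
have fb : bijective f by apply: inj_card_bij => //; rewrite card_prod !card_ord.
rewrite big_distrlr /= pair_big /= (reindex f) /=; last exact: onW_bij.
apply: eq_bigr => a _; rewrite -!dvdz_natmod.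
have -> : ((m * n)%N%:Z %| Ppoly H a%:Z)%Z = (m%:Z %| Ppoly H a%:Z)%Z && (n%:Z %| Ppoly H a%:Z)%Z.
  by rewrite !dvdzE /= Gauss_dvd.
by rewrite mulnb.
Qed.

(** The class of [- x], because the roots of the product modulo [p] are the classes of [- h]. *)
Definition residue d x : nat := `|((- x) %% d%:Z)%Z|%N.

Lemma residueP d x : (0 < d)%N -> (residue d x < d)%N /\ (d%:Z %| (residue d x)%:Z + x)%Z.
Proof.
move=> d0; have d0' : d%:Z != 0 by rewrite eqz_nat -lt0n.
have e : (residue d x)%:Z = ((- x) %% d%:Z)%Z by rewrite /residue gez0_abs // modz_ge0.
split; first by rewrite -ltz_nat e ltz_mod.
rewrite e -[X in (_ %| _ + X)%Z]opprK -eqz_mod_dvd.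
by rewrite modz_mod.
Qed.

Lemma dvdz_Ppoly d x h : h \in H -> (d%:Z %| x + h)%Z -> (d%:Z %| Ppoly H x)%Z.
Proof.
by move=> hH dx; rewrite /Ppoly (big_rem h) //= dvdz_mulr.
Qed.

Lemma nu_gt0 d : (0 < d)%N -> (0 < size H)%N -> (0 < nu H d)%N.
Proof.
move=> d0 H0; rewrite /nu -has_count; apply/hasP.
have hH : nth 0 H 0 \in H by exact: mem_nth.
have [r1 r2] := residueP d (nth 0 H 0) d0.
exists (residue d (nth 0 H 0)); first by rewrite mem_iota.
exact: dvdz_Ppoly hH r2.
Qed.

Lemma prime_dvdz_Ppoly p x : prime p ->
  (p%:Z %| Ppoly H x)%Z -> exists2 h, h \in H & (p%:Z %| x + h)%Z.
Proof.
move=> pp; rewrite /Ppoly; elim: H => [|h s IH].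
  by rewrite big_nil dvdzE /= dvdn1 => /eqP e; rewrite e in pp.
rewrite big_cons dvdzE abszM /= Euclid_dvdM // => /orP[d|d].
  by exists h; [rewrite mem_head|rewrite dvdzE].
have [|h' h's hd] := IH; first by rewrite dvdzE.
by exists h' => //; rewrite inE h's orbT.
Qed.

Lemma nu_prime p : prime p -> nu H p = size (undup [seq residue p h | h <- H]).
Proof.
move=> pp; have p0 := prime_gt0 pp; rewrite /nu -size_filter; apply: perm_size.
apply: uniq_perm; rewrite ?filter_uniq ?iota_uniq ?undup_uniq // => a.
rewrite mem_filter mem_iota mem_undup /= add0n.
apply/andP/mapP => [[pa ap]|[h hH ->]].
  have [h hH ph] := prime_dvdz_Ppoly p a%:Z pp pa; exists h => //.
  have [r1 r2] := residueP p h p0.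
  have : (p%:Z %| a%:Z - (residue p h)%:Z)%Z.
    have -> : a%:Z - (residue p h)%:Z = (a%:Z + h) - ((residue p h)%:Z + h) by ring.
    by rewrite rpredB.
  rewrite -eqz_mod_dvd !modz_nat eqz_nat !modn_small // => /eqP.
  exact.
have [r1 r2] := residueP p h p0; split=> //.
exact: dvdz_Ppoly hH r2.
Qed.

Lemma nu_prime_le p : prime p -> (nu H p <= size H)%N.
Proof. by move=> pp; rewrite nu_prime // (leq_trans (size_undup _)) // size_map. Qed.

(** A prime above every difference [h - h'] separates the shifts. This makes the series for beta
    finite and fixes all but finitely many factors of the singular series. *)
Lemma nu_prime_large : uniq H -> exists P0 : nat,
  forall p, prime p -> (P0 < p)%N -> nu H p = size H.
Proof.
move=> uH; exists (\max_(h <- H) \max_(h' <- H) `|h - h'|%N)%N => p pp Pp.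
have p0 := prime_gt0 pp.
rewrite nu_prime // undup_id ?size_map // map_inj_in_uniq // => h h' hH h'H e.
have [_ r1] := residueP p h p0; have [_ r2] := residueP p h' p0.
have : (p%:Z %| h - h')%Z.
  have -> : h - h' = ((residue p h)%:Z + h) - ((residue p h')%:Z + h') by rewrite e; ring.
  by rewrite rpredB.
rewrite dvdzE /= => d; apply/eqP; rewrite -subr_eq0 -absz_eq0.
apply/negPn/negP; rewrite -lt0n => /dvdn_leq /(_ d) le.
have : (`|h - h'| <= \max_(h <- H) \max_(h' <- H) `|h - h'|%N)%N.
  rewrite (big_rem h) //= leq_max; apply/orP; left.
  by rewrite (big_rem h') //= leq_max leqnn.
by rewrite leqNgt (leq_trans Pp le).
Qed.

End Nu.

Definition sieveg (RT : realType) (H : seq int) (n : nat) : RT :=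
  (mobius n)%:~R ^+ 2 / f1 RT H n.

(** * Bounds for beta and the singular series *)

Section SingularSeries.
Local Open Scope classical_set_scope.
Variables (RT : realType) (H : seq int).
Hypothesis uH : uniq H.
Hypothesis aH : admissible H.
Hypothesis H0 : (0 < size H)%N.
Let k := size H.
Implicit Types (p n m : nat).
Local Notation g := (sieveg RT H).

Let nu0 p : prime p -> 0 < (nu H p)%:R :> RT.
Proof. by move=> pp; rewrite ltr0n nu_gt0 // prime_gt0. Qed.

Let nup p : prime p -> (nu H p)%:R + 1 <= p%:R :> RT.
Proof. by move=> pp; rewrite natr1 ler_nat; exact: aH. Qed.

Let nuk p : prime p -> (nu H p)%:R <= k%:R :> RT.
Proof. by move=> pp; rewrite ler_nat; exact: nu_prime_le. Qed.

Lemma f1_prime p : prime p -> f1 RT H p = (p%:R - (nu H p)%:R) / (nu H p)%:R.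
Proof. by move=> pp; rewrite /f1 primes_prime // big_seq1. Qed.

Lemma f1_primeM p m : prime p -> (0 < m)%N -> ~~ (p %| m)%N ->
  f1 RT H (p * m) = f1 RT H p * f1 RT H m.
Proof.
move=> pp m0 pm; rewrite (f1_prime p) // /f1 (perm_big _ (perm_primes_primeM p m pp m0 pm)).
by rewrite big_cons.
Qed.

Lemma f1_gt0 n : 0 < f1 RT H n.
Proof.
rewrite /f1 big_seq; apply: prodr_gt0 => p; rewrite mem_primes => /and3P[pp _ _].
rewrite divr_gt0 ?nu0 // subr_gt0; have := nup p pp; lra.
Qed.

Lemma sieveg_prime p : prime p -> g p = (nu H p)%:R / (p%:R - (nu H p)%:R).
Proof.
move=> pp; rewrite /sieveg f1_prime // invf_div -{1}[p]muln1 mobius_primeM //.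
rewrite dvdn1 (_ : p == 1%N = false); last by apply/eqP => e; rewrite e in pp.
by rewrite mobius1 mulrN1z sqrrN expr1n mul1r.
Qed.

Lemma sqmult_sieveg : sqmult RT g.
Proof.
split=> [|n|p m pp].
- by rewrite /sieveg /f1 big_nil mobius1 expr1n divr1.
- by rewrite divr_ge0 ?sqr_ge0 // ltW // f1_gt0.
case: (posnP m) => [->|m0].
  by rewrite muln0 dvdn0 /sieveg /mobius /= expr0n /= mul0r.
rewrite {1}/sieveg mobius_primeM //; case: ifPn => pm; first by rewrite expr0n /= mul0r.
rewrite sieveg_prime // f1_primeM // f1_prime // /sieveg mulrNz sqrrN invfM invf_div.
ring.
Qed.

Lemma sieveg_weight p : prime p -> g p / (1 + g p) = (nu H p)%:R / p%:R.
Proof.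
move=> pp; rewrite sieveg_prime //; have := nup p pp; have := nu0 p pp => h1 h2.
by field; rewrite !gt_eqF //; lra.
Qed.

Lemma sieveg_le p : prime p -> g p <= p%:R.
Proof.
move=> pp; rewrite sieveg_prime //; have := nup p pp; have := nu0 p pp => h1 h2.
rewrite ler_pdivrMr; last by lra.
have : 0 <= p%:R * (p%:R - (nu H p)%:R - 1) :> RT by rewrite mulr_ge0 //; lra.
lra.
Qed.

(** For [p <= 2k] the bound [p - nu_p >= 1] gives a numerator of order [k^3]; for [p > 2k] the bound
    [p - nu_p >= p / 2] gives [2 k^2]. The outer 2 is the bound of [sum_ln_sq_le]. *)
Definition cE : RT := 2 * (8 * k%:R ^+ 3 + 2 * k%:R ^+ 2).

Lemma sieveg_square_sum M :
  \sum_(p < M | prime p) g p * (g p / (1 + g p)) * ln p%:R <= cE.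
Proof.
have k1 : 1 <= k%:R :> RT by rewrite ler1n.
set K : RT := 8 * k%:R ^+ 3 + 2 * k%:R ^+ 2.
have K0 : 0 <= K by rewrite addr_ge0 // mulr_ge0 // exprn_ge0.
have step (p : nat) : prime p -> g p * (g p / (1 + g p)) * ln p%:R <=
    K * (ln p%:R / (p%:R * (p%:R - 1))).
  move=> pp; rewrite sieveg_weight // sieveg_prime //.
  have := nup p pp; have := nu0 p pp; have := nuk p pp; set v : RT := (nu H p)%:R.
  have p2 : 2 <= p%:R :> RT by rewrite ler_nat prime_gt1.
  have l0 := ln_nat_ge0 RT p; move: p2 l0; set L := ln _; set x : RT := p%:R => p2 l0 vk v0 vx.
  have xv : 0 < x - v by lra.
  have xx : 0 < x * (x - 1) by rewrite mulr_gt0; lra.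
  have -> : v / (x - v) * (v / x) * L = L * (v / x * (v / (x - v))) by ring.
  have -> : K * (L / (x * (x - 1))) = L * (K / (x * (x - 1))) by ring.
  rewrite ler_wpM2l //.
  rewrite ler_pdivlMr //.
  have -> : v / x * (v / (x - v)) * (x * (x - 1)) = v ^+ 2 * (x - 1) / (x - v).
    by field; rewrite !gt_eqF //; lra.
  rewrite ler_pdivrMr //.
  have k2 : 0 <= k%:R ^+ 2 :> RT by exact: sqr_ge0.
  have v2 : v ^+ 2 <= k%:R ^+ 2 by rewrite lerXn2r ?nnegrE // ltW.
  apply: (@le_trans _ _ (k%:R ^+ 2 * (x - 1))); first by rewrite ler_wpM2r //; lra.
  have [xk|xk] := leP x (2 * k%:R).
    apply: (@le_trans _ _ K); last first.
      by rewrite -{1}[K]mulr1 ler_wpM2l //; lra.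
    have : k%:R ^+ 2 * (x - 1) <= k%:R ^+ 2 * (2 * k%:R) by rewrite ler_wpM2l //; lra.
    rewrite /K exprS; have : 0 <= k%:R * k%:R ^+ 2 :> RT by rewrite mulr_ge0.
    by lra.
  apply: (@le_trans _ _ (2 * k%:R ^+ 2 * (x - v))).
    have : 0 <= k%:R ^+ 2 * (2 * (x - v) - (x - 1)) by rewrite mulr_ge0 //; lra.
    by lra.
  rewrite ler_wpM2r ?(ltW xv) // /K lerDr mulr_ge0 // exprn_ge0 //.
apply: (@le_trans _ _ (\sum_(p < M | prime p) K * (ln p%:R / (p%:R * (p%:R - 1))))).
  by apply: ler_sum => p pp; exact: step.
rewrite -mulr_sumr /cE -/K mulrC ler_wpM2r //.
apply: le_trans (sum_ln_sq_le RT M); rewrite big_mkcond [leRHS]big_mkcond /=.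
apply: ler_sum => p _; case: ifP => [/prime_gt1->//|_]; case: ifP => // p1.
by rewrite divr_ge0 ?ln_nat_ge0 // mulr_ge0 // subr_ge0 ler1n ltnW.
Qed.

Let bpart n : RT := \sum_(p < n | prime p) ((k%:R - (nu H p)%:R) * ln p%:R / p%:R).

Let bterm_ge0 p : prime p -> 0 <= (k%:R - (nu H p)%:R) * ln p%:R / p%:R :> RT.
Proof. by move=> pp; rewrite divr_ge0 // mulr_ge0 ?ln_nat_ge0 // subr_ge0 nuk. Qed.

Let bpart_homo : {homo bpart : n m / (n <= m)%N >-> n <= m}.
Proof.
move=> n m nm; rewrite /bpart.
rewrite (big_ord_widen_cond m prime (fun p => (k%:R - (nu H p)%:R) * ln p%:R / p%:R) nm).
rewrite big_mkcondr /=; apply: ler_sum => p pp; case: ifP => // _; exact: bterm_ge0.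
Qed.

(** The partial sums increase as [nu_p <= k] and are eventually constant, so [limn] is a genuine
    limit. *)
Lemma betaH_ge n : bpart n <= betaH RT H.
Proof.
have cb : cvgn bpart.
  have [P0 hP] := nu_prime_large H uH.
  apply: (@is_cvg_near_cst _ _ (bpart P0.+1)); exists P0.+1 => // m /= Pn.
  apply: le_anti; rewrite (bpart_homo P0.+1 m) // andbT.
  rewrite /bpart [leRHS](big_ord_widen_cond m prime (fun p => (k%:R - (nu H p)%:R) * ln p%:R / p%:R) Pn).
  rewrite [leRHS]big_mkcondr /=; apply: ler_sum => p pp; case: ifPn => //.
  by rewrite -leqNgt => Pp; rewrite hP // subrr !mul0r.
have e : betaH RT H = limn bpart by [].
rewrite e; exact: (nondecreasing_cvgn_le bpart_homo cb).
Qed.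

(** Already the prime 2 contributes this much, since [nu_2 <= 1 < k]. The bound later lets constants
    depending on [k] be absorbed into beta. *)
Lemma betaH_gt : (1 < k)%N -> ln 2 / 2 <= betaH RT H.
Proof.
move=> k1; apply: le_trans (betaH_ge 3).
rewrite /bpart big_mkcond !big_ord_recr big_ord0 /= !add0r.
have n2 : (nu H 2 <= 1)%N by rewrite -ltnS; exact: aH.
rewrite -mulrA ler_peMl // ?divr_ge0 ?ln_nat_ge0 // -natrB; last by lia.
by rewrite ler1n; lia.
Qed.

(** The weight is [nu_p / p = k / p - (k - nu_p) / p]. The subtracted part is nonnegative with total
    at most beta, which therefore enters the lower bound only. *)
Lemma prime_weight_bounds (v : RT) M : 0 < v -> expR v <= M%:R ->
  k%:R * v - (5 * k%:R + betaH RT H) <=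
  \sum_(p < M | prime p && (ln (p%:R : RT) < v)) g p / (1 + g p) * ln p%:R
  <= k%:R * v + 5 * k%:R.
Proof.
move=> v0 vM; have := mertens RT v M v0 vM; rewrite ler_norml.
set T := \sum_(p < M | _) _ => /andP[m1 m2].
set B1 := \sum_(p < M | prime p && (ln (p%:R : RT) < v))
   ((k%:R - (nu H p)%:R) * ln p%:R / p%:R : RT).
have -> : \sum_(p < M | prime p && (ln (p%:R : RT) < v)) g p / (1 + g p) * ln p%:R =
   k%:R * T - B1.
  rewrite /T /B1 mulr_sumr -sumrB; apply: eq_bigr => p /andP[pp _].
  by rewrite sieveg_weight //; ring.
have b0 : 0 <= B1 by apply: sumr_ge0 => p /andP[pp _]; exact: bterm_ge0.
have b1 : B1 <= betaH RT H.
  apply: le_trans (betaH_ge M); rewrite /B1 /bpart big_mkcondr /=.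
  by apply: ler_sum => p pp; case: ifP => // _; exact: bterm_ge0.
have k0 : 0 <= k%:R :> RT by [].
have := ler_wpM2l k0 m1; have := ler_wpM2l k0 m2; rewrite mulrBr => h2; rewrite mulrN => h1.
apply/andP; split; lra.
Qed.

Let fac p : RT := (1 - (nu H p)%:R / p%:R) * (1 - 1 / p%:R) ^- k.
Let spart n : RT := \prod_(p < n | prime p) fac p.

Let fac_gt0 p : prime p -> 0 < fac p.
Proof.
move=> pp; have p2 : 2 <= p%:R :> RT by rewrite ler_nat prime_gt1.
have := nup p pp => h.
rewrite divr_gt0 // ?exprn_gt0 // subr_gt0 ltr_pdivrMr; lra.
Qed.

Let spart_gt0 n : 0 < spart n.
Proof. by apply: prodr_gt0 => p; exact: fac_gt0. Qed.

Let spartS n : spart n.+1 = spart n * (if prime n then fac n else 1).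
Proof. by rewrite /spart big_mkcond big_ord_recr /= -big_mkcond. Qed.

Let fac_ge p : prime p -> p%:R^-1 <= fac p.
Proof.
move=> pp; have p2 : 2 <= p%:R :> RT by rewrite ler_nat prime_gt1.
have := nup p pp => h; have p0 : 0 < p%:R :> RT by lra.
apply: (@le_trans _ _ (1 - (nu H p)%:R / p%:R)).
  by rewrite lerBrDr -[X in X + _ <= _]mul1r -mulrDl ler_pdivrMr // mul1r; lra.
rewrite ler_peMr //; first by rewrite subr_ge0 ler_pdivrMr //; lra.
have i0 : 0 < p%:R^-1 :> RT by rewrite invr_gt0.
have i1 : p%:R^-1 <= 2^-1 :> RT by rewrite lef_pV2 ?posrE.
by rewrite invf_ge1 ?exprn_gt0 ?exprn_ile1 // ?div1r; lra.
Qed.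

Let fac_ge_large p : prime p -> (k < p)%N ->
  1 - k%:R ^+ 2 * (p%:R * (p%:R - 1))^-1 <= fac p.
Proof.
move=> pp kp; have p2 : 2 <= p%:R :> RT by rewrite ler_nat prime_gt1.
have p0 : 0 < p%:R :> RT by lra.
have kp' : k%:R + 1 <= p%:R :> RT by rewrite natr1 ler_nat.
have i0 : 0 < p%:R^-1 :> RT by rewrite invr_gt0.
have i1 : p%:R^-1 <= 2^-1 :> RT by rewrite lef_pV2 ?posrE.
have k0 : 0 <= k%:R :> RT by [].
apply: (@le_trans _ _ ((1 - k%:R / p%:R) * (1 + k%:R / p%:R))).
  have -> : (1 - k%:R / p%:R) * (1 + k%:R / p%:R) = 1 - k%:R ^+ 2 * p%:R ^- 2 :> RT.
    by field; rewrite gt_eqF.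
  rewrite lerD2l lerN2 ler_wpM2l ?sqr_ge0 // lef_pV2 ?posrE ?exprn_gt0 ?mulr_gt0 //; last by lra.
  by rewrite expr2 ler_wpM2l //; lra.
have a1 : 1 - k%:R / p%:R <= 1 - (nu H p)%:R / p%:R :> RT.
  by rewrite lerD2l lerN2 ler_wpM2r ?(ltW i0) // nuk.
apply: ler_pM => //.
  by rewrite subr_ge0 ler_pdivrMr //; lra.
have q0 : 0 < 1 - 1 / p%:R :> RT by rewrite div1r; lra.
rewrite -exprVn; apply: (@le_trans _ _ ((1 + p%:R^-1) ^+ k)); last first.
  have i2 : 0 <= p%:R^-1 * p%:R^-1 :> RT by rewrite mulr_ge0 // ltW.
  have le1 : 1 + p%:R^-1 <= (1 - 1 / p%:R)^-1 :> RT.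
    by rewrite -[leRHS]mul1r ler_pdivlMr // div1r; lra.
  by rewrite lerXn2r ?nnegrE ?invr_ge0 ?(ltW q0) // addr_ge0 // ltW.
elim: {k0 kp kp' a1} (k) => [|j IH]; first by rewrite mul0r addr0 expr0.
rewrite exprS -natr1; apply: le_trans (ler_wpM2l _ IH); last by lra.
have : 0 <= p%:R^-1 * (j%:R * p%:R^-1) :> RT by rewrite !mulr_ge0 // ltW.
by lra.
Qed.

(** With [T = 2 k^2]: the indices up to [T] contribute at least [T^-(T+1)], as [nu_p <= p - 1]
    bounds each factor below by [1 / p], and the later primes at least [1 - k^2 / T = 1 / 2]. *)
Definition cS : RT := (2 * k ^ 2)%:R ^- (2 * k ^ 2).+1 / 2.

Lemma cS_gt0 : 0 < cS.
Proof.
rewrite /cS divr_gt0 // invr_gt0 exprn_gt0 // ltr0n muln_gt0 expn_gt0 H0 //.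
Qed.

Let spart_ge n : cS <= spart n.
Proof.
set T := (2 * k ^ 2)%N; have T1 : (0 < T)%N by rewrite muln_gt0 expn_gt0 H0.
have T0 : 0 < T%:R :> RT by rewrite ltr0n.
have T1' : 1 <= T%:R :> RT by rewrite ler1n.
have kT : (k <= T)%N by rewrite /T; have := H0; rewrite -/k; nia.
have small m : (m <= T.+1)%N -> T%:R ^- m <= spart m.
  elim: m => [|m IH] mT; first by rewrite expr0 invr1 /spart big_ord0.
  rewrite spartS exprSr invfM; apply: ler_pM; rewrite ?invr_ge0 ?exprn_ge0 ?(ltW T0) //.
    by apply: IH; exact: ltnW.
  case: ifP => pm; last by rewrite invf_le1.
  have mT' : m%:R <= T%:R :> RT by rewrite ler_nat -ltnS.
  by apply: le_trans (fac_ge m pm); rewrite lef_pV2 ?posrE // ltr0n prime_gt0.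
have cSE : cS = T%:R ^- T.+1 * (1 - k%:R ^+ 2 * T%:R^-1).
  rewrite /cS -/T; congr (_ * _); rewrite /T natrM natrX.
  have kn : k%:R != 0 :> RT by rewrite pnatr_eq0 -lt0n.
  by field.
have TT : 0 <= T%:R ^- T.+1 :> RT by rewrite invr_ge0 exprn_ge0.
have k2 : 0 <= k%:R ^+ 2 :> RT by exact: sqr_ge0.
have [nT|nT] := leqP n T.+1.
  apply: le_trans (small n nT); rewrite /cS -/T.
  apply: (@le_trans _ _ (T%:R ^- T.+1)); first by rewrite ler_pdivrMr // ler_peMr //; lra.
  by rewrite lef_pV2 ?posrE ?exprn_gt0 // ler_weXn2l.
(* The losses [k^2 / (p (p - 1))] of [fac_ge_large] telescope over all integers beyond [T]. *)
have large m : (T <= m)%N ->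
    T%:R ^- T.+1 * (1 - k%:R ^+ 2 * (T%:R^-1 - m%:R^-1)) <= spart m.+1.
  elim: m => [|m IH]; first by rewrite leqn0 => /eqP e; rewrite e in T1.
  rewrite leq_eqVlt => /orP[/eqP <-|]; first by rewrite subrr mulr0 subr0 mulr1 small.
  rewrite ltnS => Tm; have {}IH := IH Tm; rewrite spartS.
  have m0 : 0 < m%:R :> RT by rewrite ltr0n (leq_trans T1).
  have mE : (m.+1%:R * (m.+1%:R - 1))^-1 = m%:R^-1 - m.+1%:R^-1 :> RT.
    have m1 : m%:R + 1 != 0 :> RT by rewrite natr1 pnatr_eq0.
    by rewrite -natr1 addrK; field; rewrite m1 gt_eqF.
  have d0 : 0 <= (m.+1%:R * (m.+1%:R - 1))^-1 :> RT.
    by rewrite invr_ge0 mulr_ge0 // -natr1 addrK ltW.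
  set d := (m.+1%:R * (m.+1%:R - 1))^-1 in mE d0.
  have y0 : 0 <= T%:R^-1 - m%:R^-1 :> RT by rewrite subr_ge0 lef_pV2 ?posrE // ler_nat.
  have h : 1 - k%:R ^+ 2 * d <= (if prime m.+1 then fac m.+1 else 1).
    case: ifP => pm; last by rewrite gerBl mulr_ge0.
    by apply: fac_ge_large => //; rewrite ltnS (leq_trans kT).
  have -> : T%:R^-1 - m.+1%:R^-1 = (T%:R^-1 - m%:R^-1) + d :> RT by rewrite mE; ring.
  set y := T%:R^-1 - m%:R^-1 in y0 IH *.
  have yd : 0 <= k%:R ^+ 2 * d * (k%:R ^+ 2 * y) by rewrite !mulr_ge0.
  have d1 : 0 <= 1 - k%:R ^+ 2 * d.
    have mT : m%:R^-1 <= T%:R^-1 :> RT by rewrite lef_pV2 ?posrE // ler_nat.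
    have mi : 0 <= m.+1%:R^-1 :> RT by rewrite invr_ge0.
    have : k%:R ^+ 2 * d <= k%:R ^+ 2 * T%:R^-1 by rewrite ler_wpM2l // mE lerBlDr (le_trans mT) // lerDl.
    have -> : k%:R ^+ 2 * T%:R^-1 = 2^-1 :> RT.
      rewrite /T natrM natrX; have kn : k%:R != 0 :> RT by rewrite pnatr_eq0 -lt0n.
      by field.
    by lra.
  apply: (@le_trans _ _ (spart m.+1 * (1 - k%:R ^+ 2 * d))); last first.
    by rewrite ler_wpM2l // ltW.
  apply: le_trans (ler_wpM2r d1 IH); rewrite -[leRHS]mulrA ler_wpM2l //.
  have -> : (1 - k%:R ^+ 2 * y) * (1 - k%:R ^+ 2 * d) =
     1 - k%:R ^+ 2 * (y + d) + k%:R ^+ 2 * d * (k%:R ^+ 2 * y) by ring.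
  by rewrite lerDl.
rewrite -(ltn_predK nT); apply: le_trans (large n.-1 _); last by rewrite -ltnS (ltn_predK nT); exact: ltnW.
rewrite cSE ler_wpM2l // lerD2l lerN2 ler_wpM2l // gerBl invr_ge0 //.
Qed.

(** Once [nu_p = k], Bernoulli's inequality [1 - k / p <= (1 - 1 / p)^k] makes every factor at most
    1, so the partial products decrease from some index on. *)
Let spart_cvg : cvgn spart.
Proof.
have [P0 hP] := nu_prime_large H uH; set P := (P0 + k).+1.
have facle p : prime p -> (P <= p)%N -> fac p <= 1.
  move=> pp Pp; have p2 : 2 <= p%:R :> RT by rewrite ler_nat prime_gt1.
  have i0 : 0 < p%:R^-1 :> RT by rewrite invr_gt0; lra.
  have i1 : p%:R^-1 <= 2^-1 :> RT by rewrite lef_pV2 ?posrE //; lra.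
  rewrite /fac hP //; last by apply: leq_trans Pp; rewrite /P ltnS leq_addr.
  rewrite ler_pdivrMr ?mul1r ?exprn_gt0 // ?div1r; last by lra.
  rewrite -/k; elim: (k) => [|j IH]; first by rewrite mul0r subr0 expr0.
  rewrite exprS -natr1; apply: le_trans (ler_wpM2l _ IH); last by lra.
  have : 0 <= p%:R^-1 * (j%:R * p%:R^-1) :> RT by rewrite !mulr_ge0 // ltW.
  by lra.
have hm : {homo (fun n => spart (n + P)%N) : n m / (n <= m)%N >-> m <= n}.
  apply/nonincreasing_seqP => n; rewrite addSn spartS; case: ifP => pn; last by rewrite mulr1.
  rewrite ger_pMr //; apply: facle => //; exact: leq_addl.
have : cvgn (fun n => spart (n + P)%N).
  apply: nonincreasing_is_cvgn => //; exists cS => _ [n _ <-]; exact: spart_ge.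
move=> c1; apply/cvg_ex; exists (limn (fun n => spart (n + P)%N)).
by rewrite -(cvg_shiftn P).
Qed.

Lemma singser_ge : cS <= singser RT H.
Proof.
have e : singser RT H = limn spart by [].
rewrite e; apply: limr_ge; first exact: spart_cvg.
by near=> n; exact: spart_ge.
Unshelve. all: by end_near. Qed.

Lemma singser_gt0 : 0 < singser RT H.
Proof. exact: lt_le_trans cS_gt0 singser_ge. Qed.

Lemma cvg_sieveg_const :
  logsum RT g predT 0 u / u ^+ k @[u --> +oo] --> (singser RT H)^-1 / k`!%:R.
Proof.
have [P0 hP] := nu_prime_large H uH.
apply: (cvg_logsum RT g k sqmult_sieveg _ P0) => [p pp Pp|].
  by rewrite sieveg_prime // hP.
have cs : spart @ \oo --> singser RT H by exact: spart_cvg.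
have -> : (fun z => \prod_(p < z | prime p) ((1 + g p) * (1 - p%:R^-1) ^+ k)) =
   (fun z => (spart z)^-1).
  apply/funext => z; rewrite /spart -prodfV; apply: eq_bigr => p pp.
  rewrite /fac invfM invrK div1r sieveg_prime //; congr (_ * _).
  have := nup p pp; have := nu0 p pp => h1 h2.
  by field; rewrite !gt_eqF //; lra.
by apply: cvgV => //; rewrite gt_eqF // singser_gt0.
Qed.

End SingularSeries.

Lemma sqmult_le_nat (RT : realType) (a : nat -> RT) : sqmult RT a ->
  (forall p, prime p -> a p <= p%:R) -> forall n, a n <= n%:R.
Proof.
move=> sq ap; elim/ltn_ind => -[|[|n]] IH.
- by rewrite (sqmult0 _ _ sq).
- by case: sq => ->.
have pp : prime (pdiv n.+2) by rewrite pdiv_prime.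
set p := pdiv n.+2 in pp; have pd : (p %| n.+2)%N by exact: pdiv_dvd.
have ed : n.+2 = (p * (n.+2 %/ p))%N by rewrite mulnC divnK.
have lt : (n.+2 %/ p < n.+2)%N by rewrite ltn_Pdiv // prime_gt1.
have := IH _ lt; move: (n.+2 %/ p)%N ed => m -> IHm.
case: (sq) => _ a0 -> //; case: ifP => // _.
by rewrite natrM ler_pM // ap.
Qed.

Lemma logsum_le_pow (RT : realType) (a : nat -> RT) l (u : RT) : sqmult RT a -> 0 <= u ->
  logsum RT a predT l u <= u ^+ l * logsum RT a predT 0 u.
Proof.
move=> sq u0; rewrite /logsum mulr_sumr; apply: ler_sum => n /and3P[n0 nu _].
rewrite expr0 mulr1 mulrC ler_wpM2r ?(sqmult_ge0 _ _ sq) //.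
by rewrite lerXn2r ?nnegrE ?subr_ge0 ?(ltW nu) // gerBl ln_nat_ge0.
Qed.

(** * Estimates uniform in the tuple *)

Section Uniform.
Local Open Scope classical_set_scope.
Variables (RT : realType) (k : nat).
Hypothesis k1 : (1 < k)%N.

(** [5 k] is the Mertens error with weight [k]; the rest is [cE] with [size H] replaced by [k]. *)
Definition cA : RT := 5 * k%:R + 2 * (8 * k%:R ^+ 3 + 2 * k%:R ^+ 2).

Lemma cA_ge0 : 0 <= cA.
Proof. by rewrite addr_ge0 ?mulr_ge0 ?addr_ge0 ?mulr_ge0 ?exprn_ge0. Qed.

Lemma sieveg_relations (H : seq int) : uniq H -> size H = k -> admissible H ->
  logsum_relation RT (sieveg RT H) k 1 cA /\
  logsum_relation RT (sieveg RT H) k 1 (cA + betaH RT H) /\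
  logsum_relation RT (sieveg RT H) k (-1) (cA + betaH RT H).
Proof.
move=> uH eH aH; have H0 : (0 < size H)%N by rewrite eH ltnW.
have sq := sqmult_sieveg RT H aH H0.
have b0 : 0 <= betaH RT H.
  have k1' : (1 < size H)%N by rewrite eH.
  by apply: le_trans (betaH_gt RT H uH aH H0 k1'); rewrite divr_ge0 ?ln_nat_ge0.
have L u : 0 < u -> _ := fun u0 : 0 < u => log_relation RT _ sq k%:R (5 * k%:R) (5 * k%:R + betaH RT H) (cE RT H) u
   (Num.truncn (expR u)).+1 u0 (ltW (truncnS_gt _)) _ (sieveg_square_sum RT H aH H0 _).
have {}L u : 0 < u -> k%:R * logsum RT (sieveg RT H) predT 1 u -
    (5 * k%:R + betaH RT H) * logsum RT (sieveg RT H) predT 0 u <=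
   u * logsum RT (sieveg RT H) predT 0 u - logsum RT (sieveg RT H) predT 1 u <=
   k%:R * logsum RT (sieveg RT H) predT 1 u + cA * logsum RT (sieveg RT H) predT 0 u.
  move=> u0; have -> : cA = 5 * k%:R + cE RT H by rewrite /cA /cE eH.
  apply: L => // {u0}u v v0 vu.
  have vM : expR v <= (Num.truncn (expR u)).+1%:R.
    by apply: le_trans (ltW (truncnS_gt _)); rewrite ler_expR.
  by have := prime_weight_bounds RT H uH aH H0 v _ v0 vM; rewrite eH.
have m0 u : 0 <= logsum RT (sieveg RT H) predT 0 u by exact: logsum_ge0.
have c0 := cA_ge0.
have c5 : 5 * k%:R <= cA :> RT.
  by rewrite lerDl mulr_ge0 // addr_ge0 // mulr_ge0 // exprn_ge0.
split; [|split] => u u0; have /andP[h1 h2] := L u u0; rewrite -natr1.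
- lra.
- have := mulr_ge0 b0 (m0 u); lra.
- have := ler_wpM2r (m0 u) c5; lra.
Qed.

(** [logsum_growth] reduces to the single point [cA + 1], which depends on [k] only; there the crude
    bound [g n <= n] on boundedly many terms is uniform in [H]. *)
Lemma logsum_sieveg_growth : exists2 K : RT, 0 < K &
  forall (H : seq int) u, uniq H -> size H = k -> admissible H -> cA + 1 <= u ->
  logsum RT (sieveg RT H) predT 0 u <= K * u ^+ k.
Proof.
set M := (Num.truncn (expR (cA + 1))).+1.
have A1 : 0 < cA + 1 by rewrite ltr_wpDl // cA_ge0.
pose K0 : RT := \sum_(n < M) n%:R * (cA + 1).
exists (k.+1%:R * K0 + 1).
  by rewrite ltr_wpDl // mulr_ge0 // sumr_ge0 // => n _; rewrite mulr_ge0 // ltW.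
move=> H u uH eH aH Au; have H0 : (0 < size H)%N by rewrite eH ltnW.
have sq := sqmult_sieveg RT H aH H0.
have [r _] := sieveg_relations H uH eH aH.
have u0 : 0 <= u ^+ k by rewrite exprn_ge0 // (le_trans _ Au) // ltW.
apply: le_trans (logsum_growth RT _ k sq cA u cA_ge0 r Au) _.
rewrite ler_wpM2r // (@le_trans _ _ (k.+1%:R * K0)) //; last by rewrite lerDl.
rewrite ler_wpM2l // /K0 (logsumE _ _ _ _ _ M) ?(ltW (truncnS_gt _)) //.
rewrite big_mkcond; apply: ler_sum => n _; case: ifP => [/and3P[n0 nu _]|_]; last first.
  by rewrite mulr_ge0 // ltW.
rewrite expr1 ler_pM ?(sqmult_ge0 _ _ sq) ?subr_ge0 ?(ltW nu) //.
  by apply: sqmult_le_nat => // p pp; exact: sieveg_le.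
by rewrite gerBl ln_nat_ge0.
Qed.

Lemma logsum_sieveg_asymp l : exists2 C : RT, 0 < C &
  forall (H : seq int) u, uniq H -> size H = k -> admissible H -> cA + 1 <= u ->
  `|singser RT H * logsum RT (sieveg RT H) predT l u
     - l`!%:R / (k + l)`!%:R * u ^+ (k + l)| <=
  C * (l`!%:R / (k + l)`!%:R * u ^+ (k + l)) * (betaH RT H * singser RT H / u).
Proof.
have [K K0 hK] := logsum_sieveg_growth.
have [K1 K10 hK1] := pow_quot_bound RT (k + l.+1).
set D : RT := l`!%:R / (k + l)`!%:R.
have D0 : 0 < D by rewrite divr_gt0 // ltr0n fact_gt0.
have l2 : 0 < ln 2 / 2 :> RT by rewrite divr_gt0 // ln_gt0 // ltr1n.
(* Chosen so that [B = cA + beta <= C1 * beta], by [beta >= ln 2 / 2]. *)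
pose C1 : RT := cA / (ln 2 / 2) + 1.
have C10 : 0 < C1 by rewrite ltr_wpDl // divr_ge0 ?cA_ge0 // ltW.
pose s0 : RT := (2 * k ^ 2)%:R ^- (2 * k ^ 2).+1 / 2.
have s00 : 0 < s0.
  by rewrite divr_gt0 // invr_gt0 exprn_gt0 // ltr0n muln_gt0 expn_gt0 (ltnW k1).
have KDs := addr_gt0 (divr_gt0 K0 D0) (etrans (invr_gt0 s0) s00).
have Kp := mulr_gt0 KDs (mulr_gt0 (ltr0Sn RT 1) C10).
have Kq := divr_gt0 (mulr_gt0 K10 C10) s00.
exists (K1 * C1 / s0 + (K / D + s0^-1) * (2 * C1)); first exact: addr_gt0.
move=> H u uH eH aH Au; have H0 : (0 < size H)%N by rewrite eH ltnW.
have sq := sqmult_sieveg RT H aH H0.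
have u0 : 0 < u by apply: lt_le_trans Au; rewrite ltr_wpDl // cA_ge0.
have [_ [r1 r2]] := sieveg_relations H uH eH aH.
have k1' : (1 < size H)%N by rewrite eH.
have bl := betaH_gt RT H uH aH H0 k1'.
have b0 : 0 < betaH RT H by exact: lt_le_trans bl.
have Ss : s0 <= singser RT H.
  by have := singser_ge RT H uH aH H0; rewrite /cS eH.
have S0 : 0 < singser RT H by exact: lt_le_trans Ss.
set S := singser RT H in Ss S0 *; set be := betaH RT H in b0 bl r1 r2 *.
set B := cA + be in r1 r2 *.
have B0 : 0 <= B by rewrite addr_ge0 ?cA_ge0 // ltW.
have BC : B <= C1 * be.
  rewrite /B /C1 mulrDl mul1r lerD2r -[leLHS]mulr1 -mulrA ler_wpM2l ?cA_ge0 //.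
  by rewrite mulrC ler_pdivlMr // mul1r.
(* This factor introduces [S] into the error term where the estimate itself does not produce it. *)
have S1 : 1 <= S / s0 by rewrite ler_pdivlMr // mul1r.
set m := logsum RT (sieveg RT H) predT l u.
have m0 : 0 <= m by exact: logsum_ge0.
have un : 0 < u ^+ (k + l) by rewrite exprn_gt0.
set X := D * u ^+ (k + l); have X0 : 0 < X by rewrite mulr_gt0.
set e := be * S / u; have e0 : 0 < e by rewrite divr_gt0 // mulr_gt0.
have [Bu|Bu] := leP (2 * B) u.
  have Bu' : B < u by lra.
  have cv := cvg_sieveg_const RT H uH aH H0; rewrite eH in cv.
  have /andP[] := logsum_bounds RT _ k sq B _ B0 r1 r2 cv l u Bu'.
  rewrite -/S -/m /mconst.
  have -> : S^-1 / k`!%:R * (k`! * l`!)%:R / (k + l)`!%:R = S^-1 * D.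
    have kf : k`!%:R != 0 :> RT by rewrite pnatr_eq0 -lt0n fact_gt0.
    have klf : (k + l)`!%:R != 0 :> RT by rewrite pnatr_eq0 -lt0n fact_gt0.
    by rewrite /D natrM; field; rewrite kf klf gt_eqF.
  set t := B / u; have t0 : 0 <= t by rewrite divr_ge0 // ltW.
  have t1 : t <= 2^-1 by rewrite /t ler_pdivrMr //; lra.
  have [|q1 q2] := hK1 t; first by rewrite t0.
  have E1 : (u - B) ^+ (k + l.+1) / (u + B) = u ^+ (k + l) * ((1 - t) ^+ (k + l.+1) / (1 + t)).
    have -> : u - B = u * (1 - t) by rewrite /t; field; rewrite gt_eqF.
    have -> : u + B = u * (1 + t) by rewrite /t; field; rewrite gt_eqF.
    rewrite exprMn addnS exprS invfM; move: (_ ^+ (k + l).+1) (u ^+ (k + l)) => y z.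
    by field; rewrite !gt_eqF //; lra.
  have E2 : (u + B) ^+ (k + l.+1) / (u - B) = u ^+ (k + l) * ((1 + t) ^+ (k + l.+1) / (1 - t)).
    have -> : u - B = u * (1 - t) by rewrite /t; field; rewrite gt_eqF.
    have -> : u + B = u * (1 + t) by rewrite /t; field; rewrite gt_eqF.
    rewrite exprMn addnS exprS invfM; move: (_ ^+ (k + l).+1) (u ^+ (k + l)) => y z.
    by field; rewrite !gt_eqF //; lra.
  have gen (D' Y Z : RT) : S * (S^-1 * D' * Y / Z) = D' * (Y / Z).
    by rewrite !mulrA mulfV ?gt_eqF // mul1r.
  move=> b1 b2.
  have {}b1 : X * (1 - K1 * t) <= S * m.
    apply: le_trans (ler_wpM2l (ltW S0) b1).
    rewrite gen E1 /X -(mulrA D).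
    by apply: (ler_wpM2l (ltW D0)); apply: (ler_wpM2l (ltW un)).
  have {}b2 : S * m <= X * (1 + K1 * t).
    apply: le_trans (ler_wpM2l (ltW S0) b2) _.
    rewrite gen E2 /X -(mulrA D).
    by apply: (ler_wpM2l (ltW D0)); apply: (ler_wpM2l (ltW un)).
  apply: (@le_trans _ _ (X * (K1 * t))).
    by rewrite ler_norml; apply/andP; split; lra.
  rewrite [leRHS]mulrAC [leRHS]mulrC ler_wpM2l ?(ltW X0) //.
  apply: (@le_trans _ _ (K1 * C1 / s0 * e)); last first.
    by apply: (ler_wpM2r (ltW e0)); rewrite lerDl (ltW Kp).
  have -> : K1 * C1 / s0 * e = K1 * (C1 * be / u * (S / s0)) by rewrite /e; ring.
  rewrite ler_wpM2l ?(ltW K10) // -[t]mulr1 ler_pM // /t.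
  by rewrite ler_wpM2r // invr_ge0 ltW.
(* Remaining range [u < 2 B]: there [1 <= 2 C1 beta / u], so bounding both terms of the difference
   by a multiple of [S * X] is enough. *)
have hm : S * m <= S * (K / D) * X.
  have -> : S * (K / D) * X = S * (u ^+ l * (K * u ^+ k)).
    by rewrite /X exprD; field; rewrite gt_eqF.
  rewrite ler_wpM2l ?(ltW S0) //; apply: le_trans (logsum_le_pow _ _ _ _ sq (ltW u0)) _.
  by rewrite ler_wpM2l ?exprn_ge0 ?(ltW u0) // hK.
apply: (@le_trans _ _ (S * (K / D + s0^-1) * X)).
  rewrite ler_norml; have Sm : 0 <= S * m by rewrite mulr_ge0 // ltW.
  have x1 : X <= S / s0 * X by rewrite -{1}[X]mul1r ler_wpM2r // ltW.
  have kd := mulr_gt0 (mulr_gt0 S0 (divr_gt0 K0 D0)) X0.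
  by apply/andP; split; rewrite mulrDr mulrDl; lra.
have b1 : 1 <= 2 * C1 * be / u by rewrite ler_pdivlMr // mul1r; lra.
apply: (@le_trans _ _ ((K / D + s0^-1) * (2 * C1) * X * e)); last first.
  apply: (ler_wpM2r (ltW e0)); apply: (ler_wpM2r (ltW X0)).
  by rewrite lerDr (ltW Kq).
have -> : (K / D + s0^-1) * (2 * C1) * X * e = S * (K / D + s0^-1) * X * (2 * C1 * be / u).
  by rewrite /e; ring.
by rewrite ler_peMr // (ltW (mulr_gt0 (mulr_gt0 S0 KDs) X0)).
Qed.

End Uniform.

(** * The sieve sum *)

Section Counting.
Variables (RT : realType) (H : seq int).
Implicit Types (d K q n : nat).

Lemma sum_dvd_period d q :
  (\sum_(0 <= n < q * d) (d%:Z %| Ppoly H n%:Z)%Z)%N = (q * nu H d)%N.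
Proof.
elim: q => [|q IH]; first by rewrite !mul0n big_geq.
rewrite (@big_cat_nat _ _ _ (q * d)) //=; last by rewrite leq_mul2r leqnSn orbT.
rewrite IH mulSn addnC mulSn; congr (_ + _)%N.
rewrite -{1}[(q * d)%N]add0n big_addn addnK nuE -(big_mkord predT (fun n => (d%:Z %| Ppoly H n%:Z)%Z : nat)).
apply: eq_bigr => n _; congr nat_of_bool; apply: Ppoly_mod.
by rewrite PoszD addrC addKr PoszM dvdz_mull.
Qed.

Lemma sum_dvd_bounds d K : (0 < d)%N ->
  `|(\sum_(0 <= n < K) (d%:Z %| Ppoly H n%:Z)%Z)%N%:R - K%:R * (nu H d)%:R / d%:R| <=
  (nu H d)%:R :> RT.
Proof.
move=> d0; set c := (\sum_(0 <= n < K) _)%N.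
have d0' : 0 < d%:R :> RT by rewrite ltr0n.
have qK : (K %/ d * d <= K)%N by exact: leq_trunc_div.
have Kq : (K <= (K %/ d).+1 * d)%N by rewrite ltnW // ltn_ceil.
have c1 : (K %/ d * nu H d <= c)%N.
  by rewrite -sum_dvd_period /c (@big_cat_nat _ _ _ (K %/ d * d) 0 K) //= leq_addr.
have c2 : (c <= (K %/ d).+1 * nu H d)%N.
  by rewrite -sum_dvd_period /c (@big_cat_nat _ _ _ K 0 ((K %/ d).+1 * d)) //= leq_addr.
have {}c1 : (K %/ d)%:R * (nu H d)%:R <= c%:R :> RT by rewrite -natrM ler_nat.
have {}c2 : c%:R <= ((K %/ d)%:R + 1) * (nu H d)%:R :> RT by rewrite natr1 -natrM ler_nat.
have r1 : (K %/ d)%:R <= K%:R / d%:R :> RT by rewrite ler_pdivlMr // -natrM ler_nat.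
have r2 : K%:R / d%:R <= (K %/ d)%:R + 1 :> RT.
  by rewrite ler_pdivrMr // natr1 -natrM ler_nat.
have v0 : 0 <= (nu H d)%:R :> RT by [].
have {}r1 := ler_wpM2r v0 r1; have {}r2 := ler_wpM2r v0 r2.
have -> : K%:R * (nu H d)%:R / d%:R = K%:R / d%:R * (nu H d)%:R :> RT by ring.
by rewrite ler_norml; apply/andP; split; lra.
Qed.

(** Two initial segments contribute an error [nu] each; the number of integers in the interval
    differs from [N] by at most 1, which costs the third. *)
Lemma count_dvd_interval d (N : RT) : (0 < d)%N -> 0 <= N ->
  `|\sum_(n < (Num.truncn (2 * N)).+1 | N < n%:R) (d%:Z %| Ppoly H n%:Z)%Z%:R
    - N * ((nu H d)%:R / d%:R)| <= 3 * (nu H d)%:R :> RT.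
Proof.
move=> d0 N0; have N20 : 0 <= 2 * N by rewrite mulr_ge0.
have /andP[t1 t2] := truncn_itv N0; have /andP[s1 s2] := truncn_itv N20.
set K1 := Num.truncn N in t1 t2; set K2 := Num.truncn (2 * N) in s1 s2 *.
have K12 : (K1.+1 <= K2.+1)%N.
  by rewrite ltnS /K2 truncn_ge_nat // (le_trans t1) //; lra.
have -> : \sum_(n < K2.+1 | N < n%:R) (d%:Z %| Ppoly H n%:Z)%Z%:R =
  (\sum_(0 <= n < K2.+1) (d%:Z %| Ppoly H n%:Z)%Z)%N%:R -
  (\sum_(0 <= n < K1.+1) (d%:Z %| Ppoly H n%:Z)%Z)%N%:R :> RT.
  rewrite (@big_cat_nat _ _ _ K1.+1 0 K2.+1) //= natrD addrC addKr natr_sum.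
  rewrite -(big_mkord (fun n => N < n%:R) (fun n => (d%:Z %| Ppoly H n%:Z)%Z%:R : RT)).
  rewrite (@big_cat_nat _ _ _ K1.+1 0 K2.+1) //= big1_seq ?add0r.
    rewrite big_seq_cond [RHS]big_seq; apply: eq_bigl => n.
    rewrite mem_index_iota andbC; case: (boolP (K1 < n)%N) => //= h.
      by rewrite andbC; case: (n < _)%N => //=; rewrite -truncn_lt_nat.
    by rewrite andbF.
  move=> n /andP[Nn]; rewrite mem_index_iota /= ltnS leqNgt.
  by rewrite /K1 truncn_lt_nat // Nn.
have := sum_dvd_bounds d K1.+1 d0; have := sum_dvd_bounds d K2.+1 d0.
set a := (\sum_(0 <= n < K2.+1) _)%N; set b := (\sum_(0 <= n < K1.+1) _)%N.
have d0' : 1 <= d%:R :> RT by rewrite ler1n.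
have w1 : (nu H d)%:R / d%:R <= (nu H d)%:R :> RT.
  by rewrite ler_pdivrMr ?(lt_le_trans ltr01) // ler_peMr.
have w0 : 0 <= (nu H d)%:R / d%:R :> RT by rewrite divr_ge0.
rewrite -!mulrA; set w := (nu H d)%:R / d%:R in w0 w1 *; set v : RT := (nu H d)%:R in w1 *.
rewrite -!natr1 in t2 s2 *; rewrite !ler_norml => /andP[a1 a2] /andP[b1 b2].
have e1 : (K2%:R - K1%:R - N) * w <= 1 * w by rewrite ler_wpM2r //; lra.
have e2 : (-1) * w <= (K2%:R - K1%:R - N) * w by rewrite ler_wpM2r //; lra.
by apply/andP; split; lra.
Qed.
End Counting.

(** * Diagonalisation of the quadratic form *)

Lemma sqmult_mul (RT : realType) (a : nat -> RT) (d e : nat) : sqmult RT a ->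
  a (d * e)%N = if coprime d e then a d * a e else 0.
Proof.
move=> sq; elim/ltn_ind: d e => d IH e; case: d IH => [|[|d]] IH.
- by rewrite mul0n (sqmult0 _ _ sq) mul0r; case: ifP.
- by rewrite mul1n coprime1n; case: sq => -> _ _; rewrite mul1r.
have pp : prime (pdiv d.+2) by rewrite pdiv_prime.
set p := pdiv d.+2 in pp; have pd : (p %| d.+2)%N by exact: pdiv_dvd.
have ed : d.+2 = (p * (d.+2 %/ p))%N by rewrite mulnC divnK.
have lt : (d.+2 %/ p < d.+2)%N by rewrite ltn_Pdiv // prime_gt1.
have := IH _ lt e; move: (d.+2 %/ p)%N ed => m -> {IH lt pd} IH.
case: (sq) => _ _ sqM.
rewrite -mulnA (sqM p (m * e)%N) // (sqM p m) // Euclid_dvdM // IH coprimeMl (@prime_coprime p e) //.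
by case: (p %| m)%N; case: (p %| e)%N; case: (coprime m e) => //=; rewrite ?mul0r ?mulr0 ?mulrA.
Qed.

Lemma mobius_sqr (d : nat) : mobius d != 0 -> mobius d ^+ 2 = 1.
Proof.
rewrite /mobius; case: ifP => // _; case: ifP => // _ _.
by rewrite -exprM mulnC exprM sqrrN !expr1n.
Qed.

Lemma sum_divisors_primeM (V : zmodType) (F : nat -> V) (p m M : nat) :
  prime p -> ~~ (p %| m)%N -> (0 < m)%N -> (p * m < M)%N ->
  \sum_(d < M | (d %| p * m)%N) F d = \sum_(d < M | (d %| m)%N) (F d + F (p * d)%N).
Proof.
move=> pp pm m0 mM; have p0 := prime_gt0 pp.
rewrite (bigID (fun d : 'I_M => (p %| d)%N)) /= big_split /= addrC; congr (_ + _).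
  apply: eq_bigl => d; apply/andP/idP => [[dpm pd]|dm].
    by move: dpm; rewrite Gauss_dvdr // coprime_sym prime_coprime.
  split; first exact: dvdn_mull.
  by apply: contra pm => /dvdn_trans; apply.
under eq_bigl do rewrite andbC.
rewrite (sum_multiples _ p M (fun d => (d %| p * m)%N) F) //.
  by apply: eq_bigl => d; rewrite dvdn_pmul2l.
by move=> n /dvdn_leq le; apply: leq_ltn_trans mM; apply: le; rewrite muln_gt0 p0.
Qed.

Lemma sum_mobius_divisors (r m M : nat) : (0 < m < M)%N -> mobius (r * m) != 0 ->
  \sum_(d < M | (d %| m)%N) mobius (r * d) = if m == 1%N then mobius r else 0.
Proof.
case/andP=> m0 mM rm.
have [->|m1] := eqVneq m 1%N.
  have M1 : (1 < M)%N by apply: leq_ltn_trans mM.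
  rewrite (big_pred1 (Ordinal M1)) /= ?muln1 // => d.
  by rewrite /= dvdn1 -val_eqE.
have m2 : (1 < m)%N by rewrite ltn_neqAle eq_sym m1.
have pp := pdiv_prime m2; have := pdiv_dvd m; set p := pdiv m in pp * => /dvdnP[n mn].
rewrite mn (mulnC n p) in rm mM m0 *; have n0 : (0 < n)%N by move: m0; rewrite muln_gt0 => /andP[].
have rpn : ~~ (p %| r * n)%N.
  by apply: contra rm; rewrite mulnCA mobius_primeM // => ->.
have pn : ~~ (p %| n)%N by apply: contra rpn; exact: dvdn_mull.
have pr : ~~ (p %| r)%N by apply: contra rpn; exact: dvdn_mulr.
rewrite (sum_divisors_primeM _ (fun d => mobius (r * d)) p n M) // big1 // => d dn.
have pd : ~~ (p %| d)%N by apply: contra pn => /dvdn_trans; apply.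
rewrite mulnCA (mobius_primeM p (r * d)) // Euclid_dvdM // (negPf pd) (negPf pr) /= addrN //.
Qed.

Section Diagonalisation.
Variables (RT : realType) (H : seq int).
Hypothesis aH : admissible H.
Hypothesis H0 : (0 < size H)%N.
Local Notation g := (sieveg RT H).
Implicit Types (d n r p m : nat).

Let sq : sqmult RT g := sqmult_sieveg RT H aH H0.

Definition dens d : RT := (nu H d)%:R / d%:R.

Lemma dens_gt0 d : (0 < d)%N -> 0 < dens d.
Proof. by move=> d0; rewrite divr_gt0 // ltr0n ?nu_gt0. Qed.

Lemma dens_mul m n : (0 < m)%N -> (0 < n)%N -> coprime m n ->
  dens (m * n) = dens m * dens n.
Proof. by move=> m0 n0 c; rewrite /dens nu_mul // !natrM invfM; ring. Qed.

Lemma dens1 : dens 1 = 1.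
Proof. by rewrite /dens /nu /= dvd1z divr1. Qed.

Lemma ff_dens d : ff RT H d = (dens d)^-1. Proof. by rewrite /ff /dens invf_div. Qed.

Lemma mobius_gt0 d : mobius d != 0 -> (0 < d)%N.
Proof. by case: d. Qed.

(** The convolution identity [f = f_1 * 1] on squarefree numbers, since [1 + f_1(p) = p / nu_p]. *)
Lemma sum_f1_divisors d M : mobius d != 0 -> (d < M)%N ->
  \sum_(r < M | (r %| d)%N) f1 RT H r = (dens d)^-1.
Proof.
move=> sd; move: d sd M; apply: mobius_neq0_ind => [M M1|p m pp m0 pm sm IH M pmM].
  rewrite (big_pred1 (Ordinal M1)) /=; last by move=> r; rewrite /= dvdn1 -val_eqE.
  by rewrite dens1 /f1 big_nil invr1.
rewrite sum_divisors_primeM //.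
have cpm : coprime p m by rewrite prime_coprime.
have E d : (d %| m)%N -> f1 RT H d + f1 RT H (p * d) = (1 + f1 RT H p) * f1 RT H d.
  move=> dm; have d0 : (0 < d)%N by exact: dvdn_gt0 dm.
  rewrite f1_primeM //; first by ring.
  by apply: contra pm => /dvdn_trans; apply.
rewrite (eq_bigr (fun d : 'I_M => (1 + f1 RT H p) * f1 RT H d)); last by move=> d; exact: E.
rewrite -mulr_sumr IH; last by apply: leq_ltn_trans pmM; rewrite leq_pmull // prime_gt0.
rewrite (dens_mul p m (prime_gt0 pp) m0 cpm) [RHS]invfM.
have v0 : (nu H p)%:R != 0 :> RT by rewrite pnatr_eq0 -lt0n nu_gt0 // prime_gt0.
have -> : 1 + f1 RT H p = (dens p)^-1 by rewrite f1_prime // /dens invf_div; field.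
by [].
Qed.

(** The density at the lcm is the product of the densities divided by that at the gcd; expanding the
    latter over common divisors [r] separates [d1] from [d2]. *)
Lemma dens_lcm d1 d2 M : mobius d1 != 0 -> mobius d2 != 0 -> (d1 < M)%N ->
  dens (lcmn d1 d2) = dens d1 * dens d2 *
    \sum_(r < M | (r %| d1)%N && (r %| d2)%N) f1 RT H r.
Proof.
move=> s1 s2 d1M; have d10 := mobius_gt0 d1 s1; have d20 := mobius_gt0 d2 s2.
set c := gcdn d1 d2; have c0 : (0 < c)%N by rewrite gcdn_gt0 d10.
have /dvdnP[a ea] : (c %| d1)%N by exact: dvdn_gcdl.
have /dvdnP[b eb] : (c %| d2)%N by exact: dvdn_gcdr.
have a0 : (0 < a)%N by move: d10; rewrite ea muln_gt0 => /andP[].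
have b0 : (0 < b)%N by move: d20; rewrite eb muln_gt0 => /andP[].
have elcm : lcmn d1 d2 = (a * (b * c))%N.
  apply/eqP; rewrite -(eqn_pmul2r c0) -/c muln_lcm_gcd.
  by rewrite ea eb; apply/eqP; ring.
have cab : coprime a b.
  have : gcdn (a * c) (b * c) = c by rewrite -ea -eb.
  by rewrite -muln_gcdl => /eqP; rewrite -{2}[c]mul1n eqn_pmul2r.
have ca : coprime a c.
  by move: s1; rewrite ea mobius_mul; case: ifP.
have cb : coprime b c.
  by move: s2; rewrite eb mobius_mul; case: ifP.
have sc : mobius c != 0.
  by move: s1; rewrite ea mobius_mul ca; apply: contraNneq => ->; rewrite mulr0.
have -> : \sum_(r < M | (r %| d1)%N && (r %| d2)%N) f1 RT H r = (dens c)^-1.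
  rewrite -(sum_f1_divisors c M) //; first by apply: eq_bigl => r; rewrite dvdn_gcd.
  by apply: leq_ltn_trans d1M; apply: dvdn_leq => //; exact: dvdn_gcdl.
rewrite elcm dens_mul ?muln_gt0 ?b0 // ?coprimeMr ?cab // dens_mul // ea eb !dens_mul //.
have := dens_gt0 c c0; move: (dens c) (dens a) (dens b) => x y z x0.
by field; rewrite gt_eqF.
Qed.

Lemma nu_lcm_le d1 d2 : mobius d1 != 0 -> mobius d2 != 0 ->
  (nu H (lcmn d1 d2) <= nu H d1 * nu H d2)%N.
Proof.
move=> s1 s2; have d10 := mobius_gt0 d1 s1; have d20 := mobius_gt0 d2 s2.
have /dvdnP[b eb] : (gcdn d1 d2 %| d2)%N by exact: dvdn_gcdr.
set c := gcdn d1 d2 in eb; have c0 : (0 < c)%N by rewrite gcdn_gt0 d10.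
have b0 : (0 < b)%N by move: d20; rewrite eb muln_gt0 => /andP[].
have cb : coprime b c.
  by move: s2; rewrite eb mobius_mul; case: ifP.
have elcm : lcmn d1 d2 = (d1 * b)%N.
  by apply/eqP; rewrite -(eqn_pmul2r c0) -/c muln_lcm_gcd {1}eb mulnA.
have /dvdnP[a ea] : (c %| d1)%N by exact: dvdn_gcdl.
have cab : coprime a b.
  have : gcdn (a * c) (b * c) = c by rewrite -ea -eb.
  by rewrite -muln_gcdl => /eqP; rewrite -{2}[c]mul1n eqn_pmul2r.
have c1b : coprime d1 b by rewrite ea coprimeMl cab coprime_sym.
rewrite elcm nu_mul // leq_mul2l eb nu_mul // leq_pmulr ?orbT //.
by rewrite nu_gt0.
Qed.

Lemma dens_le_sieveg d : mobius d != 0 -> dens d <= g d.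
Proof.
move: d; apply: mobius_neq0_ind => [|p m pp m0 pm sm IH].
  by case: sq => -> _ _; rewrite dens1.
have cpm : coprime p m by rewrite prime_coprime.
rewrite (dens_mul p m (prime_gt0 pp) m0 cpm); case: (sq) => _ g0 ->//; rewrite (negPf pm).
apply: ler_pM => //; [exact/ltW/dens_gt0/prime_gt0|exact/ltW/dens_gt0|].
rewrite /dens -sieveg_weight // ler_pdivrMr; last by rewrite ltr_pwDl.
by rewrite ler_peMr // lerDl.
Qed.

(** Primes of [d] are removed one at a time: [(dens p)^-1 * g p = 1 + g p], and the sum prime to [p]
    over the shorter range is at most the one over the full range. This bounds the sieve weights
    independently of [d]. *)
Lemma logsum_multiples_le d (u : RT) : mobius d != 0 ->
  (dens d)^-1 * logsum RT g (fun n => (d %| n)%N) 0 u <= logsum RT g predT 0 u.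
Proof.
move: d; apply: mobius_neq0_ind => [|p m pp m0 pm sm IH].
  by rewrite dens1 invr1 mul1r; apply: le_logsum.
have cpm : coprime p m by rewrite prime_coprime.
apply: le_trans IH; rewrite (dens_mul p m (prime_gt0 pp) m0 cpm) invfM mulrAC mulrC.
rewrite ler_wpM2l ?invr_ge0 ?(ltW (dens_gt0 _ _)) //.
have Pm j : ~~ (p %| j)%N -> (m %| p * j)%N = (m %| j)%N.
  by move=> _; rewrite Gauss_dvdr // coprime_sym prime_coprime.
set M := (Num.truncn (expR u)).+1.
have uM : expR u <= M%:R by exact/ltW/truncnS_gt.
rewrite (logsum_split _ _ sq (fun n => (m %| n)%N) p 0 u pp Pm).
have -> : logsum RT g (fun n => (p * m %| n)%N) 0 u =
   g p * logsum RT g (fun j => (m %| j)%N && ~~ (p %| j)%N) 0 (u - ln p%:R).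
  rewrite -(logsum_mult _ _ sq (fun n => (m %| n)%N) p 0 u M pp uM Pm) (logsumE _ _ _ _ _ M) //.
  apply: eq_bigl => n; rewrite Gauss_dvd ?prime_coprime //.
  by case: (p %| n)%N; rewrite ?andbF //= ?andbT.
set Y := logsum _ _ _ _ (u - _); set Z := logsum _ _ _ _ u.
have YZ : Y <= Z by rewrite le_logsum // gerBl ln_nat_ge0.
have Y0 : 0 <= Y by exact: logsum_ge0.
have -> : (dens p)^-1 * (g p * Y) = (1 + g p) * Y.
  have gp : 0 <= g p by exact: sqmult_ge0.
  have gp0 : g p != 0.
    by have := dens_gt0 p (prime_gt0 pp); rewrite /dens -sieveg_weight //;
       case: eqP => // ->; rewrite mul0r ltxx.
  rewrite /dens -sieveg_weight //; field; rewrite gp0 /= gt_eqF //.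
  by rewrite ltr_pwDl.
by rewrite mulrDl mul1r lerD2r.
Qed.
End Diagonalisation.

Section SieveSum.
Variables (RT : realType) (H : seq int) (R : RT).
Hypothesis uH : uniq H.
Hypothesis aH : admissible H.
Hypothesis H0 : (0 < size H)%N.
Hypothesis R1 : 1 < R.
Local Notation g := (sieveg RT H).
Implicit Types (d n r p m l : nat).

Let sq : sqmult RT g := sqmult_sieveg RT H aH H0.
Let M := (Num.truncn R).+1.
Let S := singser RT H.
Definition lamscale l : RT := S / l`!%:R.
Local Notation cl := lamscale.

Let R0 : 0 < R. Proof. exact: lt_trans R1. Qed.

Let ltRM n : n%:R < R -> (n < M)%N.
Proof. by move=> nR; rewrite ltnS truncn_ge_nat ?(ltW R0) // ltW. Qed.

Let expRM : expR (ln R) <= M%:R.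
Proof. by rewrite lnK ?posrE // ltW // truncnS_gt. Qed.

Let ltlnR n : (0 < n)%N -> (ln (n%:R : RT) < ln R) = (n%:R < R).
Proof. by move=> n0; rewrite ltr_ln ?posrE ?ltr0n. Qed.

Let cl_ge0 l : 0 <= cl l.
Proof. by rewrite divr_ge0 // ltW // singser_gt0. Qed.

(** The inner sum of the weight rewritten over the multiples [n = r d]; the coprimality condition is
    then carried by [g n], which vanishes off squarefree numbers. *)
Definition lamtail l d : RT := \sum_(n < M | (d %| n)%N && [&& (0 < n)%N & n%:R < R])
   g n * ln (R / n%:R) ^+ l.

Lemma lamE l d : (0 < d)%N ->
  lam H R l d = (mobius d)%:~R * (dens RT H d)^-1 * (cl l * lamtail l d).
Proof.
move=> d0; rewrite /lam ff_dens.
have [->|sd] := eqVneq (mobius d) 0; first by rewrite !mul0r if_same.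
rewrite /lamtail (sum_multiples _ d M (fun n => [&& (0 < n)%N & n%:R < R])
   (fun n => g n * ln (R / n%:R) ^+ l)) //; last by move=> n /andP[_]; exact: ltRM.
case: ifP => dR; last first.
  rewrite big_pred0 ?mulr0 // => r; rewrite muln_gt0 d0 /=; apply/negP => /andP[r0].
  rewrite natrM => rR; move/negP: dR; apply; apply: le_lt_trans rR.
  by rewrite ler_peMr // ler1n.
have f10 := f1_gt0 RT H aH H0 d.
have gd : g d = (f1 RT H d)^-1.
  by rewrite /sieveg -rmorphXn /= mobius_sqr // mul1r.
have key : \sum_(m < M | (0 < d * m)%N && ((d * m)%:R < R)) g (d * m) * ln (R / (d * m)%:R) ^+ l =
  (f1 RT H d)^-1 * \sum_(r < M | (0 < r)%N && (r%:R * d%:R < R) && coprime r d)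
     ((mobius r)%:~R ^+ 2 / f1 RT H r * ln (R / (r%:R * d%:R)) ^+ l).
  rewrite mulr_sumr big_mkcond [RHS]big_mkcond /=; apply: eq_bigr => r _.
  rewrite muln_gt0 d0 /= (natrM _ d r) (mulrC d%:R).
  case: (0 < r)%N => //=; case: (_ < R) => //=.
  rewrite (sqmult_mul _ _ d r sq) coprime_sym gd; case: ifP => // _; last by rewrite mul0r.
  by rewrite /sieveg -!mulrA.
rewrite key /lamscale -/S -/M; ring.
Qed.

(** Moebius inversion: summing over [d] between [r] and [n] in the divisibility order leaves only
    [n = r]. These are the diagonal variables of the quadratic form. *)
Lemma sum_lam_dens l r : (0 < r)%N ->
  \sum_(d < M | (0 < d)%N && (r %| d)%N) lam H R l d * dens RT H d =
  if r%:R < R then cl l * (g r * ln (R / r%:R) ^+ l) * (mobius r)%:~R else 0.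
Proof.
move=> r0.
transitivity (\sum_(d < M | (0 < d)%N && (r %| d)%N) \sum_(n < M | (d %| n)%N && [&& (0 < n)%N & n%:R < R])
   cl l * (g n * ln (R / n%:R) ^+ l) * (mobius d)%:~R).
  apply: eq_bigr => d /andP[d0 rd]; rewrite lamE // /lamtail mulrAC.
  rewrite mulfVK ?gt_eqF ?dens_gt0 // mulr_sumr mulrC mulr_suml.
  by apply: eq_bigr.
rewrite (exchange_big_dep (fun n : 'I_M => (0 < n)%N && (n%:R < R))) /=; last by move=> ? ? _ /andP[].
transitivity (\sum_(n < M | (0 < n)%N && (n%:R < R)) cl l * (g n * ln (R / n%:R) ^+ l) *
   (if n == r :> nat then (mobius r)%:~R else 0)).
  apply: eq_bigr => n /andP[n0 nR]; rewrite -mulr_sumr.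
  have [gn|gn] := eqVneq (g n) 0; first by rewrite gn mul0r mulr0 !mul0r.
  have sn : mobius n != 0.
    by apply: contra_neq gn => e; rewrite /sieveg e expr0n /= mul0r.
  congr (_ * _); rewrite -rmorph_sum /=.
  have -> : \sum_(d < M | (0 < d)%N && (r %| d)%N && ((d %| n)%N && ((0 < n)%N && (n%:R < R)))) mobius d =
     \sum_(d < M | (r %| d)%N && (d %| n)%N) mobius d.
    apply: eq_bigl => d; rewrite n0 nR !andbT; case: (boolP (d %| n)%N) => dn; rewrite ?andbF //.
    by rewrite (dvdn_gt0 n0 dn).
  rewrite (sum_multiples _ r M (fun d => (d %| n)%N) mobius) //; last first.
    by move=> d /dvdn_leq -/(_ n0) le; apply: leq_ltn_trans le _.
  have [/dvdnP[m em]|rn] := boolP (r %| n)%N; last first.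
    rewrite big_pred0; last first.
      move=> d; apply/negP => /(dvdn_trans (dvdn_mulr d (dvdnn r))); exact/negP.
    by case: eqP rn => // ->; rewrite dvdnn.
  have m0 : (0 < m)%N by move: n0; rewrite em muln_gt0 => /andP[].
  have mM : (m < M)%N by apply: leq_ltn_trans (ltn_ord n); rewrite em leq_pmulr.
  rewrite em; under eq_bigl do rewrite [(m * r)%N]mulnC dvdn_pmul2l //.
  rewrite sum_mobius_divisors ?m0 //; last by rewrite mulnC -em.
  have -> : ((m * r)%N == r) = (m == 1%N) by rewrite -{2}[r]mul1n eqn_pmul2r.
  by case: eqP.
case: ifPn => rR; last first.
  rewrite big1 // => n /andP[n0 nR]; case: eqP => [e|]; last by rewrite mulr0.
  by rewrite -e nR in rR.
have rM := ltRM r rR.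
rewrite (bigD1 (Ordinal rM)) /=; last by rewrite r0.
rewrite eqxx big1 ?addr0 // => n /andP[_ ne]; rewrite ifF ?mulr0 //.
by apply/negP => /eqP e; move/eqP: ne; apply; apply: val_inj.
Qed.

Lemma quadratic_form l1 l2 :
  \sum_(d1 < M | (0 < d1)%N) \sum_(d2 < M | (0 < d2)%N)
     lam H R l1 d1 * lam H R l2 d2 * dens RT H (lcmn d1 d2) =
  cl l1 * cl l2 * logsum RT g predT (l1 + l2) (ln R).
Proof.
have lam0 l d : mobius d = 0 -> lam H R l d = 0.
  by move=> e; rewrite /lam e !mul0r if_same.
transitivity (\sum_(d1 < M | (0 < d1)%N) \sum_(d2 < M | (0 < d2)%N)
   \sum_(r < M | (0 < r)%N) f1 RT H r * ((if (r %| d1)%N then lam H R l1 d1 * dens RT H d1 else 0) *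
      (if (r %| d2)%N then lam H R l2 d2 * dens RT H d2 else 0))).
  apply: eq_bigr => d1 d10; apply: eq_bigr => d2 d20.
  have [e|s1] := eqVneq (mobius d1) 0.
    rewrite lam0 // !mul0r big1 // => r _.
    by rewrite if_same mul0r mulr0.
  have [e|s2] := eqVneq (mobius d2) 0.
    rewrite (lam0 l2) // mulr0 !mul0r big1 // => r _.
    by rewrite if_same !mulr0.
  rewrite (dens_lcm RT H H0 d1 d2 M) // mulr_sumr mulr_sumr big_mkcond [RHS]big_mkcond /=.
  apply: eq_bigr => r _; case: (posnP r) => [->|r0].
    by rewrite dvd0n (gtn_eqF d10).
  case: (r %| d1)%N => /=; last by rewrite mul0r mulr0.
  by case: (r %| d2)%N => /=; rewrite ?mulr0 //; ring.
transitivity (\sum_(r < M | (0 < r)%N) f1 RT H r *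
   ((\sum_(d < M | (0 < d)%N && (r %| d)%N) lam H R l1 d * dens RT H d) *
    (\sum_(d < M | (0 < d)%N && (r %| d)%N) lam H R l2 d * dens RT H d))).
  under eq_bigr do rewrite exchange_big.
  rewrite exchange_big /=; apply: eq_bigr => r _.
  rewrite !big_mkcondr /= big_distrlr /= mulr_sumr.
  by apply: eq_bigr => d1 _; rewrite mulr_sumr.
rewrite (logsumE _ _ _ _ _ M) // mulr_sumr big_mkcond [RHS]big_mkcond /=.
apply: eq_bigr => r _; case: (posnP r) => //= r0; rewrite andbT ltlnR //.
rewrite !sum_lam_dens //; case: ifP => rR; last by rewrite !mulr0.
have r0' : 0 < r%:R :> RT by rewrite ltr0n.
rewrite ln_div ?posrE // exprD.
have [e|sr] := eqVneq (mobius r) 0.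
  by rewrite /sieveg e expr0n /= !mul0r !mulr0 ?mul0r ?mulr0.
have f10 := f1_gt0 RT H aH H0 r.
have m2 : (mobius r)%:~R * (mobius r)%:~R = 1 :> RT.
  by rewrite -rmorphM /= -expr2 mobius_sqr.
have gE : g r = (f1 RT H r)^-1.
  by rewrite /sieveg -rmorphXn /= mobius_sqr // mul1r.
rewrite gE; set a := ln R - _; set z := (mobius r)%:~R in m2 *.
have -> : f1 RT H r * (cl l1 * ((f1 RT H r)^-1 * a ^+ l1) * z *
   (cl l2 * ((f1 RT H r)^-1 * a ^+ l2) * z)) =
   (f1 RT H r / f1 RT H r) * (z * z) * (cl l1 * cl l2 * ((f1 RT H r)^-1 * (a ^+ l1 * a ^+ l2))).
  by ring.
by rewrite m2 divff ?gt_eqF // !mul1r.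
Qed.

Lemma lam_le l d : (0 < d)%N -> `|lam H R l d| <= 
  if (mobius d != 0) && (d%:R < R) then cl l * ln R ^+ l * logsum RT g predT 0 (ln R) else 0.
Proof.
move=> d0; rewrite lamE //.
have [->|sd] := eqVneq (mobius d) 0; first by rewrite !mul0r normr0.
have lR : 0 <= ln R by rewrite ln_ge0 // ltW.
have t0 : 0 <= lamtail l d.
  apply: sumr_ge0 => n /and3P[_ n0 nR]; rewrite mulr_ge0 ?(sqmult_ge0 _ _ sq) //.
  by rewrite exprn_ge0 // ln_ge0 // ler_pdivlMr ?ltr0n // mul1r ltW.
case: ifPn => /= dR; last first.
  rewrite /lamtail big_pred0 ?mulr0 ?normr0 // => n; apply/negP => /and3P[dn n0 nR].
  move/negP: dR; apply; apply: le_lt_trans nR; rewrite ler_nat; exact: dvdn_leq.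
have z1 : `|(mobius d)%:~R : RT| = 1.
  apply/eqP; rewrite -(@eqrXn2 _ 2) // expr1n -normrX -rmorphXn /= mobius_sqr //.
  by rewrite normr1.
have di : 0 < (dens RT H d)^-1 by rewrite invr_gt0 dens_gt0.
rewrite normrM normrM z1 mul1r (ger0_norm (ltW di)) (ger0_norm (mulr_ge0 (cl_ge0 l) t0)).
rewrite mulrCA -[leRHS]mulrA ler_wpM2l //.
apply: (@le_trans _ _ (ln R ^+ l * ((dens RT H d)^-1 * logsum RT g (fun n => (d %| n)%N) 0 (ln R)))); last first.
  by rewrite ler_wpM2l ?exprn_ge0 // logsum_multiples_le.
rewrite mulrCA ler_wpM2l ?(ltW di) // (logsumE _ _ _ _ _ M) // mulr_sumr /lamtail.
rewrite big_mkcond [leRHS]big_mkcond /=; apply: ler_sum => n _.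
case: (posnP n) => [->|n0] /=; first by rewrite andbF.
rewrite ltlnR // andbC; case: ifP => // /andP[nR dn].
have n0' : 0 < n%:R :> RT by rewrite ltr0n.
rewrite expr0 mulr1 mulrC ler_wpM2r ?(sqmult_ge0 _ _ sq) // lerXn2r ?nnegrE //.
  by rewrite ln_ge0 // ler_pdivlMr // mul1r ltW.
by rewrite ln_div ?posrE // gerBl ln_nat_ge0.
Qed.

(** One factor [G_0] bounds the weight. The other comes from [nu_d = d * dens d <= R * g d], summed
    over [d < R]. *)
Lemma sum_lam_nu_le l :
  \sum_(d < M | (0 < d)%N) `|lam H R l d| * (nu H d)%:R <=
  cl l * ln R ^+ l * (R * logsum RT g predT 0 (ln R) ^+ 2).
Proof.
set G := logsum RT g predT 0 (ln R).
have G0 : 0 <= G by exact: logsum_ge0.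
have lR : 0 <= ln R by rewrite ln_ge0 // ltW.
have GE : G = \sum_(d < M | [&& (0 < d)%N, ln (d%:R : RT) < ln R & predT d])
    g d * (ln R - ln d%:R) ^+ 0 by exact: logsumE.
have c0 : 0 <= cl l * ln R ^+ l * G.
  by apply: mulr_ge0 => //; apply: mulr_ge0 => //; exact: exprn_ge0.
apply: (@le_trans _ _ (\sum_(d < M | [&& (0 < d)%N, ln (d%:R : RT) < ln R & predT d])
   (cl l * ln R ^+ l * G * R) * (g d * (ln R - ln d%:R) ^+ 0))); last first.
  rewrite -mulr_sumr -GE expr2 le_eqVlt; apply/orP; left; apply/eqP; ring.
rewrite big_mkcond [leRHS]big_mkcond /=; apply: ler_sum => d _.
case: (posnP d) => [//|d0] /=; rewrite andbT ltlnR // expr0 mulr1.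
apply: le_trans (ler_wpM2r (ler0n _ _) (lam_le l d d0)) _.
have [e|sd] := eqVneq (mobius d) 0.
  rewrite /= mul0r; case: ifP => // _.
  by apply: mulr_ge0; [exact: mulr_ge0 c0 (ltW R0)|exact: (sqmult_ge0 _ _ sq)].
rewrite /=; case: ifP => dR; last by rewrite mul0r.
rewrite -[leRHS]mulrA ler_wpM2l //.
have d0' : 0 < d%:R :> RT by rewrite ltr0n.
have -> : (nu H d)%:R = d%:R * dens RT H d by rewrite /dens mulrCA divff ?gt_eqF // mulr1.
apply: ler_pM; [by []|exact/ltW/dens_gt0|exact: ltW|exact: dens_le_sieveg].
Qed.

Lemma sieve_sum (N : RT) l1 l2 : 0 <= N ->
  `|\sum_(n < (Num.truncn (2 * N)).+1 | N < n%:R)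
      (LambdaR H R l1 n%:Z * LambdaR H R l2 n%:Z)
    - N * (cl l1 * cl l2 * logsum RT g predT (l1 + l2) (ln R))| <=
  3 * (cl l1 * cl l2 * ln R ^+ (l1 + l2) * R ^+ 2 * logsum RT g predT 0 (ln R) ^+ 4).
Proof.
move=> N0; set K := (Num.truncn (2 * N)).+1.
pose cnt d : RT := \sum_(n < K | N < n%:R) (d%:Z %| Ppoly H n%:Z)%Z%:R.
have -> : \sum_(n < K | N < n%:R) (LambdaR H R l1 n%:Z * LambdaR H R l2 n%:Z) =
  \sum_(d1 < M | (0 < d1)%N) \sum_(d2 < M | (0 < d2)%N)
     lam H R l1 d1 * lam H R l2 d2 * cnt (lcmn d1 d2).
  have LE l n : LambdaR H R l n =
     \sum_(d < M | (0 < d)%N) (if (d%:Z %| Ppoly H n)%Z then lam H R l d else 0).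
    by rewrite /LambdaR big_mkcondr.
  transitivity (\sum_(n < K | N < n%:R) \sum_(d1 < M | (0 < d1)%N) \sum_(d2 < M | (0 < d2)%N)
     lam H R l1 d1 * lam H R l2 d2 * ((lcmn d1 d2)%:Z %| Ppoly H n%:Z)%Z%:R).
    apply: eq_bigr => n _; rewrite !LE big_distrlr /=.
    apply: eq_bigr => d1 _; apply: eq_bigr => d2 _.
    have -> : ((lcmn d1 d2)%:Z %| Ppoly H n%:Z)%Z =
       (d1%:Z %| Ppoly H n%:Z)%Z && (d2%:Z %| Ppoly H n%:Z)%Z by rewrite !dvdzE /= dvdn_lcm.
    by case: (d1%:Z %| _)%Z; case: (d2%:Z %| _)%Z; rewrite /= ?mulr1 ?mulr0 ?mul0r.
  rewrite exchange_big /=; apply: eq_bigr => d1 _.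
  by rewrite exchange_big /=; apply: eq_bigr => d2 _; rewrite -mulr_sumr.
rewrite -quadratic_form mulr_sumr -sumrB.
apply: le_trans (ler_norm_sum _ _ _) _.
apply: (@le_trans _ _ (\sum_(d1 < M | (0 < d1)%N) \sum_(d2 < M | (0 < d2)%N)
   3 * ((`|lam H R l1 d1| * (nu H d1)%:R) * (`|lam H R l2 d2| * (nu H d2)%:R)))); last first.
  have := ler_pM _ _ (sum_lam_nu_le l1) (sum_lam_nu_le l2).
  rewrite !sumr_ge0 => [/(_ isT isT)|d _|d _]; rewrite ?mulr_ge0 //.
  rewrite big_distrlr /= => h.
  under eq_bigr do rewrite -mulr_sumr.
  rewrite -mulr_sumr ler_wpM2l //; apply: le_trans h _.
  by rewrite le_eqVlt; apply/orP; left; apply/eqP; rewrite exprD; ring.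
apply: ler_sum => d1 d10; rewrite mulr_sumr -sumrB; apply: le_trans (ler_norm_sum _ _ _) _.
apply: ler_sum => d2 d20.
have lam0 l d : mobius d = 0 -> lam H R l d = 0.
  by move=> e; rewrite /lam e !mul0r if_same.
have [e|s1] := eqVneq (mobius d1) 0.
  by rewrite lam0 // !(mul0r, mulr0, subrr, normr0).
have [e|s2] := eqVneq (mobius d2) 0.
  by rewrite (lam0 l2) // !(mul0r, mulr0, subrr, normr0).
have lc0 : (0 < lcmn d1 d2)%N by rewrite lcmn_gt0 d10.
have := count_dvd_interval RT H (lcmn d1 d2) N lc0 N0; rewrite -/(cnt _) -/(dens RT H _) => h.
have -> : lam H R l1 d1 * lam H R l2 d2 * cnt (lcmn d1 d2) -
   N * (lam H R l1 d1 * lam H R l2 d2 * dens RT H (lcmn d1 d2)) =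
   (lam H R l1 d1 * lam H R l2 d2) * (cnt (lcmn d1 d2) - N * dens RT H (lcmn d1 d2)) by ring.
rewrite normrM normrM.
(* This decouples [d1] and [d2], so the remainder is a product of two single sums. *)
have nl : (nu H (lcmn d1 d2))%:R <= (nu H d1)%:R * (nu H d2)%:R :> RT.
  by rewrite -natrM ler_nat nu_lcm_le.
apply: (@le_trans _ _ (`|lam H R l1 d1| * `|lam H R l2 d2| * (3 * ((nu H d1)%:R * (nu H d2)%:R)))).
  by rewrite ler_wpM2l ?mulr_ge0 //; apply: le_trans h _; rewrite ler_wpM2l.
by rewrite le_eqVlt; apply/orP; left; apply/eqP; ring.
Qed.
End SieveSum.

(** * Choice of constants and conclusion *)

Lemma leq_fact_nat (m n : nat) : (m <= n)%N -> (m`! <= n`!)%N.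
Proof.
elim: n => [|n IH]; first by rewrite leqn0 => /eqP ->.
rewrite leq_eqVlt ltnS => /orP[/eqP->//|/IH le].
by rewrite factS (leq_trans le) // leq_pmull.
Qed.

Lemma expR_dominates (RT : realType) (n : nat) (c Q : RT) : 0 < c -> 0 <= Q ->
  exists2 U : RT, 0 <= U & forall u, U <= u -> Q * u ^+ n <= expR (c * u).
Proof.
move=> c0 Q0; have cn : 0 < c ^+ n.+1 by rewrite exprn_gt0.
have f0 : 0 < n.+1`!%:R :> RT by rewrite ltr0n fact_gt0.
have U0 : 0 <= Q * n.+1`!%:R / c ^+ n.+1 by rewrite divr_ge0 ?mulr_ge0 // ltW.
exists (Q * n.+1`!%:R / c ^+ n.+1) => // u Uu.
have u0 : 0 <= u by exact: le_trans Uu.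
have cu : 0 <= c * u by rewrite mulr_ge0 // ltW.
apply: le_trans (expR_ge1Dxn n cu).
apply: (@le_trans _ _ ((c * u) ^+ n.+1 / n.+1`!%:R)); last by rewrite lerDr.
have -> : (c * u) ^+ n.+1 = c ^+ n.+1 * u * u ^+ n by rewrite exprMn [u ^+ n.+1]exprS mulrA.
rewrite ler_pdivlMr // mulrAC ler_wpM2r ?exprn_ge0 //.
by move: Uu; rewrite ler_pdivrMr // [u * _]mulrC.
Qed.

(** [(1/2 - eps) (2 + 4 eps) = 1 - 4 eps^2 <= 1]. *)
Lemma square_expR_le (RT : realType) (eps N R : RT) : 0 < eps -> eps < 2^-1 -> 0 < N ->
  1 <= R -> R <= N `^ (2^-1 - eps) -> R ^+ 2 * expR (4 * eps * ln R) <= N.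
Proof.
move=> e0 e1 N0 R1 RN; have R0 : 0 < R by exact: lt_le_trans R1.
have u0 : 0 <= ln R by rewrite ln_ge0.
have h : ln R <= (2^-1 - eps) * ln N.
  by rewrite -ln_powR ler_ln ?posrE // powR_gt0.
have a0 : 0 < 2^-1 - eps by rewrite subr_gt0.
have lnN : (2 + 4 * eps) * ln R <= ln N.
  rewrite -(ler_pM2l a0); apply: le_trans h; rewrite mulrA ler_piMl //.
  have : 0 <= eps * eps by rewrite mulr_ge0 // ltW.
  by lra.
have -> : R ^+ 2 = expR (2 * ln R) by rewrite expRM_natl lnK ?posrE.
rewrite -expRD -mulrDl -[N]lnK ?posrE // ler_expR.
by [].
Qed.

Theorem theorem5 (RT : realType) (k : nat) : (2 <= k)%N ->
  exists C : RT, 0 < C /\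
  forall eps : RT, 0 < eps -> eps < 2^-1 ->
  exists R0 : RT,
  forall (H : seq int) (l1 l2 : nat) (N R : RT),
    uniq H -> size H = k -> admissible H ->
    (l1 <= k)%N -> (l2 <= k)%N ->
    0 < N -> R0 <= R -> R <= N `^ (2^-1 - eps) ->
    let M := ('C(l1 + l2, l1))%:R * singser RT H * N
             * ln R ^+ (k + l1 + l2) / ((k + l1 + l2)`!)%:R in
    `| \sum_(n < (Num.truncn (2 * N)).+1 | N < n%:R)
          (LambdaR H R l1 n%:Z * LambdaR H R l2 n%:Z) - M |
      <= C * M * (betaH RT H * singser RT H / ln R).
Proof.
move=> k2.
have [K K0 hK] := logsum_sieveg_growth RT k k2.
have /choice[Cf hCf] : forall l, exists C : RT, 0 < C /\
  forall (H : seq int) u, uniq H -> size H = k -> admissible H -> cA RT k + 1 <= u ->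
  `|singser RT H * logsum RT (sieveg RT H) predT l u
     - l`!%:R / (k + l)`!%:R * u ^+ (k + l)| <=
  C * (l`!%:R / (k + l)`!%:R * u ^+ (k + l)) * (betaH RT H * singser RT H / u).
  by move=> l; have [C C0 hC] := logsum_sieveg_asymp RT k k2 l; exists C.
(* Summing over every [l <= 2 k] gives one constant for all [l1], [l2]. The added 1 in [Cm + 1] is
   reserved for the sieve remainder. *)
pose Cm := \sum_(l < (k + k).+1) Cf l.
have Cm0 : 0 <= Cm by apply: sumr_ge0 => l _; exact: ltW (hCf l).1.
have CfCm l : (l <= k + k)%N -> Cf l <= Cm.
  rewrite -ltnS => lk; rewrite /Cm (bigD1 (Ordinal lk)) //= lerDl sumr_ge0 // => i _.
  exact: ltW (hCf i).1.
exists (Cm + 1); split; first by rewrite ltr_wpDl.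
move=> eps e0 e1.
have ln2 : 0 < ln 2 / 2 :> RT by rewrite divr_gt0 // ln_gt0 // ltr1n.
(* Collects the remainder relative to the main error: 3 from counting, [K ^+ 4] from the four
   factors [G_0], [(3 * k)!] bounding [(k + l1 + l2)!], and [ln 2 / 2] bounding beta below. *)
pose Q : RT := 3 * K ^+ 4 * (3 * k)`!%:R / (ln 2 / 2).
have Q0 : 0 <= Q.
  apply: divr_ge0; last exact: ltW.
  by apply: mulr_ge0 => //; apply: mulr_ge0 => //; exact/exprn_ge0/ltW.
have [U U0 hU] := expR_dominates RT (4 * k) (4 * eps) Q (mulr_gt0 (ltr0Sn _ 3) e0) Q0.
exists (expR (cA RT k + 1 + U)) => H l1 l2 N R uH eH aH l1k l2k N0 RR RN /=.
have A1 : 1 <= cA RT k + 1 by rewrite lerDr cA_ge0.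
have R0 : 0 < R by apply: lt_le_trans RR; exact: expR_gt0.
have uR : cA RT k + 1 + U <= ln R by rewrite -ler_expR lnK ?posrE.
have uA : cA RT k + 1 <= ln R by apply: le_trans uR; rewrite lerDl.
have uU : U <= ln R by apply: le_trans uR; rewrite lerDr (le_trans ler01).
have u1 : 1 <= ln R by exact: le_trans uA.
have u0 : 0 < ln R by exact: lt_le_trans u1.
have R1 : 1 < R by rewrite -[R]lnK ?posrE // expR_gt1.
have H0 : (0 < size H)%N by rewrite eH ltnW.
have k1' : (1 < size H)%N by rewrite eH.
have bl := betaH_gt RT H uH aH H0 k1'.
have S0 := singser_gt0 RT H uH aH H0.
have sum := sieve_sum RT H R uH aH H0 R1 N l1 l2 (ltW N0).
have [_ asy] := hCf (l1 + l2)%N; have {}asy := asy H (ln R) uH eH aH uA.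
have gro := hK H (ln R) uH eH aH uA.
have G0 : 0 <= logsum RT (sieveg RT H) predT 0 (ln R).
  by apply: logsum_ge0; exact: sqmult_sieveg.
have CC : Cf (l1 + l2)%N <= Cm by apply: CfCm; exact: leq_add.
have NR := square_expR_le RT eps N R e0 e1 N0 (ltW R1) RN.
have {}hU := hU (ln R) uU.
have binE : ('C(l1 + l2, l1))%:R = (l1 + l2)`!%:R / (l1`!%:R * l2`!%:R) :> RT.
  have := bin_fact (leq_addr l2 l1); rewrite addKn => /(congr1 (fun n => n%:R : RT)).
  rewrite !natrM => <-; rewrite mulfK // mulf_neq0 // pnatr_eq0 -lt0n fact_gt0 //.
rewrite /lamscale in sum.
have kl : (k + l1 + l2 = k + (l1 + l2))%N by rewrite addnA.
have dk : ((k + (l1 + l2))`!%:R : RT) <= (3 * k)`!%:R.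
  have le : (k + (l1 + l2) <= 3 * k)%N by rewrite !mulSn mul0n addn0 leq_add2l leq_add.
  by rewrite ler_nat leq_fact_nat.
rewrite kl binE; set l := (l1 + l2)%N in sum asy CC dk *.
have f1 : 0 < l1`!%:R :> RT by rewrite ltr0n fact_gt0.
have f2 : 0 < l2`!%:R :> RT by rewrite ltr0n fact_gt0.
have fl : 1 <= l`!%:R :> RT by rewrite ler1n fact_gt0.
have fkl : 0 < (k + l)`!%:R :> RT by rewrite ltr0n fact_gt0.
move: sum asy gro G0 fl f1 f2 fkl dk.
set T := \sum_(n < _ | _) _; set ml := logsum _ _ _ l _; set m0 := logsum _ _ _ 0 _.
set S := singser RT H in S0 *; set be := betaH RT H in bl *; set u := ln R in u0 u1 NR hU *.
move: (l1`!%:R : RT) (l2`!%:R : RT) (l`!%:R : RT) ((k + l)`!%:R : RT) => x1 x2 xl xk.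
move=> sum asy gro G0 fl f1 f2 fkl dk.
set M := xl / (x1 * x2) * S * N * u ^+ (k + l) / xk.
have xl0 : 0 < xl by exact: lt_le_trans fl.
have be0 : 0 < be by exact: lt_le_trans bl.
set e := be * S / u; have e_gt0 : 0 < e by rewrite divr_gt0 // mulr_gt0.
have un : 0 < u ^+ (k + l) by rewrite exprn_gt0.
have ME : M = N * S / (x1 * x2) * (xl / xk * u ^+ (k + l)).
  by rewrite /M; ring.
have P0 : 0 < N * S / (x1 * x2) by rewrite divr_gt0 // mulr_gt0.
have M0 : 0 < M by rewrite ME mulr_gt0 // mulr_gt0 // divr_gt0.
have main : `|N * (S / x1 * (S / x2) * ml) - M| <= Cm * M * e.
  have -> : N * (S / x1 * (S / x2) * ml) - M =
     N * S / (x1 * x2) * (S * ml - xl / xk * u ^+ (k + l)).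
    by rewrite ME invfM; ring.
  rewrite normrM (ger0_norm (ltW P0)).
  apply: le_trans (ler_wpM2l (ltW P0) asy) _.
  have -> : N * S / (x1 * x2) * (Cf l * (xl / xk * u ^+ (k + l)) * (be * S / u)) =
     Cf l * M * e by rewrite ME /e; ring.
  by apply: (ler_wpM2r (ltW e_gt0)); exact: ler_wpM2r (ltW M0) _ _ CC.
(* Both sides contain [S ^+ 2], which cancels, so no upper bound for the singular series is
   required. What remains is [Q * u ^+ (4 * k) <= expR (4 * eps * u)]. *)
have err : 3 * (S / x1 * (S / x2) * u ^+ l * R ^+ 2 * m0 ^+ 4) <= M * e.
  have m4 : m0 ^+ 4 <= K ^+ 4 * u ^+ (4 * k).
    by rewrite mulnC exprM -exprMn lerXn2r ?nnegrE // mulr_ge0 ?exprn_ge0 ?(ltW u0) // ltW.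
  have W0 : 0 < S / x1 * (S / x2) * u ^+ l by rewrite !mulr_gt0 ?invr_gt0 ?exprn_gt0.
  have -> : M * e = S / x1 * (S / x2) * u ^+ l * (N * (xl / xk) * be * (u ^+ k / u)).
    by rewrite ME /e exprD invfM; ring.
  have -> : 3 * (S / x1 * (S / x2) * u ^+ l * R ^+ 2 * m0 ^+ 4) =
     S / x1 * (S / x2) * u ^+ l * (3 * (R ^+ 2 * m0 ^+ 4)) by ring.
  apply: (ler_wpM2l (ltW W0)).
  have uk : 1 <= u ^+ k / u.
    rewrite ler_pdivlMr // mul1r -{1}[u]expr1 ler_weXn2l //; exact: ltnW.
  have F0 : 0 < (3 * k)`!%:R :> RT by rewrite ltr0n fact_gt0.
  have xlk : ((3 * k)`!%:R)^-1 <= xl / xk.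
    have xki : ((3 * k)`!%:R)^-1 <= xk^-1 by rewrite lef_pV2 ?posrE.
    by rewrite -[leLHS]mul1r ler_pM // invr_ge0 ltW.
  have R20 : 0 <= R ^+ 2 by rewrite exprn_ge0 // ltW.
  apply: (@le_trans _ _ (N * ((3 * k)`!%:R)^-1 * (ln 2 / 2) * 1)); last first.
    have Fi0 : 0 <= N * ((3 * k)`!%:R)^-1 by exact: divr_ge0 (ltW N0) (ltW F0).
    apply: ler_pM => //; first exact: mulr_ge0 Fi0 (ltW ln2).
    apply: ler_pM => //; first exact: ltW.
    by apply: ler_wpM2l => //; exact: ltW.
  have QE : 3 * K ^+ 4 * u ^+ (4 * k) = Q * u ^+ (4 * k) * ((3 * k)`!%:R^-1 * (ln 2 / 2)).
    by rewrite /Q; field; rewrite !gt_eqF // ln_gt0 // ltr1n.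
  apply: (@le_trans _ _ (R ^+ 2 * (3 * K ^+ 4 * u ^+ (4 * k)))).
    rewrite mulrCA; apply: (ler_wpM2l R20); rewrite -mulrA.
    by apply: ler_wpM2l.
  rewrite QE mulrA mulr1 -[leRHS]mulrA; apply: ler_wpM2r.
    by rewrite mulr_ge0 ?invr_ge0 // ltW.
  by apply: le_trans NR; exact: ler_wpM2l.
have -> : T - M = (T - N * (S / x1 * (S / x2) * ml)) + (N * (S / x1 * (S / x2) * ml) - M) by ring.
apply: le_trans (ler_normD _ _) _.
rewrite addrC mulrDl mul1r mulrDl; apply: lerD => //.
exact: le_trans sum err.
Qed.
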